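(* Let $d\ge2$, $d\le q<\infty$, and let $\beta,\gamma>0$ satisfy $0<\gamma\le d/q$, $\gamma<d-1$ and $$\beta+\gamma=\frac dq.$$ Then, for every $1\le r\le s\le\infty$, there is a constant $C$ such that for every $u\in C_c^\infty(\mathbb R^d)$ $$\big\||x|^{-\beta}u\big\|_{L^{q,s}}\le C\,\big\||x|^\gamma\nabla u\big\|_{L^{d,r}}.$$ Moreover, the relation $\beta+\gamma=d/q$ is necessary: if such an inequality holds (with some constant $C$) for every $u\in C_c^\infty(\mathbb R^d)$, then $\beta+\gamma=d/q$.
   Context: For a measurable $f$ on $\mathbb R^d$ with decreasing rearrangement $f^*$, $\|f\|_{L^{a,b}}:=\big(\frac ba\int_0^\infty[t^{1/a}f^*(t)]^b\frac{dt}t\big)^{1/b}$ for $0<a,b<\infty$, and $\|f\|_{L^{a,\infty}}:=\sup_{t>0}t^{1/a}f^*(t)$; for vector fields the norm is that of the pointwise Euclidean length. *)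

(* Defs.v *)
From HB Require Import structures.
From mathcomp Require Import all_boot all_order all_algebra.
From mathcomp Require Import all_classical all_reals all_analysis.

Set Implicit Arguments.
Unset Strict Implicit.
Unset Printing Implicit Defensive.

Import Order.TTheory GRing.Theory Num.Theory.
Import numFieldNormedType.Exports.

Local Open Scope classical_set_scope.
Local Open Scope ring_scope.

(* The library has no Lebesgue measure on R^n. The row vectors 'rV[R]_n get the
   sigma-algebra generated by the coordinates, i.e. the Borel sigma-algebra. *)

Definition rV_display : measure_display -> measure_display.
Proof. exact. Qed.

Section measurable_rV.
Variables (R : realType) (n : nat).

Definition rV_coord (i : 'I_n) (v : 'rV[R]_n) : measurableTypeR R := v 0 i.

Let rV_set0 : g_sigma_preimage rV_coord set0.
Proof. exact: sigma_algebra0. Qed.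

Let rV_setC A : g_sigma_preimage rV_coord A -> g_sigma_preimage rV_coord (~` A).
Proof. exact: sigma_algebraC. Qed.

Let rV_bigcup (F : _^nat) : (forall i, g_sigma_preimage rV_coord (F i)) ->
  g_sigma_preimage rV_coord (\bigcup_i (F i)).
Proof. exact: sigma_algebra_bigcup. Qed.

HB.instance Definition _ := @isMeasurable.Build
  (rV_display default_measure_display) 'rV[R]_n
  (g_sigma_preimage rV_coord) rV_set0 rV_setC rV_bigcup.

Lemma measurable_rV_coord (i : 'I_n) : measurable_fun [set: 'rV[R]_n] (rV_coord i).
Proof.
move=> _ Y mY; rewrite setTI; apply: sub_sigma_algebra => /=.
rewrite -bigcup_seq/=; exists i => /=; first by rewrite mem_index_enum.
by exists Y => //; rewrite setTI.
Qed.

Lemma measurable_fun_rVP d (T : measurableType d) (f : T -> 'rV[R]_n) :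
  (forall i, measurable_fun [set: T] (rV_coord i \o f)) ->
  measurable_fun [set: T] f.
Proof.
move=> mf _ A mA; rewrite setTI.
suff : g_sigma_preimage (fun i => rV_coord i \o f) `<=` measurable.
  rewrite g_sigma_preimage_comp; apply.
  by exists A => //; rewrite setTI.
apply: smallest_sub; first exact: sigma_algebra_measurable.
rewrite -bigcup_seq; apply: bigcup_sub => i _.
by move=> _ [B mB <-]; exact: mf.
Qed.

End measurable_rV.

Section lebesgue_rV_step.
Variables (R : realType) (n : nat).

Definition rV_cons (p : measurableTypeR R * 'rV[R]_n) : 'rV[R]_n.+1 :=
  row_mx (p.1 : R)%:M p.2.

Definition rV_uncons (v : 'rV[R]_n.+1) : measurableTypeR R * 'rV[R]_n :=
  (v 0 ord0, rsubmx (v : 'rV_(1 + n))).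

Lemma rV_consK : cancel rV_cons rV_uncons.
Proof.
move=> [x y]; rewrite /rV_uncons /rV_cons /= row_mxKr; congr pair.
rewrite (_ : ord0 = lshift n ord0 :> 'I_(1 + n)); last exact/val_inj.
by rewrite [LHS](row_mxEl (x : R)%:M y) mxE eqxx.
Qed.

Lemma measurable_rV_cons : measurable_fun setT rV_cons.
Proof.
apply: measurable_fun_rVP => i.
have [j ->|j ->] := @split_ordP 1 n i.
  rewrite (_ : _ \o _ = fst)//; apply/funext => -[x y].
  by rewrite [LHS](row_mxEl (x : R)%:M y) mxE (ord1 j) eqxx.
rewrite (_ : _ \o _ = rV_coord j \o snd).
  exact: (measurableT_comp (measurable_rV_coord j)).
by apply/funext => -[x y]; rewrite [LHS](row_mxEr (x : R)%:M y).
Qed.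

Lemma measurable_rV_uncons : measurable_fun setT rV_uncons.
Proof.
apply: measurable_fun_pair; first exact: measurable_rV_coord.
apply: measurable_fun_rVP => j.
rewrite (_ : _ \o _ = rV_coord (rshift 1 j : 'I_n.+1)).
  exact: measurable_rV_coord.
by apply/funext => v; rewrite /rV_coord /= mxE.
Qed.

Variable mu : {sigma_finite_measure set 'rV[R]_n -> \bar R}.

Definition lebesgue_rV_succ : set 'rV[R]_n.+1 -> \bar R :=
  pushforward (@lebesgue_measure R \x mu)%E rV_cons.

Let succ0 : lebesgue_rV_succ set0 = 0%E.
Proof. by rewrite /lebesgue_rV_succ /pushforward preimage_set0 measure0. Qed.

Let succ_ge0 A : (0 <= lebesgue_rV_succ A)%E.
Proof. by rewrite /lebesgue_rV_succ /pushforward; exact: measure_ge0. Qed.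

Let succ_sigma_additive : semi_sigma_additive lebesgue_rV_succ.
Proof.
move=> F mF tF mUF; rewrite /lebesgue_rV_succ /pushforward preimage_bigcup.
apply: measure_semi_sigma_additive.
- by move=> i; rewrite -[X in measurable X]setTI; exact: measurable_rV_cons.
- apply/trivIsetP => i j _ _ ij; rewrite -preimage_setI.
  by move/trivIsetP : tF => -> //; rewrite preimage_set0.
- rewrite -preimage_bigcup -[X in measurable X]setTI.
  exact: measurable_rV_cons.
Qed.

HB.instance Definition _ := isMeasure.Build _ _ _ lebesgue_rV_succ
  succ0 succ_ge0 succ_sigma_additive.

Let succ_sigma_finite : sigma_finite setT lebesgue_rV_succ.
Proof.
have /sigma_finiteP[F [TF ndF Foo]] := sigma_finiteT (@lebesgue_measure R).
have /sigma_finiteP[G [TG ndG Goo]] := sigma_finiteT mu.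
exists (fun k => rV_uncons @^-1` (F k `*` G k)).
  rewrite -preimage_bigcup -[LHS](preimage_setT rV_uncons); congr preimage.
  rewrite -setXTT TF TG predeqE => -[x y]; split.
    move=> [/= [k _ Fkx] [l _ Gly]]; exists (maxn k l) => //; split.
    - by move: x Fkx; exact/subsetPset/ndF/leq_maxl.
    - by move: y Gly; exact/subsetPset/ndG/leq_maxr.
  by move=> [k _ []/= ? ?]; split; exists k.
move=> k; have [mFk Fk] := Foo k; have [mGk Gk] := Goo k; split.
  rewrite -[X in measurable X]setTI; apply: measurable_rV_uncons => //.
  exact: measurableX.
rewrite /lebesgue_rV_succ /pushforward -comp_preimage.
rewrite (_ : _ \o _ = id); last exact/funext/rV_consK.
by rewrite preimage_id product_measure1E// lte_mul_pinfty// ge0_fin_numE.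
Qed.

HB.instance Definition _ := Measure_isSigmaFinite.Build _ _ _ lebesgue_rV_succ
  succ_sigma_finite.

End lebesgue_rV_step.

(* n-fold product of the Lebesgue measure of R; 'rV[R]_0 is a point of mass 1. *)
Fixpoint lebesgue_rV (R : realType) (n : nat) :
    {sigma_finite_measure set 'rV[R]_n -> \bar R} :=
  match n with
  | 0 => \d_(0 : 'rV[R]_0)
  | n.+1 => lebesgue_rV_succ (lebesgue_rV R n)
  end.

Section lorentz.
Variables (T : Type) (R : realType) (mu : set T -> \bar R).
Local Open Scope ereal_scope.

Definition rearrangement (f : T -> R) (t : R) : \bar R :=
  ereal_inf [set l%:E | l in
    [set l : R | (0 <= l)%R /\ mu [set x | (l < `|f x|)%R] <= t%:E]].

(* Meant for a > 0 and b > 0; the value at b = -oo is irrelevant. *)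
Definition lorentz_norm (a : R) (b : \bar R) (f : T -> R) : \bar R :=
  match b with
  | b%:E =>
      ((b / a)%:E * \int[lebesgue_measure]_(t in `]0%R, +oo[)
         ((((t `^ a^-1)%:E * rearrangement f t) `^ b) * (t^-1)%:E)) `^ b^-1
  | +oo => ereal_sup [set (t `^ a^-1)%:E * rearrangement f t | t in `]0%R, +oo[]
  | -oo => 0
  end.

End lorentz.

Section calculus.
Variables (R : realType) (n : nat).
Implicit Types (u : 'rV[R]_n -> R) (x : 'rV[R]_n).

(* The norm of the library on 'rV[R]_n is the sup norm. *)
Definition eucl_norm x : R := Num.sqrt (\sum_(i < n) x 0 i ^+ 2).

Definition partial (i : 'I_n) u : 'rV[R]_n -> R := 'D_(delta_mx 0 i) u.

Definition gradient u x : 'rV[R]_n := \row_i partial i u x.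

Definition iter_partial (s : seq 'I_n) u : 'rV[R]_n -> R := foldr partial u s.

Definition smooth u : Prop := forall s : seq 'I_n,
  continuous (iter_partial s u) /\
  forall (i : 'I_n) x, derivable (iter_partial s u) x (delta_mx 0 i).

Definition Cc_infty u : Prop :=
  smooth u /\ compact (closure [set x | u x != 0]).

End calculus.

(* Main.v *)
(* In dimension n, averaging u(p) = - int_0^oo <grad u(p + t z), z> dt over z in
   [1,2]^n bounds |u(p)| by the potential int |grad u(y)| |y - p|^(1-n) dy in the sup
   norm, without polar coordinates. For sets E, F of measure t, s the bilinear form
     int_E int_F |x|^-b |x-y|^(1-n) |y|^-c dy dx
   is at most a constant times the minimum of t^((1-b)/n) s^(1-c/n) and
   t^(1-b/n) s^((1-c)/n): two restricted weak-type bounds whose exponents lie on both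
   sides of (1/n, 1/q) when b + c = n/q. Testing on the level sets of |x|^-b u and
   slicing |x|^c |grad u| into level sets, this gives
     t^(1/q) (|x|^-b u)^*(t) <= K int_0^oo k(s/t) s^(1/n) (|x|^c |grad u|)^*(s) ds/s
   with k(x) = min(x^e0, x^-e1), e0, e1 > 0, and Schur's test on (0,oo) with the measure
   ds/s concludes. Necessity of b + c = n/q follows from dilating a bump. *)
Require Import Defs.
From HB Require Import structures.
From mathcomp Require Import all_boot all_order all_algebra.
From mathcomp Require Import all_classical all_reals all_analysis.
From mathcomp Require Import measurable_realfun.
From mathcomp Require Import ring lra.

Set Implicit Arguments.
Unset Strict Implicit.
Unset Printing Implicit Defensive.

Import Order.TTheory GRing.Theory Num.Theory.
Import numFieldNormedType.Exports.
Local Open Scope classical_set_scope.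
Local Open Scope ring_scope.

(** * One-dimensional integrals *)

(** Since [d <= q], the relation [beta + gamma = d / q] between positive exponents puts both in ]0,
    1[. Each weight can then be merged with the kernel |x - y|^(1-n) into a function that is still
    locally integrable, uniformly in the other variable. The gradient sits at the exponent n, where
    the unweighted potential just misses the bounded functions. The weight |y|^-c opens a gap there:
    the two restricted estimates carry s^(1-c/n) and s^((1-c)/n), at distances (n-1-c)/n and c/n
    from the target s^(1/n). These distances become the decay rates of the Schur kernel. Keeping
    both estimates in one minimum carries out the interpolation on rearrangements directly, so that
    a single inequality serves all second indices; [r <= s] is used to reach s from the two cases s
    = r and s = oo. A recurring technical point is the convention that a negative power of 0 is 0:
    kernels and weights vanish at their singularity, which is harmless in upper bounds for them but
    must be handled wherever they are bounded from below. *)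

Section nonneg_integral.
Local Open Scope ereal_scope.
Context {d} {T : measurableType d} {R : realType} (mu : {measure set T -> \bar R}).

(** The integral of a nonnegative function is a supremum over its simple minorants, and a larger
    integrand has more of them. Iterated integrals and rearrangements can thus be compared as they
    stand. *)
Lemma ge0_le_integral_nomeas (D : set T) (f g : T -> \bar R) :
  (forall x, D x -> 0 <= f x) -> (forall x, D x -> f x <= g x) ->
  \int[mu]_(x in D) f x <= \int[mu]_(x in D) g x.
Proof.
move=> f0 fg; rewrite ge0_integralE// ge0_integralE; last first.
  by move=> x Dx; apply: le_trans (fg _ Dx); exact: f0.
apply: ereal_sup_le => _ /= [h hf <-]; exists h => // x.
apply: (le_trans (hf x)); apply: lee_restrict => //.
Qed.

End nonneg_integral.

Section power_integrals.
Context {R : realType}.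
Local Notation leb := (@lebesgue_measure R).

Lemma is_derive_powR_div (a x : R) : a != 0 -> 0 < x ->
  is_derive x 1 (fun y => y `^ a / a) (x `^ (a - 1)).
Proof.
move=> a0 x0; have h := is_derive1_powR a x0.
rewrite (_ : (fun y => y `^ a / a) = a^-1 \*: (fun y : R => y `^ a)); last first.
  by apply/funext => y /=; rewrite mulrC.
by apply: is_derive_eq; rewrite /= [_ *: _]mulrA mulVf// mul1r.
Qed.

Lemma continuous_powR_gt0 (a x : R) : 0 < x -> {for x, continuous (fun y : R => y `^ a)}.
Proof.
move=> x0; apply: differentiable_continuous.
by apply/derivable1_diffP; apply: derivable_powR; rewrite in_itv/= x0.
Qed.

Lemma integral_powR_cc (a S T : R) : a != 0 -> 0 < S -> S < T ->
  (\int[leb]_(x in `[S, T]) (x `^ (a - 1))%:E = (T `^ a / a - S `^ a / a)%:E)%E.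
Proof.
move=> a0 S0 ST.
have h (x : R) : S <= x -> is_derive x 1 (fun y => y `^ a / a) (x `^ (a - 1)).
  by move=> Sx; apply: is_derive_powR_div => //; exact: lt_le_trans Sx.
rewrite (@continuous_FTC2 _ _ (fun y => y `^ a / a)) ?EFinB//.
- apply: continuous_in_subspaceT => x; rewrite inE/= in_itv/= => /andP[Sx _].
  by apply: continuous_powR_gt0; exact: lt_le_trans Sx.
- have cF x : S <= x -> {for x, continuous (fun y => y `^ a / a)}.
    move=> /h [dx _]; apply: differentiable_continuous; exact/derivable1_diffP.
  split.
  + by move=> x; rewrite in_itv/= => /andP[/ltW /h [] ].
  + apply: cvg_at_right_filter; exact: cF.
  + apply: cvg_at_left_filter; apply: cF; exact: ltW.
- move=> x; rewrite in_itv/= => /andP[/ltW /h [_ <-] _].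
  by rewrite derive1E.
Qed.

Lemma integral_powR_0 (a T : R) : 0 < a -> 0 < T ->
  (\int[leb]_(x in `]0%R, T]) (x `^ (a - 1))%:E = (T `^ a / a)%:E)%E.
Proof.
move=> a0 T0.
(* The integrand may blow up at 0, so the interval is exhausted from the right. The shift by 2 makes
   T / (n+2) strictly less than T already for n = 0, as [integral_powR_cc] demands. *)
pose F := fun n : nat => `[T / n.+2%:R, T]%classic.
have -> : `]0, T]%classic = \bigcup_n F n.
  apply/seteqP; split => x; rewrite /F /= in_itv/=.
    move=> /andP[x0 xT].
    have [n _ /(_ _ (leqnn _)) h] : \forall n \near \oo, T / n.+2%:R < x.
      near=> n; rewrite ltr_pdivrMr// mulrC -ltr_pdivrMr//.
      apply: (@lt_trans _ _ n%:R); last by rewrite ltr_nat.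
      near: n; exact: nbhs_infty_gtr.
    by exists n => //=; rewrite in_itv/= xT ltW.
  move=> [n _] /=; rewrite in_itv/= => /andP[h ->]; rewrite andbT.
  by apply: lt_le_trans h; rewrite divr_gt0.
have h1 : (\int[leb]_(x in F i) (x `^ (a - 1))%:E @[i --> \oo] -->
   \int[leb]_(x in \bigcup_i F i) (x `^ (a - 1))%:E)%E.
  apply: ge0_nondecreasing_set_cvg_integral.
  - move=> m n mn; apply/subsetPset => x; rewrite /F/= !in_itv/= => /andP[h ->].
    rewrite andbT; apply: le_trans h; rewrite ler_pM2l// lef_pV2 ?posrE//.
    by rewrite ler_nat !ltnS.
  - by move=> i; exact: measurable_itv.
  - move=> i; apply/measurable_EFinP; apply: measurable_funTS.
    exact: measurable_powR.
  - by move=> i x _; rewrite lee_fin powR_ge0.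
apply: (cvg_unique _ h1) => //.
rewrite [X in X @ _](_ : _ = fun n : nat =>
    (T `^ a / a - T `^ a / a * (n.+2%:R^-1 `^ a))%:E); last first.
  apply/funext => n; rewrite integral_powR_cc ?gt_eqF ?divr_gt0//; last first.
    by rewrite ltr_pdivrMr// ltr_pMr// ltr1n.
  by rewrite powRM ?ltW ?invr_gt0// mulrAC.
apply: cvg_EFin; first by near=> n.
rewrite -[X in _ --> X]subr0 -[X in _ - X](mulr0 (T `^ a / a)).
apply: cvgB; first exact: cvg_cst.
apply: cvgM; first exact: cvg_cst.
apply: (cvg_comp _ _ _ (powR_cvg0 a0)).
move=> A [e /= e0 He].
near=> n; apply: He => //=.
rewrite sub0r normrN ger0_norm ?invr_ge0// invf_plt ?posrE//.
apply: (@lt_trans _ _ n%:R); last by rewrite ltr_nat.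
near: n; exact: nbhs_infty_gtr.
Unshelve. all: by end_near. Qed.

Lemma integral_powR_y (a T : R) : 0 < a -> 0 < T ->
  (\int[leb]_(x in `[T, +oo[) (x `^ (- a - 1))%:E = (T `^ (- a) / a)%:E)%E.
Proof.
move=> a0 T0.
have h (x : R) : T <= x ->
    is_derive x 1 (fun y => y `^ (- a) / (- a)) (x `^ (- a - 1)).
  move=> Tx; apply: is_derive_powR_div; first by rewrite oppr_eq0 gt_eqF.
  exact: lt_le_trans Tx.
have cF x : T <= x -> {for x, continuous (fun y => y `^ (- a) / (- a))}.
  move=> /h [dx _]; apply: differentiable_continuous; exact/derivable1_diffP.
rewrite (@ge0_continuous_FTC2y _ _ (fun y => y `^ (- a) / (- a)) _ 0).
- by rewrite sub0e -EFinN invrN mulrN opprK.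
- by move=> x _; rewrite powR_ge0.
- apply: continuous_in_subspaceT => x; rewrite inE/= in_itv/= => /andP[Sx _].
  by apply: continuous_powR_gt0; exact: lt_le_trans Sx.
- rewrite -[X in _ --> X](mul0r (- a)^-1); apply: cvgM; last exact: cvg_cst.
  apply/cvgrPdist_lt => e e0; near=> x.
  have x0 : 0 < x by near: x; apply: nbhs_pinfty_gt.
  rewrite sub0r normrN ger0_norm ?powR_ge0// powRN.
  rewrite invf_plt ?posrE ?powR_gt0//.
  have -> : e^-1 = (e^-1 `^ a^-1) `^ a.
    by rewrite -powRrM mulVf ?gt_eqF// powRr1// ltW// invr_gt0.
  apply: gt0_ltr_powR => //; first by rewrite nnegrE powR_ge0.
    by rewrite nnegrE ltW.
- by move=> x /ltW /h [].
- by apply: cvg_at_right_filter; apply: cF.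
- by move=> x; rewrite in_itv/= andbT => /ltW /h [_ <-]; rewrite derive1E.
Unshelve. all: by end_near. Qed.

(** The common shape of the majorants below: one power up to a threshold and another beyond it. It
    serves the layer-cake bound for Riesz kernels and both marginals of the Schur kernel. *)
Lemma integral_piecewise_powR (a b c1 c2 T : R) :
  0 < a -> 0 < b -> 0 <= c1 -> 0 <= c2 -> 0 < T ->
  (\int[leb]_(x in `]0%R, +oo[)
     (if x <= T then c1 * x `^ (a - 1) else c2 * x `^ (- b - 1))%:E =
   (c1 * (T `^ a / a) + c2 * (T `^ (- b) / b))%:E)%E.
Proof.
move=> a0 b0 c10 c20 T0.
have mp c e (D : set R) : measurable_fun D (fun x : R => (c * x `^ e)%:E).
  apply: measurable_funTS; apply/measurable_EFinP; exact: measurable_funM.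
have mp0 e (D : set R) : measurable_fun D (fun x : R => (x `^ e)%:E).
  by apply: measurable_funTS; exact/measurable_EFinP.
have mif : measurable_fun setT (fun x : R =>
    (if x <= T then c1 * x `^ (a - 1) else c2 * x `^ (- b - 1))%:E).
  apply/measurable_EFinP; apply: measurable_fun_ifT.
  - exact: measurable_fun_ler.
  - exact: measurable_funM.
  - exact: measurable_funM.
have -> : `]0, +oo[%classic = `]0, T] `|` `]T, +oo[.
  apply/seteqP; split => x /=; rewrite !in_itv/= !andbT.
    by move=> x0; case: (leP x T) => xT; [left; rewrite x0|right].
  by move=> [/andP[]//|]; exact: lt_trans.
rewrite ge0_integral_setU//=.
- rewrite EFinD; congr (_ + _)%E.
    rewrite EFinM -integral_powR_0// -ge0_integralZl_EFin//.
    + by apply: eq_integral => x; rewrite inE/= in_itv/= => /andP[_ ->].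
    + by move=> x _; rewrite lee_fin powR_ge0.
    + exact: mp0.
  rewrite EFinM -integral_powR_y// -integral_itv_obnd_cbnd; last first.
    exact: mp0.
  rewrite -ge0_integralZl_EFin//.
  + by apply: eq_integral => x; rewrite inE/= in_itv/= andbT ltNge => /negbTE ->.
  + by move=> x _; rewrite lee_fin powR_ge0.
  + exact: mp0.
- by apply: measurable_funTS.
- by move=> x _; rewrite lee_fin; case: ifP => _; rewrite mulr_ge0// powR_ge0.
- rewrite disj_set2E; apply/eqP/seteqP; split => x //= [].
  by rewrite !in_itv/= andbT => /andP[_ xT]; rewrite ltNge xT.
Qed.

End power_integrals.

(** * Tonelli, layer cake and the Lebesgue measure of R^n *)

Section tonelli.
Local Open Scope ereal_scope.
Context {d1 d2} {T1 : measurableType d1} {T2 : measurableType d2} {R : realType}.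
Variables (m1 : {sigma_finite_measure set T1 -> \bar R}).
Variables (m2 : {sigma_finite_measure set T2 -> \bar R}).

Lemma tonelli_on (A : set T1) (B : set T2) (f : T1 * T2 -> \bar R) :
  measurable A -> measurable B -> measurable_fun setT f -> (forall z, 0 <= f z) ->
  \int[m1]_(x in A) \int[m2]_(y in B) f (x, y) =
  \int[m2]_(y in B) \int[m1]_(x in A) f (x, y).
Proof.
move=> mA mB mf f0.
pose g := f \_ (A `*` B).
have g0 z : 0 <= g z by exact: erestrict_ge0.
have mg : measurable_fun setT g.
  by apply/(measurable_restrictT _ (measurableX mA mB)); exact: measurable_funTS.
have := @fubini_tonelli _ _ _ _ _ m1 m2 g mg g0.
have -> : \int[m1]_x \int[m2]_y g (x, y) = \int[m1]_(x in A) \int[m2]_(y in B) f (x, y).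
  rewrite [RHS]integral_mkcond; apply: eq_integral => x _; rewrite [RHS]patchE.
  case: ifPn => xA.
    rewrite [RHS]integral_mkcond; apply: eq_integral => y _.
    by rewrite /g !patchE in_setX/= xA.
  by apply: integral0_eq => y _; rewrite /g patchE in_setX/= (negbTE xA).
have -> : \int[m2]_y \int[m1]_x g (x, y) = \int[m2]_(y in B) \int[m1]_(x in A) f (x, y).
  rewrite [RHS]integral_mkcond; apply: eq_integral => y _; rewrite [RHS]patchE.
  case: ifPn => yB.
    rewrite [RHS]integral_mkcond; apply: eq_integral => x _.
    by rewrite /g !patchE in_setX/= yB andbT.
  by apply: integral0_eq => x _; rewrite /g patchE in_setX/= (negbTE yB) andbF.
by [].
Qed.

End tonelli.

Section layer_cake.
Local Open Scope ereal_scope.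
Context {d} {T : measurableType d} {R : realType}.
Variable mu : {sigma_finite_measure set T -> \bar R}.
Local Notation leb := (@lebesgue_measure R).

Lemma measurable_set_lt (g : T -> R) : measurable_fun setT g ->
  measurable [set z : T * measurableTypeR R | (z.2 < g z.1)%R].
Proof.
move=> mg.
have : measurable_fun setT (fun z : T * measurableTypeR R => (z.2 : R) < g z.1)%R.
  apply: measurable_fun_ltr; first exact: measurable_snd.
  exact: (measurableT_comp mg).
move=> /(_ measurableT [set true]); rewrite setTI => h.
exact: h.
Qed.

(** Write [g x] as the length of []0, g x[] and exchange integrals over the region below the graph
    of [g]. The factor [P] is there to carry an inner potential along when [g] is sliced. *)
Lemma layer_cake (g : T -> R) (P : T -> \bar R) :
  measurable_fun setT g -> measurable_fun setT P ->
  (forall x, (0 <= g x)%R) -> (forall x, 0 <= P x) ->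
  \int[mu]_x ((g x)%:E * P x) =
  \int[leb]_(l in `]0%R, +oo[) \int[mu]_(x in [set x | (l < g x)%R]) P x.
Proof.
move=> mg mP g0 P0.
pose S := [set z : T * measurableTypeR R | (z.2 < g z.1)%R].
have mS : measurable S by exact: measurable_set_lt.
pose f := (P \o fst) \_ S.
have f0 z : 0 <= f z by apply: erestrict_ge0 => x _; exact: P0.
have mf : measurable_fun setT f.
  apply/(measurable_restrictT _ mS); apply: measurable_funTS.
  exact: measurableT_comp mP measurable_fst.
have := @tonelli_on _ _ _ _ _ mu leb _ _ f measurableT (measurable_itv `]0%R, +oo[) mf f0.
have -> : \int[mu]_x \int[leb]_(l in `]0%R, +oo[) f (x, l) =
    \int[mu]_x ((g x)%:E * P x).
  apply: eq_integral => x _.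
  transitivity (\int[leb]_(l in `]0%R, g x[) (cst (P x)) l).
    rewrite integral_mkcond [RHS]integral_mkcond; apply: eq_integral => l _.
    rewrite /f !patchE/= !mem_setE !in_itv/= andbT.
    by case: (ltP 0%R l) => //= l0; congr (if _ then _ else _); apply/idP/idP; rewrite inE.
  rewrite integral_cst//= muleC lebesgue_measure_itv/= lte_fin.
  rewrite sube0; case: ltP => // gx; have -> // : g x = 0%R.
  by apply/eqP; rewrite eq_le gx g0.
move=> ->.
apply: eq_integral => l _.
rewrite [RHS]integral_mkcond; apply: eq_integral => x _.
by rewrite /f !patchE/= /S; congr (if _ then _ else _); apply/idP/idP; rewrite !inE.
Qed.

Lemma layer_cake_on (D : set T) (g : T -> R) (P : T -> \bar R) :
  measurable D -> measurable_fun setT g -> measurable_fun setT P ->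
  (forall x, (0 <= g x)%R) -> (forall x, 0 <= P x) ->
  \int[mu]_(x in D) ((g x)%:E * P x) =
  \int[leb]_(l in `]0%R, +oo[) \int[mu]_(x in D `&` [set x | (l < g x)%R]) P x.
Proof.
move=> mD mg mP g0 P0.
rewrite integral_mkcond.
transitivity (\int[mu]_x ((g x)%:E * (P \_ D) x)).
  by apply: eq_integral => x _; rewrite !patchE; case: ifP; rewrite ?mule0.
rewrite layer_cake//.
- by apply: eq_integral => l _; rewrite -integral_mkcondr setIC.
- by apply/(measurable_restrictT _ mD); exact: measurable_funTS.
- by move=> x; exact: erestrict_ge0.
Qed.

Lemma layer_cake1 (D : set T) (g : T -> R) :
  measurable D -> measurable_fun setT g -> (forall x, (0 <= g x)%R) ->
  \int[mu]_(x in D) (g x)%:E =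
  \int[leb]_(l in `]0%R, +oo[) mu (D `&` [set x | (l < g x)%R]).
Proof.
move=> mD mg g0.
transitivity (\int[mu]_(x in D) ((g x)%:E * cst 1 x)).
  by apply: eq_integral => x _; rewrite mule1.
rewrite layer_cake_on//; apply: eq_integral => l _.
rewrite integral_cst ?mul1e//; apply: measurableI => //.
rewrite -[X in measurable X]setTI.
by have := mg measurableT _ (measurable_itv `]l, +oo[); congr (measurable (_ `&` _));
  apply/seteqP; split => x /=; rewrite in_itv/= andbT.
Qed.

End layer_cake.

(** * Affine changes of variables and the volume of boxes *)

Section affine.
Local Open Scope ereal_scope.
Context {R : realType}.
Local Notation leb := (@lebesgue_measure R).

Lemma measurable_affine (x t : R) :
  measurable_fun setT (fun z : measurableTypeR R => (x + t * z)%R : measurableTypeR R).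
Proof. by apply: measurable_funD => //; exact: measurable_funM. Qed.

(** The image of Lebesgue measure under z -> x + t z, multiplied by t, gives half-open intervals
    their length; uniqueness of Lebesgue measure identifies the two measures. *)
Lemma integral_affine1 (G : R -> \bar R) (x t : R) : (0 < t)%R ->
  measurable_fun setT G -> (forall y, 0 <= G y) ->
  \int[leb]_y G y = t%:E * \int[leb]_z G (x + t * z)%R.
Proof.
move=> t0 mG G0.
pose phi (z : measurableTypeR R) : measurableTypeR R := (x + t * z)%R.
have mphi : measurable_fun setT phi by exact: measurable_affine.
pose tn := NngNum (ltW t0).
pose m0 : {measure set (measurableTypeR R) -> \bar R} := mscale tn (pushforward leb phi).
pose m := m0 mphi.
have lm A : measurable A -> leb A = m A.
  apply: (@lebesgue_measure_unique _ m) => //= _ [[a b]] _ <-.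
  rewrite /m/m0/= /mscale /= /pushforward.
  have -> : phi @^-1` `]a, b]%classic = `]((a - x) / t)%R, ((b - x) / t)%R]%classic.
    apply/seteqP; split => z /=; rewrite /phi !in_itv/= ltr_pdivrMr// ler_pdivlMr//;
      by rewrite ltrBlDl lerBrDl mulrC.
  rewrite [LHS](lebesgue_measure_itv (Interval (BRight a) (BRight b))).
  rewrite [in RHS](lebesgue_measure_itv (Interval (BRight _) (BRight _)))/= !lte_fin.
  rewrite ltr_pM2r ?invr_gt0// ltrD2r; case: ifPn => _; last by rewrite mule0.
  rewrite -!EFinB -EFinM; congr EFin; field; exact: lt0r_neq0.
transitivity (\int[m]_y G y).
  by apply: eq_measure_integral => A mA _; exact: lm.
rewrite /m/m0 ge0_integral_mscale//; congr (_ * _).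
by rewrite ge0_integral_pushforward.
Qed.

End affine.

Section lebesgue_rV_theory.
Local Open Scope ereal_scope.
Context {R : realType}.
Local Notation leb := (@lebesgue_measure R).
Implicit Types n : nat.

Lemma integral_rV_succ n (f : 'rV[R]_n.+1 -> \bar R) :
  measurable_fun setT f -> (forall v, 0 <= f v) ->
  \int[lebesgue_rV R n.+1]_v f v =
  \int[leb]_a \int[lebesgue_rV R n]_y f (rV_cons (a, y)).
Proof.
move=> mf f0.
have h := @ge0_integral_pushforward _ _ _ _ R (@rV_cons R n)
  (@measurable_rV_cons R n) (leb \x lebesgue_rV R n) setT f measurableT mf
  (fun v _ => f0 v).
rewrite [LHS]h.
rewrite preimage_setT fubini_tonelli1//; last by move=> x; exact: f0.
exact: (measurableT_comp mf (@measurable_rV_cons R n)).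
Qed.

Lemma measurable_rV_affine n d (T : measurableType d) (f : T -> 'rV[R]_n) (t : T -> R)
    (g : T -> 'rV[R]_n) :
  measurable_fun setT f -> measurable_fun setT t -> measurable_fun setT g ->
  measurable_fun setT (fun z => (f z + t z *: g z)%R).
Proof.
move=> mf mt mg; apply: measurable_fun_rVP => i.
rewrite (_ : _ \o _ = (fun z => rV_coord i (f z) + t z * rV_coord i (g z))%R); last first.
  by apply/funext => z; rewrite /rV_coord /= !mxE.
apply: measurable_funD; first exact: (measurableT_comp (measurable_rV_coord i)).
by apply: measurable_funM => //; exact: (measurableT_comp (measurable_rV_coord i)).
Qed.

Lemma rV_cons0 n (b : R) (y : 'rV[R]_n) : rV_cons (b, y) 0%R ord0 = b.
Proof. by have := rV_consK (b, y); rewrite /rV_uncons => -[]. Qed.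

Lemma rV_consS n (b : R) (y : 'rV[R]_n) i :
  rV_cons (b, y) 0%R (rshift 1 i : 'I_n.+1) = y 0%R i.
Proof. by rewrite [LHS](row_mxEr (b : R)%:M y). Qed.

Lemma ordS_cases n (i : 'I_n.+1) : i = ord0 \/ exists j : 'I_n, i = rshift 1 j.
Proof.
have [j ->|j ->] := @split_ordP 1 n i; last by right; exists j.
by left; apply/val_inj; rewrite /= ord1.
Qed.

Lemma rV_cons_affine n (a b t : R) (x y : 'rV[R]_n) :
  rV_cons ((a + t * b)%R, (x + t *: y)%R) = (rV_cons (a, x) + t *: rV_cons (b, y))%R.
Proof.
apply/rowP => i.
have -> : (rV_cons (a, x) + t *: rV_cons (b, y))%R 0%R i =
    (rV_cons (a, x) 0%R i + t * rV_cons (b, y) 0%R i)%R by rewrite !mxE.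
by have [->|[j ->]] := ordS_cases i; rewrite ?rV_cons0// !rV_consS !mxE.
Qed.

Lemma rV_unconsK n : cancel (@rV_uncons R n) (@rV_cons R n).
Proof.
move=> v; apply/rowP => i; rewrite /rV_uncons.
by have [->|[j ->]] := ordS_cases i; rewrite ?rV_cons0// rV_consS mxE.
Qed.

(** The map acts coordinatewise, so induction on the dimension peels off one coordinate, and one
    factor t, at a time. *)
Lemma integral_affine n (G : 'rV[R]_n -> \bar R) (x : 'rV[R]_n) (t : R) : (0 < t)%R ->
  measurable_fun setT G -> (forall y, 0 <= G y) ->
  \int[lebesgue_rV R n]_y G y =
  (t ^+ n)%:E * \int[lebesgue_rV R n]_z G (x + t *: z)%R.
Proof.
move=> t0; elim: n G x => [|n IH] G x mG G0.
  by rewrite expr0 mul1e; apply: eq_integral => y _; congr G; apply/rowP => -[].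
have mGc a : measurable_fun setT (fun y => G (rV_cons (a, y))).
  apply: (measurableT_comp mG); apply: (measurableT_comp (@measurable_rV_cons R n)).
  exact: measurable_pair1.
have mF : measurable_fun setT (fun a => \int[lebesgue_rV R n]_y G (rV_cons (a, y))).
  apply: (@measurable_fun_fubini_tonelli_F _ _ _ _ _ (lebesgue_rV R n)
     (fun z => G (rV_cons z))) => //.
  exact: (measurableT_comp mG (@measurable_rV_cons R n)).
have mGx : measurable_fun setT (fun z : 'rV[R]_n.+1 => G (x + t *: z)%R).
  by apply: (measurableT_comp mG); exact: measurable_rV_affine.
rewrite integral_rV_succ// integral_rV_succ//.
rewrite -(rV_unconsK x); case: (rV_uncons x) => a0 x0.
under [in RHS]eq_integral do under eq_integral do rewrite -rV_cons_affine.
rewrite (integral_affine1 a0 t0)//; last by move=> y; exact: integral_ge0.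
rewrite exprS EFinM -muleA; congr (_ * _).
rewrite -ge0_integralZl_EFin//.
- apply: eq_integral => z _.
  by rewrite (IH (fun y => G (rV_cons ((a0 + t * z)%R, y))) x0).
- by move=> y _; exact: integral_ge0.
- apply: (@measurable_fun_fubini_tonelli_F _ _ _ _ _ (lebesgue_rV R n)
     (fun z : measurableTypeR R * 'rV[R]_n =>
       G (rV_cons ((a0 + t * (z.1 : R))%R, (x0 + t *: z.2)%R)))) => //.
  apply: (measurableT_comp mG); apply: (measurableT_comp (@measurable_rV_cons R n)).
  apply: measurable_fun_pair => /=.
    by apply: (measurableT_comp (measurable_affine a0 t)); exact: measurable_fst.
  by apply: measurable_rV_affine => //; exact: measurable_snd.
- by rewrite exprn_ge0// ltW.
Qed.

Lemma measurable_rV_box n (a b : 'rV[R]_n) :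
  measurable [set v : 'rV[R]_n | forall i, (a 0%R i <= v 0%R i <= b 0%R i)%R].
Proof.
rewrite (_ : [set _ | _] =
    \bigcap_(i in [set: 'I_n]) (rV_coord i @^-1` `[a 0%R i, b 0%R i]%classic)).
  apply: fin_bigcap_measurable => // i _; rewrite -[X in measurable X]setTI.
  exact: measurable_rV_coord.
apply/seteqP; split => v /= h i; last by have := h i I; rewrite /= in_itv.
by move=> _ /=; rewrite in_itv/=; exact: h.
Qed.

Lemma lebesgue_rV_box n (a : 'rV[R]_n) (l : R) : (0 <= l)%R ->
  lebesgue_rV R n [set v : 'rV[R]_n | forall i, (a 0%R i <= v 0%R i <= a 0%R i + l)%R] =
  (l ^+ n)%:E.
Proof.
move=> l0; elim: n a => [|n IH] a.
  by rewrite expr0 /= diracE mem_set// => -[].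
rewrite /= /lebesgue_rV_succ /pushforward -(rV_unconsK a); case: (rV_uncons a) => a0 x0.
rewrite (_ : _ @^-1` _ = `[a0, (a0 + l)%R]%classic `*`
    [set v : 'rV[R]_n | forall i, (x0 0%R i <= v 0%R i <= x0 0%R i + l)%R]).
  rewrite product_measure1E//; last first.
    have := measurable_rV_box x0 (x0 + const_mx l)%R.
    by congr measurable; apply/seteqP; split => v /= h i; have := h i; rewrite !mxE.
  transitivity (l%:E * (l ^+ n)%:E); last by rewrite -EFinM -exprS.
  congr (_ * _); last exact: IH.
  rewrite [LHS](lebesgue_measure_itv (Interval (BLeft a0) (BRight (a0 + l)%R)))/= lte_fin.
  rewrite ltrDl; case: ltP => [_|l0']; first by rewrite -EFinB addrAC subrr add0r.
  by apply/esym/eqP; rewrite eq_le !lee_fin l0 l0'.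
apply/seteqP; split => [[b y] /= h|[b y] /= [h1 h2] i].
  split; first by have := h ord0; rewrite !rV_cons0 in_itv.
  by move=> i; have := h (rshift 1 i : 'I_n.+1); rewrite !rV_consS.
have [->|[j ->]] := ordS_cases i; last by rewrite !rV_consS.
by rewrite !rV_cons0; move: h1; rewrite in_itv.
Qed.

End lebesgue_rV_theory.

(** * Sup norm, Euclidean norm and Riesz kernels *)

Section rV_norm.
Context {R : realType} {n : nat}.
Implicit Types (v x y : 'rV[R]_n).

Lemma rV_norm_leP v (r : R) : 0 <= r ->
  reflect (forall i, `|v 0 i| <= r) (`|v| <= r).
Proof.
move=> r0; rewrite [`|v|]mx_normrE; apply: (iffP idP) => [/bigmax_leP[_ h] i|h].
  exact: (h (0, i) isT).
by apply/bigmax_leP; split=> // -[i j] _ /=; rewrite ord1.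
Qed.

Lemma rV_coord_le_norm v i : `|v 0 i| <= `|v|.
Proof. exact/rV_norm_leP. Qed.

Lemma rV_coord_le_eucl v i : `|v 0 i| <= eucl_norm v.
Proof.
rewrite -[leLHS]sqrtr_sqr; apply: ler_wsqrtr.
by rewrite (bigD1 i)//= lerDl sumr_ge0// => j _; exact: sqr_ge0.
Qed.

Lemma eucl_norm_ge0 v : 0 <= eucl_norm v.
Proof. exact: sqrtr_ge0. Qed.

Lemma norm_le_eucl v : `|v| <= eucl_norm v.
Proof. by apply/rV_norm_leP => [|i]; [exact: eucl_norm_ge0|exact: rV_coord_le_eucl]. Qed.

Lemma eucl_le_norm v : eucl_norm v <= n%:R * `|v|.
Proof.
case: (posnP n) => [n0|n0].
  rewrite /eucl_norm big1 ?sqrtr0 ?mulr_ge0// => i _.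
  by have := ltn_ord i; rewrite {2}n0.
rewrite -[leRHS]ger0_norm ?mulr_ge0// -sqrtr_sqr; apply: ler_wsqrtr.
apply: (@le_trans _ _ (\sum_(i < n) `|v| ^+ 2)).
  apply: ler_sum => i _; rewrite -[v 0 i ^+ 2]real_normK ?num_real//.
  by rewrite lerXn2r ?nnegrE// rV_coord_le_norm.
rewrite sumr_const card_ord -[leLHS]mulr_natl exprMn ler_wpM2r ?sqr_ge0//.
by rewrite -natrX ler_nat; exact: leq_pmull.
Qed.

Lemma eucl_normZ (a : R) v : eucl_norm (a *: v) = `|a| * eucl_norm v.
Proof.
rewrite /eucl_norm -sqrtr_sqr -sqrtrM ?sqr_ge0// mulr_sumr; congr Num.sqrt.
by apply: eq_bigr => i _; rewrite mxE exprMn.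
Qed.

Lemma eucl_norm0 : eucl_norm (0 : 'rV[R]_n) = 0.
Proof. by rewrite -[X in eucl_norm X](scale0r 0) eucl_normZ normr0 mul0r. Qed.

Lemma measurable_rV_sub x : measurable_fun setT (fun v => v - x).
Proof.
apply: measurable_fun_rVP => i.
rewrite (_ : _ \o _ = fun v => rV_coord i v - x 0 i); last first.
  by apply/funext => v; rewrite /rV_coord/= !mxE.
by apply: measurable_funB => //; exact: measurable_rV_coord.
Qed.

Lemma measurable_eucl_norm : measurable_fun setT (@eucl_norm R n).
Proof.
rewrite (_ : @eucl_norm R n = fun v => (\sum_(i < n) rV_coord i v ^+ 2) `^ 2^-1).
  apply: (measurableT_comp (@measurable_powR _ _)).
  apply: measurable_sum => i; apply: measurable_funX; exact: measurable_rV_coord.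
apply/funext => v; rewrite /eucl_norm powR12_sqrt// sumr_ge0// => i _.
exact: sqr_ge0.
Qed.

Lemma measurable_rV_ball x (r : R) : measurable [set v | `|v - x| <= r].
Proof.
have [r0|r0] := leP 0 r; last first.
  rewrite (_ : [set _ | _] = set0)//; apply/seteqP; split => // v /=.
  by move=> h; move: r0; rewrite ltNge (le_trans (normr_ge0 _) h).
have := measurable_rV_box (x - const_mx r) (x + const_mx r).
congr measurable; apply/seteqP; split => v /=.
  move=> h; apply/rV_norm_leP => // i.
  by have := h i; rewrite !mxE ler_norml lerBlDr lerBrDr; lra.
move/rV_norm_leP => /(_ r0) h i; have := h i; rewrite !mxE ler_norml; lra.
Qed.

Lemma lebesgue_rV_ball x (r : R) : 0 <= r ->
  lebesgue_rV R n [set v | `|v - x| <= r] = ((2 * r) ^+ n)%:E.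
Proof.
move=> r0; rewrite -(lebesgue_rV_box (x - const_mx r)) ?mulr_ge0//.
congr (lebesgue_rV R n _); apply/seteqP; split => v /=.
  move/rV_norm_leP => /(_ r0) h i; have := h i; rewrite !mxE ler_norml; lra.
move=> h; apply/rV_norm_leP => // i; have := h i; rewrite !mxE ler_norml; lra.
Qed.

Lemma measurable_rV_norm : measurable_fun setT (fun v => `|v|).
Proof.
apply: (measurability _ (RGenOInfty.measurableE R)) => // _ [_ [r ->] <-].
rewrite setTI; have := measurableC (measurable_rV_ball 0 r); congr measurable.
apply/seteqP; split => v /=; rewrite in_itv/= andbT subr0 ltNge; first by move/negP.
by move=> h; apply/negP.
Qed.

(** The sigma-algebra is generated by the coordinates, the topology by the sup norm. The bridge: [U]
    is the union of the countably many closed balls with rational centre and radius 1/(k+1) that it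
    contains. *)
Lemma open_rV_measurable (U : set 'rV[R]_n) : open U -> measurable U.
Proof.
move=> oU.
pose c (q : 'rV[rat]_n) : 'rV[R]_n := map_mx ratr q.
pose B (p : 'rV[rat]_n * nat) := [set v | `|v - c p.1| <= p.2.+1%:R^-1].
have -> : U = \bigcup_p (if `[< B p `<=` U >] then B p else set0).
  apply/seteqP; split => [v Uv|v [p _]]; last by case: asboolP => // pU; exact: pU.
  have /nbhs_ballP[e /= e0 eU] := open_nbhs_nbhs (conj oU Uv).
  (* A ball of radius [r] whose centre is within [r] of [v] reaches as far as [2 * r] from [v];
     hence the 2. *)
  have [k _ /(_ _ (leqnn _)) hk] : \forall k \near \oo, 2 / e < k%:R.
    exact: nbhs_infty_gtr.
  pose r : R := k.+1%:R^-1.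
  have r0 : 0 < r by rewrite invr_gt0.
  have re : 2 * r < e.
    rewrite ltr_pdivrMr// mulrC -ltr_pdivrMr//; apply: (lt_trans hk).
    by rewrite ltr_nat.
  have h i : exists q : rat, `|v 0 i - ratr q| < r.
    have /rat_in_itvoo[q] : v 0 i - r < v 0 i + r by lra.
    by rewrite in_itv/= => hq; exists q; rewrite ltr_norml; lra.
  pose q : 'rV[rat]_n := \row_i sval (cid (h i)).
  have vq : `|v - c q| <= r.
    apply/rV_norm_leP => [|i]; first exact: ltW.
    by rewrite !mxE; case: cid => /= t; exact: ltW.
  exists (q, k) => //; rewrite asboolT// => w; rewrite /B/= => wq; apply: eU.
  rewrite mx_norm_ball /ball_/=; apply: le_lt_trans re.
  rewrite (_ : v - w = (v - c q) - (w - c q)); last by rewrite opprB addrA subrK.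
  by rewrite (le_trans (ler_normB _ _))// mulrDl !mul1r lerD.
apply: countable_bigcupT_measurable; first exact: countableP.
move=> p; case: asboolP => // _; exact: measurable_rV_ball.
Qed.

Lemma continuous_rV_measurable (f : 'rV[R]_n -> R) :
  continuous f -> measurable_fun setT f.
Proof.
move=> /continuousP cf.
apply: (measurability _ (RGenOInfty.measurableE R)) => // _ [_ [r ->] <-].
rewrite setTI; apply: open_rV_measurable; exact: cf.
Qed.

Lemma lebesgue_rV_set1 : (0 < n)%N -> lebesgue_rV R n [set 0] = 0%E.
Proof.
move=> n0; have := @lebesgue_rV_ball 0 0 (lexx _).
rewrite mulr0 expr0n eqn0Ngt n0/= => h; apply: etrans h; congr (lebesgue_rV R n _).
by apply/seteqP; split => v /=; rewrite subr0 normr_le0 => /eqP.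
Qed.

End rV_norm.

Section riesz_kernel.
Context {R : realType} {n : nat}.
Local Notation mu := (lebesgue_rV R n).

(** The part of [E] where the kernel exceeds l has measure at most t, being inside [E], and at most
    2^n l^(-n/a), being inside a ball of radius l^(-1/a). The layer-cake formula integrates the
    smaller bound. *)
Lemma integral_riesz_le (a : R) : 0 < a -> a < n%:R ->
  exists2 C : R, 0 < C & forall (E : set 'rV[R]_n) (y : 'rV[R]_n) (t : R),
    measurable E -> 0 < t -> (mu E <= t%:E)%E ->
    (\int[mu]_(x in E) (`|x - y| `^ (- a))%:E <= (C * t `^ (1 - a / n%:R))%:E)%E.
Proof.
move=> a0 an.
have n0 : 0 < n%:R :> R by exact: lt_trans an.
(* Chosen so that l^(-n/a) is l^(-b-1); [a < n] says exactly that this tail is integrable. *)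
pose b := n%:R / a - 1.
have b0 : 0 < b by rewrite subr_gt0 ltr_pdivlMr// mul1r.
exists (1 + 2 ^+ n / b).
  by rewrite ltr_pwDl// divr_ge0 ?exprn_ge0// ltW.
move=> E y t mE t0 Et.
have mN : measurable_fun setT (fun x : 'rV[R]_n => `|x - y| `^ (- a)).
  apply: (measurableT_comp (@measurable_powR _ _)).
  exact: (measurableT_comp measurable_rV_norm (measurable_rV_sub y)).
rewrite layer_cake1//.
(* The height where t and l^(-n/a) coincide. Both pieces of the integral are then multiples of
   t^(1-a/n). *)
pose T := t `^ (- (a / n%:R)).
have T0 : 0 < T by exact: powR_gt0.
apply: (@le_trans _ _ (\int[@lebesgue_measure R]_(x in `]0%R, +oo[)
     (if (x <= T)%R then t * x `^ (1 - 1) else 2 ^+ n * x `^ (- b - 1))%:E)%E).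
  apply: ge0_le_integral_nomeas => // l /=; rewrite in_itv/= andbT => l0.
  have mI : measurable (E `&` [set x | l < `|x - y| `^ (- a)]).
    apply: measurableI => //.
    have := mN measurableT _ (measurable_itv `]l, +oo[); rewrite setTI.
    by congr measurable; apply/seteqP; split => x /=; rewrite in_itv/= andbT.
  case: ifPn => _.
    rewrite subrr powRr0 mulr1; apply: le_trans Et.
    by apply: le_measure; rewrite ?inE// => ? [].
  apply: (@le_trans _ _ (mu [set x | `|x - y| <= l `^ (- a^-1)])).
    apply: le_measure; rewrite ?inE//; first exact: measurable_rV_ball.
    move=> x [_ /=] h.
    have N0 : 0 < `|x - y|.
      rewrite normr_gt0; apply/eqP => xy; move: h; rewrite xy normr0 powR0.
        by rewrite ltNge ltW.
      by rewrite oppr_eq0 gt_eqF.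
    have -> : `|x - y| = (`|x - y| `^ (- a)) `^ (- a^-1).
      by rewrite -powRrM mulrNN mulfV ?gt_eqF// powRr1.
    rewrite !powRN lef_pV2 ?posrE ?powR_gt0// -powRN ?powR_gt0//.
    by apply: ge0_ler_powR; rewrite ?nnegrE ?powR_ge0 ?invr_ge0 ?ltW.
  rewrite lebesgue_rV_ball ?powR_ge0// lee_fin exprMn -[(_ `^ _) ^+ n]powR_mulrn ?powR_ge0//.
  rewrite -powRrM (_ : - a^-1 * n%:R = - b - 1)//; rewrite /b; field.
  exact: lt0r_neq0.
rewrite integral_piecewise_powR ?(ltW t0)// lee_fin.
rewrite divr1 powRr1 ?(ltW T0)// mulrDl mul1r.
have -> : t * T = t `^ (1 - a / n%:R).
  by rewrite powRD ?(gt_eqF t0) ?implybT// powRr1// ltW.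
have -> : T `^ (- b) = t `^ (1 - a / n%:R).
  rewrite /T -powRrM; congr (_ `^ _); rewrite /b; field.
  by rewrite !lt0r_neq0.
by rewrite mulrA mulrAC lexx.
Qed.

End riesz_kernel.

(** * Bilinear bounds on sets of finite measure *)

Section riesz_bilinear.
Context {R : realType} {n : nat}.
Local Notation mu := (lebesgue_rV R n).
Local Notation kern x y := (`|x - y| `^ (1 - n%:R)).

(** Both factors are at most the corresponding powers of min(a, b). If a or b is 0, the left side is
    0 because a negative power of 0 is 0. *)
Lemma powR_mul_le (a b p q : R) : 0 <= a -> 0 <= b -> 0 < p -> 0 < q ->
  a `^ (- p) * b `^ (- q) <= a `^ (- (p + q)) + b `^ (- (p + q)).
Proof.
move=> a0 b0 p0 q0.
have E (x e : R) : 0 <= x -> 0 < e -> x = 0 -> x `^ (- e) = 0.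
  by move=> _ e0 ->; rewrite powR0// oppr_eq0 gt_eqF.
have [a00|an0] := eqVneq a 0; first by rewrite (E a)// mul0r addr_ge0// powR_ge0.
have [b00|bn0] := eqVneq b 0; first by rewrite (E b)// mulr0 addr_ge0// powR_ge0.
have {}a0 : 0 < a by rewrite lt0r an0.
have {}b0 : 0 < b by rewrite lt0r bn0.
have h (x y e : R) : 0 < x -> 0 < e -> x <= y -> y `^ (- e) <= x `^ (- e).
  move=> x0 e0 xy; have y0 := lt_le_trans x0 xy.
  rewrite !powRN lef_pV2 ?posrE ?powR_gt0//.
  by apply: ge0_ler_powR; rewrite ?nnegrE ?(ltW x0) ?(ltW y0) ?(ltW e0).
rewrite !opprD !powRD ?an0 ?bn0 ?implybT//.
have [ab|/ltW ba] := leP a b.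
  apply: (@le_trans _ _ (a `^ (- p) * a `^ (- q))).
    by rewrite ler_wpM2l ?powR_ge0// h.
  by rewrite lerDl mulr_ge0 ?powR_ge0.
apply: (@le_trans _ _ (b `^ (- p) * b `^ (- q))).
  by rewrite ler_wpM2r ?powR_ge0// h.
by rewrite lerDr mulr_ge0 ?powR_ge0.
Qed.

Lemma measurable_powR_norm (y : 'rV[R]_n) (a : R) :
  measurable_fun setT (fun x : 'rV[R]_n => `|x - y| `^ a).
Proof.
apply: (measurableT_comp (@measurable_powR _ _)).
exact: (measurableT_comp measurable_rV_norm (measurable_rV_sub y)).
Qed.

(** By [powR_mul_le] the product of weight and kernel is dominated by two Riesz kernels of exponent
    b + n - 1, centred at 0 and at y. This exponent is below n because [b < 1], and the bound does
    not see y. *)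
Lemma integral_weighted_kernel_le (b : R) : (2 <= n)%N -> 0 < b -> b < 1 ->
  exists2 C : R, 0 < C & forall (E : set 'rV[R]_n) (y : 'rV[R]_n) (t : R),
    measurable E -> 0 < t -> (mu E <= t%:E)%E ->
    (\int[mu]_(x in E) (`|x| `^ (- b) * kern x y)%:E <=
      (C * t `^ ((1 - b) / n%:R))%:E)%E.
Proof.
move=> n2 b0 b1.
have n1 : 0 < n%:R - 1 :> R by rewrite subr_gt0 ltr1n.
have n0 : 0 < n%:R :> R by rewrite (lt_trans _ (_ : 1 < _))// -subr_gt0.
have a0 : 0 < b + (n%:R - 1) by exact: addr_gt0.
have an : b + (n%:R - 1) < n%:R by lra.
have [C C0 HC] := @integral_riesz_le R n _ a0 an.
exists (C + C); first exact: addr_gt0.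
move=> E y t mE t0 Et.
apply: (@le_trans _ _ (\int[mu]_(x in E) ((`|x - 0| `^ (- (b + (n%:R - 1))))%:E +
   (`|x - y| `^ (- (b + (n%:R - 1))))%:E))%E).
  apply: ge0_le_integral_nomeas => x _.
    by rewrite lee_fin mulr_ge0// powR_ge0.
  by rewrite -EFinD lee_fin subr0 -[1 - _]opprB powR_mul_le.
have mK e w : measurable_fun E (fun x : 'rV[R]_n => (`|x - w| `^ e)%:E).
  by apply/measurable_EFinP; apply: measurable_funTS; exact: measurable_powR_norm.
rewrite ge0_integralD//.
rewrite mulrDl EFinD; have -> : (1 - b) / n%:R = 1 - (b + (n%:R - 1)) / n%:R.
  by field; exact: lt0r_neq0.
by apply: leeD; exact: HC.
Qed.

Lemma measurable_kernel : measurable_fun setT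
  (fun z : 'rV[R]_n * 'rV[R]_n => kern z.1 z.2).
Proof.
apply: (measurableT_comp (@measurable_powR _ _)).
apply: (measurableT_comp measurable_rV_norm).
rewrite (_ : (fun x => _) = fun z : 'rV[R]_n * 'rV[R]_n => z.1 + (cst (-1) z) *: z.2).
  exact: measurable_rV_affine.
by apply/funext => z; rewrite scaleN1r.
Qed.

Lemma measurable_weighted_kernel (b c : R) : measurable_fun setT
  (fun z : 'rV[R]_n * 'rV[R]_n => (`|z.1| `^ b * kern z.1 z.2 * `|z.2| `^ c)%:E).
Proof.
have mN (e : R) : measurable_fun setT (fun x : 'rV[R]_n => `|x| `^ e).
  by have := measurable_powR_norm 0 e; under eq_fun do rewrite subr0.
apply/measurable_EFinP; apply: measurable_funM.
  apply: measurable_funM; last exact: measurable_kernel.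
  exact: (measurableT_comp (mN b) measurable_fst).
exact: (measurableT_comp (mN c) measurable_snd).
Qed.

Local Open Scope ereal_scope.

(** Each entry of the minimum is one order of integration. The inner integral takes the kernel with
    its own weight and is bounded uniformly in the outer variable; the remaining weight is a Riesz
    kernel centred at 0. *)
Lemma riesz_bilinear_le (b c : R) : (2 <= n)%N ->
  (0 < b)%R -> (b < 1)%R -> (0 < c)%R -> (c < 1)%R ->
  exists2 C : R, (0 < C)%R & forall (E F : set 'rV[R]_n) (t s : R),
    measurable E -> measurable F -> (0 < t)%R -> (0 < s)%R ->
    mu E <= t%:E -> mu F <= s%:E ->
    \int[mu]_(y in F) \int[mu]_(x in E)
      (`|x| `^ (- b) * kern x y * `|y| `^ (- c))%:E <=
    (C * Num.min (t `^ ((1 - b) / n%:R) * s `^ (1 - c / n%:R))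
                 (t `^ (1 - b / n%:R) * s `^ ((1 - c) / n%:R)))%:E.
Proof.
move=> n2 b0 b1 c0 c1.
have n1 : (1 < n%:R :> R)%R by rewrite ltr1n.
have bn : (b < n%:R)%R by exact: lt_trans n1.
have cn : (c < n%:R)%R by exact: lt_trans n1.
have [B B0 HB] := @integral_riesz_le R n b b0 bn.
have [C C0 HC] := @integral_riesz_le R n c c0 cn.
have [B' B'0 HB'] := integral_weighted_kernel_le n2 b0 b1.
have [C' C'0 HC'] := integral_weighted_kernel_le n2 c0 c1.
pose M := (Num.max (C * B') (B * C'))%R.
exists M; first by rewrite lt_max mulr_gt0.
move=> E F t s mE mF t0 s0 Et Fs.
have mker := measurable_weighted_kernel (- b) (- c).
have key (A A' : set 'rV[R]_n) (f f' : 'rV[R]_n -> R) (g : 'rV[R]_n -> \bar R) (k k' : R) :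
  measurable A -> measurable_fun setT f ->
  (forall x, (0 <= f x)%R) ->
  (forall x, 0 <= g x) ->
  (forall x, g x <= k%:E) -> (0 <= k)%R -> \int[mu]_(x in A) (f x)%:E <= k'%:E ->
  \int[mu]_(x in A) ((f x)%:E * g x) <= (k * k')%:E.
  move=> mA mf f0 g0 gk k0 fk.
  apply: (@le_trans _ _ (\int[mu]_(x in A) (k%:E * (f x)%:E))).
    apply: ge0_le_integral_nomeas => x _; first by rewrite mule_ge0// lee_fin.
    by rewrite muleC lee_wpmul2r// lee_fin.
  rewrite ge0_integralZl_EFin//.
  - by rewrite EFinM lee_wpmul2l// lee_fin.
  - by move=> x _; rewrite lee_fin.
  - by apply/measurable_EFinP; exact: measurable_funTS.
have mN (e : R) : measurable_fun setT (fun x : 'rV[R]_n => `|x| `^ e)%R.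
  by have := measurable_powR_norm 0 e; under eq_fun do rewrite subr0.
have mK (D : set 'rV[R]_n) e w : measurable_fun D (fun x : 'rV[R]_n => (`|x| `^ e * kern x w)%:E).
  apply/measurable_EFinP; apply: measurable_funTS.
  exact: (measurable_funM (mN e) (measurable_powR_norm w _)).
have b1E : \int[mu]_(y in F) \int[mu]_(x in E)
      (`|x| `^ (- b) * kern x y * `|y| `^ (- c))%:E =
  \int[mu]_(y in F) ((`|y| `^ (- c))%:E *
     \int[mu]_(x in E) (`|x| `^ (- b) * kern x y)%:E).
  apply: eq_integral => y _; rewrite -ge0_integralZl_EFin ?powR_ge0//.
  by apply: eq_integral => x _; rewrite -EFinM mulrC.
have b2E : \int[mu]_(y in F) \int[mu]_(x in E)
      (`|x| `^ (- b) * kern x y * `|y| `^ (- c))%:E =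
  \int[mu]_(x in E) ((`|x| `^ (- b))%:E *
     \int[mu]_(y in F) (`|y| `^ (- c) * kern y x)%:E).
  rewrite -(@tonelli_on _ _ _ _ _ mu mu E F _ mE mF mker); last first.
    by move=> z; rewrite lee_fin !mulr_ge0 ?powR_ge0.
  apply: eq_integral => x _; rewrite -ge0_integralZl_EFin ?powR_ge0//.
  apply: eq_integral => y _ /=; rewrite -EFinM distrC; congr EFin.
  by rewrite -mulrA; congr (_ * _)%R; exact: mulrC.
have M0 : (0 <= M)%R by rewrite le_max !mulr_ge0 ?ltW.
rewrite minr_pMr// EFin_min le_min; apply/andP; split.
  rewrite b1E; apply: (@le_trans _ _
     ((B' * t `^ ((1 - b) / n%:R)) * (C * s `^ (1 - c / n%:R)))%:E).
    apply: key => //.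
    - by move=> x; apply: integral_ge0 => y _; rewrite lee_fin mulr_ge0 ?powR_ge0.
    - by move=> y; exact: HB'.
    - by rewrite mulr_ge0 ?powR_ge0// ltW.
    - by have := HC F 0%R s mF s0 Fs; under eq_integral do rewrite subr0.
  rewrite lee_fin mulrACA (mulrC B') ler_wpM2r ?mulr_ge0 ?powR_ge0//.
  by rewrite le_max lexx.
rewrite b2E; apply: (@le_trans _ _
     ((C' * s `^ ((1 - c) / n%:R)) * (B * t `^ (1 - b / n%:R)))%:E).
  apply: key => //.
  - by move=> x; apply: integral_ge0 => y _; rewrite lee_fin mulr_ge0 ?powR_ge0.
  - by move=> y; exact: HC'.
  - by rewrite mulr_ge0 ?powR_ge0// ltW.
  - by have := HB E 0%R t mE t0 Et; under eq_integral do rewrite subr0.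
rewrite lee_fin mulrC mulrACA ler_wpM2r ?mulr_ge0 ?powR_ge0//.
by rewrite le_max lexx orbT.
Qed.

End riesz_bilinear.

(** * Potential estimate for the gradient *)

Section line_derivative.
Context {R : realType} {n : nat}.
Implicit Types (u : 'rV[R]_n -> R) (p w z : 'rV[R]_n).

Lemma is_derive_line u p z (t l : R) :
  is_derive (p + t *: z) z u l -> is_derive t 1 (fun s => u (p + s *: z)) l.
Proof.
move=> [du <-].
have E : (fun h : R => h^-1 *: (((fun s => u (p + s *: z)) \o shift t) (h *: (1 : R)) -
            u (p + t *: z))) =
    (fun h => h^-1 *: ((u \o shift (p + t *: z)) (h *: z) - u (p + t *: z))).
  apply/funext => h /=; congr (_ *: (u _ - _)).
  by rewrite [h%:A]mulr1 scalerDl addrCA.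
by split; rewrite /derivable/derive E.
Qed.

(** The mean value theorem along one coordinate axis, once for each sign of [s]. *)
Lemma partial_increment_le u i w (s c e : R) :
  (forall q, derivable u q (delta_mx 0 i)) ->
  (forall s', `|s'| <= `|s| -> `|partial i u (w + s' *: delta_mx 0 i) - c| <= e) ->
  `|u (w + s *: delta_mx 0 i) - u w - s * c| <= `|s| * e.
Proof.
move=> du hs.
pose f s' := u (w + s' *: delta_mx 0 i).
pose df s' := partial i u (w + s' *: delta_mx 0 i).
have fd (x : R) : is_derive x 1 f (df x).
  by apply: is_derive_line; apply: DeriveDef.
have fc (a b : R) : {within `[a, b], continuous f}.
  by apply: derivable_within_continuous => x _; exact: ex_derive.
have -> : u w = f 0 by rewrite /f scale0r addr0.
have key (x : R) : `|x| <= `|s| -> `|s * df x - s * c| <= `|s| * e.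
  by move=> xs; rewrite -mulrBr normrM ler_wpM2l// hs.
have [s0|s0] := leP 0 s.
  have [x xs] := MVT_segment s0 (fun x _ => fd x) (fc 0 s).
  rewrite -/(f s) subr0 => ->; rewrite mulrC; apply: key.
  by move: xs; rewrite in_itv/= => /andP[x0 xs]; rewrite !ger0_norm.
have [x xs] := MVT_segment (ltW s0) (fun x _ => fd x) (fc s 0).
rewrite -/(f s) sub0r => h.
have -> : f s - f 0 = s * df x by rewrite -opprB h mulrN opprK mulrC.
apply: key.
by move: xs; rewrite in_itv/= => /andP[xs x0]; rewrite !ler0_norm ?lerN2// ltW.
Qed.

(** Smoothness is given through partial derivatives alone, whereas the rays below have arbitrary
    directions. The increment from p to p + h z is split into n moves along the axes, each
    controlled by continuity of one partial derivative. *)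
Lemma C1_is_derive u p z :
  (forall i q, derivable u q (delta_mx 0 i)) ->
  (forall i, continuous (partial i u)) ->
  is_derive p z u (\sum_i z 0 i * partial i u p).
Proof.
move=> du cu.
suff h : (fun h => h^-1 *: ((u \o shift p) (h *: z) - u p)) @ 0^' -->
    (\sum_i z 0 i * partial i u p : R).
  by split; [apply/cvg_ex; eexists; exact: h|exact/cvg_lim].
apply/cvgrPdist_le => e e0.
(* The term [n%:R * |z|] absorbs the n coordinate errors, [|z|] keeps the path in the ball where the
   partials vary little, and 1 keeps [K] positive when z = 0. *)
pose K := n%:R * `|z| + `|z| + 1.
have K0 : 0 < K by rewrite ltr_wpDl// addr_ge0// mulr_ge0.
have e'0 : 0 < e / K by rewrite divr_gt0.
have : \forall q \near p, forall i, `|partial i u q - partial i u p| <= e / K.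
  apply: (@filter_forall _ _ (fun i q => `|partial i u q - partial i u p| <= e / K) _
    (nbhs_filter p)) => i.
  have := cu i p => /cvgrPdist_le /(_ _ e'0); apply: filterS => q.
  by rewrite distrC.
move=> /nbhs_ballP[r /= r0 hr].
have hz : \forall h \near (0 : R)^', `|h| * `|z| < r.
  have : \forall h \near (0 : R), `|h| * K < r.
    exists (r / K) => /=; first by rewrite divr_gt0.
    by move=> h /=; rewrite sub0r normrN ltr_pdivlMr.
  move=> hK; apply: nbhs_dnbhs; move: hK; apply: filterS => h.
  by apply: le_lt_trans; rewrite ler_wpM2l// /K -addrA addrCA lerDl addr_ge0// mulr_ge0.
have hn0 : \forall h \near (0 : R)^', h != 0 by exact: nbhs_dnbhs_neq.
near=> h.
have h0 : h != 0 by near: h.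
have hzr : `|h| * `|z| < r by near: h.
(* [y k] retains the first k coordinates of z, so [p + h *: y k] runs along a staircase from p to p
   + h z. *)
pose y k := \row_(i < n) (if (i < k)%N then z 0 i else 0).
pose v k := u (p + h *: y k).
have y0 : y 0%N = 0 by apply/rowP => i; rewrite !mxE.
have yn : y n = z by apply/rowP => i; rewrite !mxE ltn_ord.
have tele : u (h *: z + p) - u p = \sum_(k < n) (v k.+1 - v k).
  rewrite -(big_mkord xpredT (fun k => v k.+1 - v k)) telescope_sumr//.
  by rewrite /v yn y0 scaler0 addr0 [p + _]addrC.
have step (k : 'I_n) : `|v k.+1 - v k - h * z 0 k * partial k u p| <=
    `|h * z 0 k| * (e / K).
  have -> : v k.+1 = u ((p + h *: y k) + (h * z 0 k) *: delta_mx 0 k).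
    rewrite /v -addrA -scalerA -scalerDr; congr (u (_ + _ *: _)).
    apply/rowP => i; rewrite !mxE eqxx/= ltnS leq_eqVlt.
    rewrite -(inj_eq val_inj) eq_sym/=; case: eqP => [ik|_] /=.
      by rewrite ik ltnn add0r mulr1; congr (z _ _); exact/val_inj.
    by rewrite mulr0 addr0.
  apply: partial_increment_le => // s' hs'; apply: hr.
  rewrite mx_norm_ball /ball_/=; apply: le_lt_trans hzr.
  apply/rV_norm_leP => [|i]; first by rewrite mulr_ge0.
  rewrite !mxE eqxx/=.
  have [ik|ik] := eqVneq i k.
    rewrite ik ltnn mulr0 addr0 mulr1 opprD addNKr normrN (le_trans hs')// normrM.
    by rewrite ler_wpM2l// rV_coord_le_norm.
  rewrite mulr0 addr0 opprD addNKr normrN normrM ler_wpM2l//.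
  by case: ifP => _; rewrite ?rV_coord_le_norm ?normr0.
rewrite /= tele.
have -> : \sum_i z 0 i * partial i u p - h^-1 *: \sum_(k < n) (v k.+1 - v k) =
   - (h^-1 * \sum_(k < n) (v k.+1 - v k - h * z 0 k * partial k u p)).
  rewrite [X in _ = - (_ * X)]sumrB mulrBr opprB [_ *: _]/GRing.scale/=; congr (_ - _).
  rewrite mulr_sumr; apply: eq_bigr => i _.
  by rewrite -mulrA mulKf.
rewrite normrN normrM normfV ler_pdivrMl ?normr_gt0//.
apply: (le_trans (ler_norm_sum _ _ _)).
apply: (@le_trans _ _ (\sum_(k < n) (`|h| * `|z| * (e / K)))).
  apply: ler_sum => k _; apply: (le_trans (step k)).
  by rewrite normrM ler_wpM2r ?(ltW e'0)// ler_wpM2l// rV_coord_le_norm.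
rewrite sumr_const card_ord -[leLHS]mulr_natl mulrCA -!mulrA ler_wpM2l//.
rewrite !mulrA ler_pdivrMr// mulrC ler_wpM2l ?(ltW e0)//.
by rewrite /K mulrC -addrA lerDl addr_ge0.
Unshelve. all: by end_near. Qed.

End line_derivative.

Section potential_estimate.
Context {R : realType} {n : nat}.
Local Notation mu := (lebesgue_rV R n).
Local Notation leb := (@lebesgue_measure R).
Variable u : 'rV[R]_n -> R.
Hypothesis du : forall i q, derivable u q (delta_mx 0 i).
Hypothesis cu : forall i, continuous (partial i u).
Hypothesis su : exists M : R, forall x, M < `|x| -> u x = 0.
Local Notation h x := (eucl_norm (gradient u x)).

Lemma partial_le_gradient i x : `|partial i u x| <= h x.
Proof. by have := rV_coord_le_eucl (gradient u x) i; rewrite mxE. Qed.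

Lemma measurable_gradient_norm : measurable_fun setT (fun x => h x).
Proof.
apply: (measurableT_comp measurable_eucl_norm).
apply: measurable_fun_rVP => i.
rewrite (_ : _ \o _ = partial i u); first exact: continuous_rV_measurable.
by apply/funext => x; rewrite /rV_coord/= mxE.
Qed.

Lemma continuous_line (f : 'rV[R]_n -> R) p z :
  continuous f -> continuous (fun t : R => f (p + t *: z)).
Proof.
move=> cf t; have H : (fun s : R => p + s *: z) @ t --> p + t *: z.
  apply: cvgD; first exact: cvg_cst.
  by apply: cvgZr_tmp; exact: cvg_id.
exact: (cvg_comp _ _ H (cf _)).
Qed.

Lemma increment_le_integral p z (L : R) : 0 < L ->
  (`|u (p + L *: z) - u p|%:E <=
    (n%:R * `|z|)%:E * \int[leb]_(t in `]0%R, +oo[) (h (p + t *: z))%:E)%E.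
Proof.
move=> L0.
pose df t := \sum_i z 0 i * partial i u (p + t *: z).
have cdf : continuous df.
  apply: continuous_big => [|i _ t]; first exact: add_continuous.
  apply: cvgM; first exact: cvg_cst.
  exact: (@continuous_line (partial i u) p z).
have fd (t : R) : is_derive t 1 (fun s => u (p + s *: z)) (df t).
  by apply: is_derive_line; apply: C1_is_derive.
have fc t : {for t, continuous (fun s : R => u (p + s *: z))}.
  by apply: differentiable_continuous; apply/derivable1_diffP; exact: ex_derive.
have := @continuous_FTC2 R df (fun s => u (p + s *: z)) 0 L L0.
rewrite scale0r addr0 => FTC.
have {}FTC : (\int[leb]_(x in `[0%R, L]) (df x)%:E = (u (p + L *: z) - u p)%:E)%E.
  rewrite FTC ?EFinB//.
  - exact: continuous_subspaceT.
  - split=> [t _||]; first exact: ex_derive.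
    + by apply: cvg_at_right_filter; exact: fc.
    + by apply: cvg_at_left_filter; exact: fc.
  - by move=> t _; rewrite derive1E; exact: derive_val.
have mh : measurable_fun setT (fun t : R => h (p + t *: z)).
  apply: (measurableT_comp measurable_gradient_norm).
  by apply: measurable_rV_affine.
have mdf : measurable_fun setT df by exact: continuous_measurable_fun.
rewrite -[(`|_|)%:E]/(`|_%:E|)%E -FTC.
apply: (le_trans (le_abse_integral _ _ _)) => //.
  by apply: measurable_funTS; exact/measurable_EFinP.
rewrite -ge0_integralZl_EFin ?mulr_ge0//; last 2 first.
- by move=> t _; rewrite lee_fin eucl_norm_ge0.
- by apply: measurable_funTS; exact/measurable_EFinP.
have mg : measurable_fun setT (fun t : measurableTypeR R =>
    ((n%:R * `|z|)%:E * (h (p + (t : R) *: z))%:E)%E).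
  by apply/measurable_EFinP; exact: measurable_funM.
apply: (@le_trans _ _
   (\int[leb]_(t in `[0%R, +oo[) ((n%:R * `|z|)%:E * (h (p + t *: z))%:E))%E); last first.
  by rewrite -integral_itv_obnd_cbnd//; exact: measurable_funTS.
apply: (@le_trans _ _
   (\int[leb]_(t in `[0%R, L]) ((n%:R * `|z|)%:E * (h (p + t *: z))%:E))%E); last first.
  apply: ge0_subset_integral => //; first exact: measurable_funTS.
    by move=> t _; rewrite -EFinM lee_fin !mulr_ge0 ?eucl_norm_ge0.
  by move=> t /=; rewrite !in_itv/= andbT => /andP[].
apply: ge0_le_integral_nomeas => t _; rewrite -?EFinM lee_fin//.
apply: (le_trans (ler_norm_sum _ _ _)).
apply: (@le_trans _ _ (\sum_(i < n) (`|z| * h (p + t *: z)))).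
  apply: ler_sum => i _; rewrite normrM ler_pM// ?rV_coord_le_norm//.
  exact: partial_le_gradient.
by rewrite sumr_const card_ord -[leLHS]mulr_natl mulrA.
Qed.

Lemma pointwise_le_ray p z : z != 0 ->
  (`|u p|%:E <= (n%:R * `|z|)%:E * \int[leb]_(t in `]0%R, +oo[) (h (p + t *: z))%:E)%E.
Proof.
move=> z0; have [M HM] := su.
(* Far enough to leave the support: |p + L z| is at least L |z| - |p| = |M| + 1 > M. *)
pose L := (`|M| + `|p| + 1) / `|z|.
have nz : 0 < `|z| by rewrite normr_gt0.
have L0 : 0 < L by rewrite divr_gt0// ltr_wpDl// addr_ge0.
have := @increment_le_integral p z L L0.
rewrite HM ?sub0r ?normrN//.
apply: (@lt_le_trans _ _ (`|L *: z| - `|p|)); last first.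
  by rewrite lerBlDr; have := ler_normB (p + L *: z) p; rewrite addrAC subrr add0r.
rewrite normrZ gtr0_norm// /L divfK ?gt_eqF//.
have := ler_norm M; lra.
Qed.



(** The box has measure 1, so |u p| is at most the average of its ray bounds. For fixed t the
    substitution y = p + t z costs t^-n. For fixed y with N = |y - p|, only t in [N/2, N]
    contribute, an interval of length N/2 on which t^-n is at most (N/2)^-n. The constant is n |z|
    <= 2 n from the rays times 2^(n-1) from (N/2)^(1-n). *)
Lemma pointwise_le_potential p : (0 < n)%N ->
  (`|u p|%:E <= \int[mu]_y ((n%:R * 2 ^+ n) * (`|y - p| `^ (1 - n%:R) * h y))%:E)%E.
Proof.
move=> n0.
pose A := [set z : 'rV[R]_n | forall i, 1 <= z 0 i <= 2].
have mA : measurable A.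
  have := measurable_rV_box (const_mx 1 : 'rV[R]_n) (const_mx 2).
  by congr measurable; apply/seteqP; split => z /= H i; have := H i; rewrite !mxE.
have A1 : mu A = 1%E.
  have := lebesgue_rV_box (const_mx 1 : 'rV[R]_n) ler01.
  rewrite expr1n => H; apply: etrans H; congr (mu _).
  by apply/seteqP; split => z /= H i; have := H i; rewrite !mxE.
pose i0 : 'I_n := Ordinal n0.
pose f (z : 'rV[R]_n * measurableTypeR R) := (n%:R * 2 * h (p + (z.2 : R) *: z.1))%:E.
have f0 z : (0 <= f z)%E by rewrite lee_fin !mulr_ge0 ?eucl_norm_ge0.
have mf : measurable_fun setT f.
  apply/measurable_EFinP; apply: measurable_funM => //.
  apply: (measurableT_comp measurable_gradient_norm).
  exact: measurable_rV_affine.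
(* The condition that (y - p) / t lies in the box, written without division. *)
pose S := [set z : measurableTypeR R * 'rV[R]_n |
  forall i, (z.1 : R) <= z.2 0 i - p 0 i <= 2 * (z.1 : R)].
have mS : measurable S.
  have -> : S = \bigcap_(i in [set: 'I_n])
     ([set z : measurableTypeR R * 'rV[R]_n | (z.1 : R) <= z.2 0 i - p 0 i] `&`
     [set z : measurableTypeR R * 'rV[R]_n | z.2 0 i - p 0 i <= 2 * (z.1 : R)]).
    apply/seteqP; split => z /= H i; first by move=> _ /=; have /andP[] := H i.
    by apply/andP; exact: (H i I).
  have mc i : measurable_fun setT (fun z : measurableTypeR R * 'rV[R]_n => z.2 0 i - p 0 i).
    apply: measurable_funB => //.
    exact: (measurableT_comp (measurable_rV_coord i) measurable_snd).
  have m1 : measurable_fun setT (fun z : measurableTypeR R * 'rV[R]_n => z.1 : R).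
    exact: measurable_fst.
  have mT (b : measurableTypeR R * 'rV[R]_n -> bool) :
      measurable_fun setT b -> measurable [set z | b z].
    by move=> /(_ measurableT [set true]); rewrite setTI; exact.
  apply: fin_bigcap_measurable => // i _; apply: measurableI; apply: mT.
    exact: measurable_fun_ler.
  by apply: measurable_fun_ler => //; exact: measurable_funM.
pose F (z : measurableTypeR R * 'rV[R]_n) :=
  (\1_S z * (n%:R * 2 * h z.2 * (z.1 : R) `^ (- n%:R)))%:E.
have F0 z : (0 <= F z)%E by rewrite lee_fin !mulr_ge0 ?eucl_norm_ge0 ?powR_ge0.
have mF : measurable_fun setT F.
  apply/measurable_EFinP; apply: measurable_funM; first exact: measurable_indic.
  apply: measurable_funM.
    apply: measurable_funM => //.
    exact: (measurableT_comp measurable_gradient_norm measurable_snd).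
  exact: (measurableT_comp (@measurable_powR _ _) measurable_fst).
apply: (@le_trans _ _ (\int[mu]_(z in A) \int[leb]_(t in `]0%R, +oo[) f (z, t))%E).
  rewrite -[leLHS]mule1 -[X in (_ * X)%E]A1 -integral_cst//.
  apply: ge0_le_integral_nomeas => z Az; first by rewrite lee_fin.
  have z2 : `|z| <= 2.
    by apply/rV_norm_leP => // i; have /andP[? ?] := Az i; rewrite ger0_norm// (le_trans ler01).
  have z0 : z != 0.
    by apply/eqP => z0; have := Az i0; rewrite z0 mxE ler10.
  apply: (le_trans (pointwise_le_ray p z0)).
  rewrite -ge0_integralZl_EFin ?mulr_ge0//; last 2 first.
  - by move=> t _; rewrite lee_fin eucl_norm_ge0.
  - apply: measurable_funTS; apply/measurable_EFinP.
    apply: (measurableT_comp measurable_gradient_norm).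
    exact: measurable_rV_affine.
  apply: ge0_le_integral_nomeas => t _.
    by rewrite -EFinM lee_fin !mulr_ge0 ?eucl_norm_ge0.
  by rewrite -EFinM lee_fin /= ler_wpM2r ?eucl_norm_ge0// ler_wpM2l.
rewrite (@tonelli_on _ _ _ _ _ mu leb A _ f mA (measurable_itv _) mf f0).
have -> : (\int[leb]_(t in `]0%R, +oo[) \int[mu]_(z in A) f (z, t) =
           \int[leb]_(t in `]0%R, +oo[) \int[mu]_(y in setT) F (t, y))%E.
  apply: eq_integral => t; rewrite inE/= in_itv/= andbT => t0.
  have mFt : measurable_fun setT (fun y => F (t, y)).
    by apply: (measurableT_comp mF); exact: measurable_pair1.
  rewrite [RHS](integral_affine p t0)// -ge0_integralZl_EFin ?exprn_ge0 ?(ltW t0)//; last first.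
    apply: (measurableT_comp mFt); exact: measurable_rV_affine.
  rewrite [LHS]integral_mkcond; apply: eq_integral => z _.
  rewrite patchE /F /f /= indicE.
  have -> : ((t, p + t *: z) \in S) = (z \in A).
    have E (a : R) : (t <= t * a <= 2 * t) = (1 <= a <= 2).
      by rewrite ler_pMr// [2 * t]mulrC ler_pM2l.
    apply/idP/idP; rewrite !inE /S /A /= => H i; have := H i;
      by rewrite !mxE addrAC subrr add0r E.
  case: ifP => _; last by rewrite mul0r mule0.
  rewrite mul1r -EFinM powRN powR_mulrn ?(ltW t0)// mulrCA mulfV ?mulr1//.
  by rewrite expf_neq0// gt_eqF.
rewrite (@tonelli_on _ _ _ _ _ leb mu _ _ F (measurable_itv _) measurableT mF F0).
apply: ge0_le_integral_nomeas => y _; first by apply: integral_ge0 => t _; exact: F0.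
set N := `|y - p|.
(* All coordinates of y - p lie in [t, 2t], hence so does the sup norm. The lower bound needs one
   coordinate to look at, namely [i0]. *)
have SN t : 0 < t -> S (t, y) -> t <= N <= 2 * t.
  move=> t0 H; apply/andP; split.
    have /andP[+ _] := H i0; move/le_trans; apply.
    by rewrite (le_trans (ler_norm _))//; have := rV_coord_le_norm (y - p) i0; rewrite !mxE.
  apply/rV_norm_leP => [|i]; first by rewrite mulr_ge0// ltW.
  have /andP[/= H1 H2] := H i; rewrite !mxE ger0_norm//.
  by rewrite (le_trans _ H1)// ltW.
have [N0|N0] := eqVneq N 0.
  rewrite integral0_eq ?lee_fin ?mulr_ge0 ?powR_ge0 ?exprn_ge0 ?eucl_norm_ge0// => t.
  rewrite /= in_itv/= andbT => t0; rewrite /F/= indicE.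
  rewrite memNset ?mul0r// => /(SN _ t0); rewrite N0.
  by move=> /andP[]; rewrite leNgt t0.
have {}N0 : 0 < N by rewrite lt0r N0 normr_ge0.
have N2 : 0 < N / 2 by rewrite divr_gt0.
pose c := n%:R * 2 * h y * (N / 2) `^ (- n%:R).
have c0 : 0 <= c by rewrite !mulr_ge0 ?eucl_norm_ge0 ?powR_ge0.
apply: (@le_trans _ _ (\int[leb]_(t in `[(N / 2)%R, N]) c%:E)%E).
  rewrite integral_mkcond [leRHS]integral_mkcond.
  apply: ge0_le_integral_nomeas => t _; first exact: erestrict_ge0.
  rewrite !patchE; case: ifPn => [|_]; last first.
    by case: ifP => _; rewrite lee_fin.
  rewrite inE/= in_itv/= andbT => t0; rewrite /F/= indicE.
  have [tS|tS] := pselect (S (t, y)); last first.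
    by rewrite memNset// mul0r; case: ifP => _; rewrite lee_fin.
  have /andP[tN Nt] := SN _ t0 tS.
  have Nt2 : N / 2 <= t by rewrite ler_pdivrMr// mulrC.
  rewrite mem_set// ifT; last by rewrite inE/= in_itv/= Nt2.
  rewrite mul1r lee_fin /c ler_wpM2l ?mulr_ge0 ?eucl_norm_ge0//.
  rewrite !powRN lef_pV2 ?posrE ?powR_gt0//.
  by apply: ge0_ler_powR; rewrite ?nnegrE ?(ltW N2) ?(ltW t0).
rewrite integral_cst//= lebesgue_measure_itv/= lte_fin.
rewrite gtr_pMr// invf_lt1// ltr1n /= -EFinB -EFinM lee_fin.
have -> : N - N / 2 = N / 2 by rewrite {1}[N]splitr addrK.
have -> : c * (N / 2) = n%:R * 2 ^+ n * (N `^ (1 - n%:R) * h y); last exact: lexx.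
rewrite /c powRM ?invr_ge0 ?(ltW N0)// [2^-1 `^ _]powRN powR_mulrn ?invr_ge0//.
rewrite exprVn invrK [N `^ (1 - _)]powRD ?(gt_eqF N0) ?implybT// powRr1 ?(ltW N0)//.
by field.
Qed.

End potential_estimate.

(** * Decreasing rearrangements *)

Section monotone_measurable.
Context {R : realType}.

Lemma nonincreasing_emeasurable (F : R -> \bar R) :
  {homo F : x y / x <= y >-> (y <= x)%E} -> measurable_fun setT F.
Proof.
move=> Fnincr.
apply: (measurability _ (ErealGenOInfty.measurableE R)) => // _ [_ [r ->] <-].
rewrite setTI; apply: is_interval_measurable => x y /=.
rewrite !in_itv/= !andbT => rx ry z /andP[xz zy].
by rewrite in_itv/= andbT (lt_le_trans ry)// Fnincr.
Qed.

End monotone_measurable.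

Section rearrangement.
Context {d} {T : measurableType d} {R : realType}.
Variable mu : {measure set T -> \bar R}.
Local Open Scope ereal_scope.

Lemma rearrangement_ge0 (f : T -> R) t : 0 <= rearrangement mu f t.
Proof. by apply: le_ereal_inf_tmp => _ [l [l0 _] <-]; rewrite lee_fin. Qed.

Lemma rearrangement_nincr (f : T -> R) (s t : R) :
  (s <= t)%R -> rearrangement mu f t <= rearrangement mu f s.
Proof.
move=> st; apply: ereal_inf_le_tmp => _ [l [l0 ls] <-]; exists l => //.
by split => //; apply: (le_trans ls); rewrite lee_fin.
Qed.

Lemma measurable_rearrangement (f : T -> R) :
  measurable_fun setT (rearrangement mu f).
Proof. by apply: nonincreasing_emeasurable => s t; exact: rearrangement_nincr. Qed.

Lemma rearrangement_le (f : T -> R) (t : R) (X : \bar R) : 0 <= X ->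
  (forall l : R, (0 <= l)%R -> t%:E < mu [set x | (l < `|f x|)%R] -> l%:E <= X) ->
  rearrangement mu f t <= X.
Proof.
move=> X0 H; apply/lee_addgt0Pr => e e0.
case: X X0 H => [X| |] X0 H //; last by rewrite addye// leey.
apply: ereal_inf_lbound; exists (X + e)%R => //; split.
  by rewrite addr_ge0// ltW.
rewrite leNgt; apply/negP => /H; rewrite addr_ge0 ?(ltW e0)// => /(_ isT).
by rewrite lee_fin gerDl leNgt e0.
Qed.

Lemma lt_distribution_le_rearrangement (f : T -> R) (s l : R) :
  measurable_fun setT f -> (0 <= l)%R ->
  s%:E < mu [set x | (l < `|f x|)%R] -> l%:E <= rearrangement mu f s.
Proof.
move=> mf l0 sl; apply: le_ereal_inf_tmp => _ [l' [l'0 hl'] <-].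
rewrite leNgt; apply/negP => ll'; move: sl; apply/negP; rewrite -leNgt.
have ml a : measurable [set x | (a < `|f x|)%R].
  have := measurableT_comp (@normr_measurable R setT) mf.
  move=> /(_ measurableT _ (measurable_itv `]a, +oo[)); rewrite setTI.
  by congr measurable; apply/seteqP; split => x /=; rewrite in_itv/= andbT.
apply: le_trans hl'; apply: le_measure; rewrite ?inE// => x /=.
by apply: lt_trans; rewrite -lte_fin.
Qed.

End rearrangement.

Section distribution_integral.
Context {d} {T : measurableType d} {R : realType}.
Variable mu : {measure set T -> \bar R}.
Local Notation leb := (@lebesgue_measure R).
Variable g : T -> R.
Hypothesis mg : measurable_fun setT g.
Hypothesis g0 : forall x, 0 <= g x.
Hypothesis fg : (mu [set x | (0 < g x)%R] < +oo)%E.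

(** Cutting the level off at 0 keeps the set inside the support of [g], of finite measure. Hence
    [fine] loses nothing and the function is monotone on the whole line, which makes it
    measurable. *)
Definition distr (l : R) : R := fine (mu [set x | Num.max l 0 < g x]).

Lemma measurable_level (l : R) : measurable [set x | l < g x].
Proof.
have := mg measurableT (measurable_itv `]l, +oo[); rewrite setTI.
by congr measurable; apply/seteqP; split => x /=; rewrite in_itv/= andbT.
Qed.

Lemma distr_fin (l : R) : mu [set x | Num.max l 0 < g x] = (distr l)%:E.
Proof.
rewrite /distr fineK// ge0_fin_numE//; apply: le_lt_trans fg.
apply: le_measure; rewrite ?inE//; try exact: measurable_level.
by move=> x /=; apply: le_lt_trans; rewrite le_max lexx orbT.
Qed.

Lemma distrE (l : R) : 0 <= l -> mu [set x | l < g x] = (distr l)%:E.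
Proof. by move=> l0; rewrite -distr_fin max_l. Qed.

Lemma distr_ge0 l : 0 <= distr l.
Proof. exact: fine_ge0. Qed.

Lemma distr_nincr (l l' : R) : l <= l' -> distr l' <= distr l.
Proof.
move=> ll'; rewrite -lee_fin -!distr_fin.
apply: le_measure; rewrite ?inE//; try exact: measurable_level.
by move=> x /=; rewrite !gt_max => /andP[h ->]; rewrite (le_lt_trans ll').
Qed.

Lemma measurable_distr : measurable_fun setT (distr : measurableTypeR R -> R).
Proof.
apply/measurable_EFinP; apply: nonincreasing_emeasurable => l l' ll'.
by rewrite lee_fin distr_nincr.
Qed.

(* Swapping the two integrals turns the distribution function of g into its
   decreasing rearrangement, with no need for a layer-cake formula for g^*. *)
Lemma integral_distr_le_rearrangement (Q : R -> R) :
  measurable_fun setT Q -> (forall x, 0 <= Q x) ->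
  (\int[leb]_(l in `]0%R, +oo[) \int[leb]_(s in `]0%R, distr l[) (Q s)%:E <=
   \int[leb]_(s in `]0%R, +oo[) ((Q s)%:E * rearrangement mu g s))%E.
Proof.
move=> mQ Q0.
pose S := [set z : measurableTypeR R * measurableTypeR R | (z.2 : R) < distr z.1].
have mS : measurable S by exact: (measurable_set_lt measurable_distr).
pose F := (fun z : measurableTypeR R * measurableTypeR R => (Q z.2)%:E) \_ S.
have F0 z : (0 <= F z)%E by apply: erestrict_ge0 => ? _; rewrite lee_fin.
have mF : measurable_fun setT F.
  apply/(measurable_restrictT _ mS); apply: measurable_funTS.
  by apply/measurable_EFinP; exact: (measurableT_comp mQ measurable_snd).
have mi := measurable_itv (`]0, +oo[ : interval R).
have := @tonelli_on _ _ _ _ _ leb leb _ _ F mi mi mF F0.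
have -> : (\int[leb]_(l in `]0%R, +oo[) \int[leb]_(s in `]0%R, +oo[) F (l, s) =
  \int[leb]_(l in `]0%R, +oo[) \int[leb]_(s in `]0%R, distr l[) (Q s)%:E)%E.
  apply: eq_integral => l _; rewrite integral_mkcond [RHS]integral_mkcond.
  apply: eq_integral => s _; rewrite /F !patchE/= !mem_setE !in_itv/= andbT.
  by case: (ltP 0 s) => //= s0; congr (if _ then _ else _); apply/idP/idP; rewrite inE.
move=> ->.
apply: ge0_le_integral_nomeas => s /=; rewrite in_itv/= andbT => s0.
  by apply: integral_ge0 => l _; exact: F0.
have [Qs0|Qs0] := eqVneq (Q s) 0.
  rewrite Qs0 mul0e integral0_eq// => l _; rewrite /F patchE/= Qs0.
  by case: ifP.
have [->|Xoo] := eqVneq (rearrangement mu g s) +oo%E.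
  by rewrite gt0_muley ?leey// lte_fin lt0r Qs0 Q0.
have X0 := rearrangement_ge0 mu g s.
have [X XE] : exists X : R, rearrangement mu g s = X%:E.
  by exists (fine (rearrangement mu g s)); rewrite fineK// ge0_fin_numE// ltey.
rewrite XE.
(* For fixed s, every level l with s < [distr l] is at most the rearrangement X at s. *)
apply: (@le_trans _ _ (\int[leb]_(l in `]0%R, X]) (Q s)%:E)%E).
  rewrite integral_mkcond [leRHS]integral_mkcond.
  apply: ge0_le_integral_nomeas => l _; first exact: erestrict_ge0.
  rewrite /F !patchE/= !mem_setE !in_itv/= andbT.
  case: (ltP 0 l) => //= l0; case: ifPn => [|_]; last by case: ifP => _; rewrite ?lee_fin.
  rewrite unfold_in /= => sl; rewrite ifT// -lee_fin -XE.
  apply: lt_distribution_le_rearrangement => //; first exact: ltW.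
  have -> : [set x | l < `|g x|] = [set x | l < g x].
    by apply/seteqP; split => x /=; rewrite ger0_norm.
  by rewrite distrE ?(ltW l0)// lte_fin.
rewrite integral_cst//= lebesgue_measure_itv/= lte_fin.
case: ifPn => [_|]; first by rewrite sube0.
rewrite mule0 -leNgt => X0'.
by rewrite mule_ge0 ?lee_fin// -lee_fin -XE.
Qed.

End distribution_integral.

(** * Weighted potentials averaged over a set *)

Section weak_type.
Context {R : realType} {n : nat}.
Local Notation mu := (lebesgue_rV R n).
Local Notation leb := (@lebesgue_measure R).
Local Notation kern x y := (`|x - y| `^ (1 - n%:R)).
Variables b c : R.
Hypothesis n2 : (2 <= n)%N.
Hypotheses (b0 : 0 < b) (b1 : b < 1) (c0 : 0 < c) (c1 : c < 1).

(** The minimum in [riesz_bilinear_le] divided by t, that is, the bound for an average over a set of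
    measure t. *)
Definition weak_bound (t s : R) : R :=
  Num.min (t `^ ((1 - b) / n%:R - 1) * s `^ (1 - c / n%:R))
          (t `^ (- (b / n%:R)) * s `^ ((1 - c) / n%:R)).

Let n_gt0 : 0 < n%:R :> R. Proof. by rewrite ltr0n (leq_trans _ n2). Qed.
Let n_ge2 : 2 <= n%:R :> R. Proof. by rewrite ler_nat. Qed.

Lemma weak_bound_ge0 t s : 0 <= weak_bound t s.
Proof. by rewrite le_min !mulr_ge0 ?powR_ge0. Qed.

Lemma measurable_weak_bound d (T : measurableType d) (t s : T -> R) :
  measurable_fun setT t -> measurable_fun setT s ->
  measurable_fun setT (fun x => weak_bound (t x) (s x)).
Proof.
move=> mt ms; have mp (f : T -> R) e :
    measurable_fun setT f -> measurable_fun setT (fun x => f x `^ e).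
  by move=> mf; exact: (measurableT_comp (@measurable_powR _ _) mf).
by apply: measurable_minr; apply: measurable_funM; exact: mp.
Qed.

Let a0_gt0 : 0 < 1 - c / n%:R.
Proof. by rewrite subr_gt0 ltr_pdivrMr// mul1r; have := (n_ge2, b0, c0, c1) => -[[[]]]; lra. Qed.
Let a0_le1 : 1 - c / n%:R <= 1.
Proof. by rewrite gerBl divr_ge0// ltW. Qed.
Let a1_gt0 : 0 < (1 - c) / n%:R.
Proof. by rewrite divr_gt0// subr_gt0. Qed.
Let a1_le1 : (1 - c) / n%:R <= 1.
Proof. by rewrite ler_pdivrMr// mul1r; have := (n_ge2, b0, c0, c1) => -[[[]]]; lra. Qed.
Let e0_lt1 : (1 - b) / n%:R - 1 <= 0.
Proof. by rewrite subr_le0 ler_pdivrMr// mul1r; have := (n_ge2, b0, c0, c1) => -[[[]]]; lra. Qed.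

Lemma weak_bound0 t : weak_bound t 0 = 0.
Proof.
by rewrite /weak_bound !powR0 ?mulr0 ?minxx// gt_eqF.
Qed.

Lemma powR_le_neg (x y e : R) : 0 < x -> x <= y -> e <= 0 -> y `^ e <= x `^ e.
Proof.
move=> x0 xy e0; have y0 := lt_le_trans x0 xy.
move: e0; rewrite -[e]opprK; move: (- e) => a; rewrite oppr_le0 => a0.
rewrite !powRN lef_pV2 ?posrE ?powR_gt0//.
by apply: ge0_ler_powR; rewrite ?nnegrE ?(ltW x0) ?(ltW y0).
Qed.

(** After division by m both exponents of m are nonpositive, so an average over a set of measure m
    >= t obeys the bound at t. This is needed because a level set tested at t is only known to have
    measure larger than t. *)
Lemma weak_bound_scale (t m s : R) : 0 < t -> t <= m ->
  Num.min (m `^ ((1 - b) / n%:R) * s `^ (1 - c / n%:R))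
          (m `^ (1 - b / n%:R) * s `^ ((1 - c) / n%:R)) <= m * weak_bound t s.
Proof.
move=> t0 tm; have m0 := lt_le_trans t0 tm.
rewrite /weak_bound minr_pMr ?(ltW m0)// !mulrA.
have E e : m `^ (1 + e) = m * m `^ e.
  by rewrite powRD ?(gt_eqF m0) ?implybT// powRr1// ltW.
have -> : m `^ ((1 - b) / n%:R) = m * m `^ ((1 - b) / n%:R - 1).
  by rewrite -E; congr (_ `^ _); rewrite [RHS]addrC subrK.
rewrite E le_min !ge_min; apply/andP; split; apply/orP;
  [left|right]; rewrite ler_wpM2r ?powR_ge0// ler_wpM2l ?(ltW m0)// powR_le_neg//.
by rewrite oppr_le0 divr_ge0 // ltW.
Qed.

(* On ]s/2, s[ the function weak_bound t is at least half its value at s. *)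
Lemma weak_bound_le_integral (t s : R) : 0 <= s ->
  ((weak_bound t s)%:E <=
    \int[leb]_(x in `]0%R, s[) (4 * weak_bound t x * x `^ (-1))%:E)%E.
Proof.
rewrite le_eqVlt => /predU1P[<-|s0].
  rewrite weak_bound0; apply: integral_ge0 => x _.
  by rewrite lee_fin !mulr_ge0 ?weak_bound_ge0 ?powR_ge0.
have s20 : 0 < s / 2 by rewrite divr_gt0.
(* The constant whose integral over an interval of length s/2 is [weak_bound t s]. *)
pose k := 2 * weak_bound t s * s^-1.
have k0 : 0 <= k by rewrite !mulr_ge0 ?weak_bound_ge0 ?invr_ge0// ltW.
apply: (@le_trans _ _ (\int[leb]_(x in `](s / 2)%R, s[) k%:E)%E).
  rewrite integral_cst//= lebesgue_measure_itv/= lte_fin ifT; last first.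
    by rewrite ltr_pdivrMr// ltr_pMr// ltr1n.
  rewrite -EFinB -EFinM lee_fin /k.
  rewrite (_ : _ * (s - s / 2) = weak_bound t s)//.
  by field; exact: lt0r_neq0.
rewrite integral_mkcond [leRHS]integral_mkcond.
apply: ge0_le_integral_nomeas => x _; first exact: erestrict_ge0.
rewrite !patchE !mem_setE !in_itv/=.
have [sx|_] /= := ltP (s / 2) x; last first.
  case: ifP => // _.
  by rewrite lee_fin !mulr_ge0 ?weak_bound_ge0 ?powR_ge0.
have x0 : 0 < x by exact: lt_trans sx.
rewrite x0 powR_inv1 ?(ltW x0)//=; case: ifPn => // xs.
rewrite lee_fin /k ler_pM ?mulr_ge0 ?weak_bound_ge0 ?invr_ge0 ?(ltW s0)//; last first.
  by rewrite lef_pV2 ?posrE// ltW.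
(* One 2 is already in [k]; the other is the loss from halving s, since both exponents of s lie in
   ]0, 1]. *)
rewrite (_ : 4 = 2 * 2 :> R); last by rewrite -natrM.
rewrite -mulrA ler_wpM2l//.
have key e : 0 < e -> e <= 1 -> s `^ e <= 2 * x `^ e.
  move=> e0 e1; apply: (@le_trans _ _ ((2 * x) `^ e)).
    apply: ge0_ler_powR; rewrite ?nnegrE ?mulr_ge0 ?(ltW e0) ?(ltW s0) ?(ltW x0)//.
    by rewrite mulrC -ler_pdivrMr// ltW.
  rewrite powRM ?(ltW x0)// ler_wpM2r ?powR_ge0//.
  by apply: ler1_powR => //; rewrite ler1n.
rewrite /weak_bound minr_pMr// le_min !ge_min; apply/andP; split; apply/orP; [left|right];
  by rewrite mulrCA ler_wpM2l ?powR_ge0// key.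
Qed.

Local Open Scope ereal_scope.

(** Slicing [g] turns the potential into an integral over l of bilinear forms on [E] and the set
    where g > l. Each is bounded by [riesz_bilinear_le] at the measures m and [distr mu g l], then
    moved from m to t by [weak_bound_scale]. *)
Lemma weighted_potential_le : exists2 C : R, (0 < C)%R &
  forall (g : 'rV[R]_n -> R) (E : set 'rV[R]_n) (t m : R),
    measurable_fun setT g -> (forall x, (0 <= g x)%R) ->
    mu [set x | (0 < g x)%R] < +oo ->
    measurable E -> (0 < t)%R -> (t <= m)%R -> mu E <= m%:E ->
    \int[mu]_(x in E) \int[mu]_y
      (`|x| `^ (- b) * kern x y * `|y| `^ (- c) * g y)%:E <=
    (C * m)%:E * \int[leb]_(l in `]0%R, +oo[) (weak_bound t (distr mu g l))%:E.
Proof.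
have [C C0 HC] := @riesz_bilinear_le R n b c n2 b0 b1 c0 c1.
exists C => // g E t m mg g0 fg mE t0 tm Em.
have m0 := lt_le_trans t0 tm.
pose ker (z : 'rV[R]_n * 'rV[R]_n) := (`|z.1| `^ (- b) * kern z.1 z.2 * `|z.2| `^ (- c))%:E.
have mker : measurable_fun setT ker by exact: measurable_weighted_kernel.
have ker0 z : 0 <= ker z by rewrite lee_fin !mulr_ge0 ?powR_ge0.
pose P y := \int[mu]_(x in E) ker (x, y).
have P0 y : 0 <= P y by apply: integral_ge0 => x _; exact: ker0.
have mP : measurable_fun setT P.
  pose ker' := ker \_ (E `*` setT).
  have mk' : measurable_fun setT ker'.
    apply/(measurable_restrictT _ (measurableX mE measurableT)).
    exact: measurable_funTS.
  have k'0 z : 0 <= ker' z by apply: erestrict_ge0.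
  have := @measurable_fun_fubini_tonelli_G _ _ _ _ _ mu ker' mk' k'0.
  congr measurable_fun; apply/funext => y; rewrite /P [RHS]integral_mkcond.
  by apply: eq_integral => x _; rewrite /ker' !patchE in_setX/= in_setT andbT.
have -> : \int[mu]_(x in E) \int[mu]_y
      (`|x| `^ (- b) * kern x y * `|y| `^ (- c) * g y)%:E =
   \int[mu]_y ((g y)%:E * P y).
  rewrite (@tonelli_on _ _ _ _ _ mu mu E setT (fun z => ker z * (g z.2)%:E) mE measurableT)//.
  - apply: eq_integral => y _; rewrite /P -ge0_integralZl_EFin//.
      by apply: eq_integral => x _; rewrite muleC.
    by apply: measurable_funTS; apply: (measurableT_comp mker); exact: measurable_pair2.
  - apply: emeasurable_funM => //; apply/measurable_EFinP.
    exact: (measurableT_comp mg measurable_snd).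
  - by move=> z; rewrite mule_ge0 ?lee_fin.
rewrite layer_cake//.
rewrite -ge0_integralZl_EFin//; last 3 first.
- by move=> l _; rewrite lee_fin weak_bound_ge0.
- apply/measurable_EFinP; apply: measurable_funTS; apply: measurable_weak_bound => //.
  exact: measurable_distr.
- by rewrite mulr_ge0// ltW.
apply: ge0_le_integral_nomeas => l /=; rewrite in_itv/= andbT => l0.
  by apply: integral_ge0 => y _; exact: P0.
have ml : measurable [set x | (l < g x)%R] by exact: measurable_level.
have sE : mu [set x | (l < g x)%R] = (distr mu g l)%:E by apply: distrE => //; exact: ltW.
(* The bilinear bound is for positive s, so null slices are treated apart; there the integral is
   0. *)
have := distr_ge0 mu g l; rewrite le_eqVlt => /predU1P[s0|s0].
  have mu0 : mu [set x | (l < g x)%R] = 0 by rewrite sE -s0.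
  rewrite (null_set_integral ml _ mu0); last exact: measurable_funTS.
  by rewrite -EFinM lee_fin !mulr_ge0 ?weak_bound_ge0 ?ltW.
apply: (le_trans (HC E [set x | (l < g x)%R] m _ mE ml m0 s0 Em _)); first by rewrite sE.
by rewrite -EFinM lee_fin -mulrA ler_wpM2l ?(ltW C0)// weak_bound_scale.
Qed.

End weak_type.

(** * The rearrangement of the weighted function *)

Section rearrangement_estimate.
Context {R : realType} {n : nat}.
Local Notation mu := (lebesgue_rV R n).
Local Notation leb := (@lebesgue_measure R).
Local Notation kern x y := (`|x - y| `^ (1 - n%:R)).
Variables b c : R.
Hypothesis n2 : (2 <= n)%N.
Hypotheses (b0 : 0 < b) (b1 : b < 1) (c0 : 0 < c) (c1 : c < 1).

Definition weighted_fun (u : 'rV[R]_n -> R) x := eucl_norm x `^ (- b) * u x.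

Definition weighted_grad (u : 'rV[R]_n -> R) x :=
  eucl_norm (eucl_norm x `^ c *: gradient u x).

Section fixed_function.
Variable u : 'rV[R]_n -> R.
Hypothesis du : forall i q, derivable u q (delta_mx 0 i).
Hypothesis cu : forall i, continuous (partial i u).
Hypothesis u_cont : continuous u.
Hypothesis su : exists M : R, forall x, M < `|x| -> u x = 0.

Lemma weighted_gradE x :
  weighted_grad u x = eucl_norm x `^ c * eucl_norm (gradient u x).
Proof. by rewrite /weighted_grad eucl_normZ ger0_norm ?powR_ge0. Qed.

Lemma measurable_weighted_fun : measurable_fun setT (weighted_fun u).
Proof.
apply: measurable_funM; last exact: continuous_rV_measurable.
exact: (measurableT_comp (@measurable_powR _ _) measurable_eucl_norm).
Qed.

Lemma measurable_weighted_grad : measurable_fun setT (weighted_grad u).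
Proof.
rewrite (_ : weighted_grad u = fun x => eucl_norm x `^ c * eucl_norm (gradient u x)).
  apply: measurable_funM; last exact: measurable_gradient_norm.
  exact: (measurableT_comp (@measurable_powR _ _) measurable_eucl_norm).
by apply/funext => x; exact: weighted_gradE.
Qed.

Lemma weighted_grad_ge0 x : 0 <= weighted_grad u x.
Proof. exact: eucl_norm_ge0. Qed.

Lemma gradient_support : exists2 M : R, 0 <= M & forall x, M < `|x| ->
  u x = 0 /\ gradient u x = 0.
Proof.
have [M HM] := su; exists `|M| => // x Mx.
have Mx' := le_lt_trans (ler_norm M) Mx.
split; first exact: HM.
apply/rowP => i; rewrite !mxE /partial.
rewrite (@near_eq_derive _ _ _ u (cst 0)) ?derive_cst//; last first.
  near=> y; apply: HM; near: y.
  have : continuous (fun y : 'rV[R]_n => `|y|) by exact: norm_continuous.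
  by move=> /(_ x) /cvgr_gt; apply.
Unshelve. all: by end_near. Qed.

Lemma bounded_set_finite (A : set 'rV[R]_n) (M : R) : 0 <= M -> measurable A ->
  (forall x, A x -> `|x| <= M) -> (mu A < +oo)%E.
Proof.
move=> M0 mA AM; apply: (@le_lt_trans _ _ (mu [set x | `|x - 0| <= M])).
  apply: le_measure; rewrite ?inE//; first exact: measurable_rV_ball.
  by move=> x /AM; rewrite /= subr0.
by rewrite lebesgue_rV_ball// ltry.
Qed.

Lemma weighted_grad_finite : (mu [set x | (0 < weighted_grad u x)%R] < +oo)%E.
Proof.
have [M M0 HM] := gradient_support.
apply: (bounded_set_finite M0).
  exact: (measurable_level measurable_weighted_grad).
move=> x /=; rewrite leNgt; apply: contraTN => /HM[_ gx].
by rewrite weighted_gradE gx eucl_norm0 mulr0 ltxx.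
Qed.

Lemma weighted_level_finite (l : R) : 0 <= l ->
  (mu [set x | (l < `|weighted_fun u x|)%R] < +oo)%E.
Proof.
move=> l0; have [M M0 HM] := gradient_support.
apply: (bounded_set_finite M0).
  apply: (@measurable_level _ _ _ (fun x => `|weighted_fun u x|)).
  exact: (measurableT_comp (@normr_measurable R setT) measurable_weighted_fun).
move=> x /=; rewrite leNgt; apply: contraTN => /HM[ux _].
by rewrite /weighted_fun ux mulr0 normr0 -leNgt.
Qed.

Local Open Scope ereal_scope.

(** Both weights pass from the Euclidean to the sup norm through [norm_le_eucl], at no cost: the
    negative power on the left only grows, and the positive power inside [weighted_grad] outweighs
    |y|^c. *)
Lemma weighted_fun_le_potential (E : set 'rV[R]_n) : measurable E ->
  \int[mu]_(x in E) `|weighted_fun u x|%:E <=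
  (n%:R * 2 ^+ n)%:E * \int[mu]_(x in E) \int[mu]_y
      (`|x| `^ (- b) * kern x y * `|y| `^ (- c) * weighted_grad u y)%:E.
Proof.
move=> mE; have n0 : (0 < n)%N by exact: leq_trans n2.
pose F (z : 'rV[R]_n * 'rV[R]_n) := (`|z.1| `^ (- b) * kern z.1 z.2 *
  `|z.2| `^ (- c) * weighted_grad u z.2)%:E.
have F0 z : 0 <= F z by rewrite lee_fin !mulr_ge0 ?powR_ge0 ?weighted_grad_ge0.
have mF : measurable_fun setT F.
  apply/measurable_EFinP; apply: measurable_funM.
    by apply/measurable_EFinP; exact: measurable_weighted_kernel.
  exact: (measurableT_comp measurable_weighted_grad measurable_snd).
have k0 : (0 <= n%:R * 2 ^+ n :> R)%R by rewrite mulr_ge0.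
have mFx x : measurable_fun setT (fun y => F (x, y)).
  by apply: (measurableT_comp mF); exact: measurable_pair1.
rewrite -ge0_integralZl_EFin//; last 2 first.
- by move=> x _; apply: integral_ge0 => y _; exact: (F0 (x, y)).
- apply: measurable_funTS; exact: (@measurable_fun_fubini_tonelli_F _ _ _ _ _ mu F mF F0).
apply: ge0_le_integral_nomeas => x _; first by rewrite lee_fin.
apply: (@le_trans _ _ ((`|x| `^ (- b))%:E * `|u x|%:E)).
  rewrite -EFinM lee_fin /weighted_fun normrM [X in (X * _)%R]ger0_norm ?powR_ge0//.
  rewrite ler_wpM2r//.
  have [->|x0] := eqVneq x 0%R.
    by rewrite eucl_norm0 normr0.
  rewrite !powRN lef_pV2 ?posrE ?powR_gt0 ?normr_gt0//; last first.
    by rewrite (lt_le_trans _ (norm_le_eucl x))// normr_gt0.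
  apply: ge0_ler_powR; rewrite ?nnegrE ?eucl_norm_ge0 ?(ltW b0)//.
  exact: norm_le_eucl.
apply: (@le_trans _ _ ((`|x| `^ (- b))%:E *
   \int[mu]_y (n%:R * 2 ^+ n * (`|y - x| `^ (1 - n%:R) * eucl_norm (gradient u y)))%:E)).
  by rewrite lee_wpmul2l ?lee_fin ?powR_ge0//; exact: pointwise_le_potential.
have mG : measurable_fun setT (fun y : 'rV[R]_n =>
    (n%:R * 2 ^+ n * (`|y - x| `^ (1 - n%:R) * eucl_norm (gradient u y)))%:E).
  apply/measurable_EFinP; apply: measurable_funM => //.
  apply: measurable_funM; first exact: measurable_powR_norm.
  exact: measurable_gradient_norm.
have mFx' := mFx x; have F0' y : 0 <= F (x, y) by exact: F0.
rewrite -!ge0_integralZl_EFin ?powR_ge0//; last 2 first.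
- by move=> y _; exact: F0'.
- by move=> y _; rewrite lee_fin !mulr_ge0 ?powR_ge0 ?eucl_norm_ge0.
apply: ae_ge0_le_integral => //.
- by move=> y _; rewrite -EFinM lee_fin !mulr_ge0 ?powR_ge0 ?eucl_norm_ge0.
- exact: measurable_funeM.
- by move=> y _; apply: mule_ge0; [rewrite lee_fin|exact: F0'].
- exact: measurable_funeM.
(* At y = 0 the factor |y|^-c is 0 by convention while the gradient need not vanish, so the
   comparison is only almost everywhere; the origin is a null set. *)
exists [set 0%R]; split.
- have := measurable_rV_ball (0 : 'rV[R]_n) 0; congr measurable.
  by apply/seteqP; split => v /=; rewrite subr0 normr_le0 => /eqP.
- exact: lebesgue_rV_set1.
move=> y /= H; apply/eqP; apply: contra_notT H => y0 _.
rewrite -!EFinM lee_fin weighted_gradE mulrCA.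
rewrite ler_wpM2l// distrC -!mulrA ler_wpM2l ?powR_ge0// ler_wpM2l ?powR_ge0//.
rewrite mulrA -[leLHS]mul1r ler_wpM2r ?eucl_norm_ge0// powRN mulrC.
rewrite ler_pdivlMr ?powR_gt0 ?normr_gt0// mul1r.
apply: ge0_ler_powR; rewrite ?nnegrE ?eucl_norm_ge0 ?(ltW c0)//.
exact: norm_le_eucl.
Qed.

End fixed_function.

Local Open Scope ereal_scope.

(** If the level set [E] at height l has measure m > t, then l m is at most the integral of the
    weighted function over [E], which the potential bounds by a multiple of m. Cancelling m leaves a
    bound on l in terms of t alone, and [rearrangement_le] concludes. The factors of the constant
    come from the potential, the bilinear form and [weak_bound_le_integral]. *)
Lemma rearrangement_estimate : exists2 K : R, (0 < K)%R &
  forall u : 'rV[R]_n -> R,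
    (forall i q, derivable u q (delta_mx 0%R i)) ->
    (forall i, continuous (partial i u)) -> continuous u ->
    (exists M : R, forall x, (M < `|x|)%R -> u x = 0%R) ->
  forall t : R, (0 < t)%R ->
    rearrangement mu (weighted_fun u) t <=
    K%:E * \int[leb]_(s in `]0%R, +oo[)
      ((weak_bound (n := n) b c t s * s `^ (-1))%:E * rearrangement mu (weighted_grad u) s).
Proof.
have [C C0 HC] := @weighted_potential_le R n b c n2 b0 b1 c0 c1.
pose k : R := (n%:R * 2 ^+ n)%R.
have k0 : (0 < k)%R.
  by rewrite /k mulr_gt0 ?exprn_gt0// ltr0n (leq_trans _ n2).
exists (k * C * 4)%R; first by rewrite mulr_gt0// mulr_gt0.
move=> u du cu u_cont su t t0.
have mg := measurable_weighted_grad cu.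
have g0 := weighted_grad_ge0 u.
have fg := weighted_grad_finite cu su.
have mW : measurable_fun setT (fun s : R => weak_bound (n := n) b c t s).
  by apply: measurable_weak_bound => //; exact: measurable_id.
have mQ a : measurable_fun setT (fun s : R => a * weak_bound (n := n) b c t s * s `^ (-1))%R.
  by apply: measurable_funM => //; exact: measurable_funM.
have Q0 a s : (0 <= a)%R -> (0 <= a * weak_bound (n := n) b c t s * s `^ (-1))%R.
  by move=> a0; rewrite !mulr_ge0 ?weak_bound_ge0 ?powR_ge0.
apply: rearrangement_le.
  rewrite mule_ge0 ?lee_fin ?mulr_ge0 ?(ltW k0) ?(ltW C0)//.
  apply: integral_ge0 => s _; rewrite mule_ge0 ?rearrangement_ge0//.
  by have := Q0 1%R s ler01; rewrite mul1r.
move=> l l0; set E := [set x | _] => tE.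
have mE : measurable E.
  apply: (@measurable_level _ _ _ (fun x => `|weighted_fun u x|%R)).
  exact: (measurableT_comp (@normr_measurable R setT) (measurable_weighted_fun u_cont)).
have Ef : mu E < +oo by exact: weighted_level_finite.
have [m mEm] : exists m : R, mu E = m%:E.
  by exists (fine (mu E)); rewrite fineK// ge0_fin_numE.
have tm : (t < m)%R by rewrite -lte_fin -mEm.
have m0 := lt_trans t0 tm.
have H1 : (l * m)%:E <= \int[mu]_(x in E) `|weighted_fun u x|%:E.
  rewrite EFinM -mEm -integral_cst//.
  apply: ge0_le_integral_nomeas => x /=; first by rewrite lee_fin.
  by move=> /ltW; rewrite lee_fin.
have Em : mu E <= m%:E by rewrite mEm.
have := HC _ E t m mg g0 fg mE t0 (ltW tm) Em.
rewrite -(lee_pmul2l _ (_ : 0 < k%:E))// ?lte_fin// => H2.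
have {H1 H2} := le_trans H1 (le_trans (weighted_fun_le_potential du cu su mE) H2).
rewrite (_ : k%:E * ((C * m)%:E * _) = m%:E * ((k * C)%:E * \int[leb]_(l in `]0%R, +oo[)
    (weak_bound (n := n) b c t (distr mu (weighted_grad u) l))%:E)); last first.
  by rewrite !muleA -!EFinM; congr (_%:E * _); ring.
rewrite [(l * m)%R]mulrC EFinM lee_pmul2l ?lte_fin// => H.
apply: (le_trans H); rewrite [in leRHS]EFinM -muleA.
rewrite lee_wpmul2l ?lee_fin ?mulr_ge0 ?(ltW k0) ?(ltW C0)//.
(* The value of [weak_bound t] at a measure becomes an integral up to that measure, the form in
   which levels and measures can be exchanged. *)
apply: (@le_trans _ _ (\int[leb]_(l in `]0%R, +oo[)
   \int[leb]_(s in `]0%R, distr mu (weighted_grad u) l[)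
     (4 * weak_bound (n := n) b c t s * s `^ (-1))%:E)).
  apply: ge0_le_integral_nomeas => x _; first by rewrite lee_fin weak_bound_ge0.
  by apply: weak_bound_le_integral => //; exact: distr_ge0.
apply: (le_trans (integral_distr_le_rearrangement mg g0 fg (mQ 4%R) _)) => //.
  by move=> s; exact: Q0.
rewrite -ge0_integralZl_EFin//.
- rewrite le_eqVlt; apply/orP; left; apply/eqP; apply: eq_integral => s _.
  by rewrite -[(4 * _ * _)%R]mulrA EFinM -muleA.
- move=> s _; rewrite mule_ge0 ?rearrangement_ge0//.
  by have := Q0 1%R s ler01; rewrite mul1r.
- apply: emeasurable_funM; last first.
    by apply: measurable_funTS; exact: measurable_rearrangement.
  by apply: measurable_funTS; apply/measurable_EFinP; exact: measurable_funM.
Qed.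

End rearrangement_estimate.

(** * Schur's test *)

Section schur_kernel.
Context {R : realType}.
Local Notation leb := (@lebesgue_measure R).
Variables e0 e1 : R.
Hypotheses (e0_gt0 : 0 < e0) (e1_gt0 : 0 < e1).

Definition schur (t s : R) : R :=
  Num.min (s `^ e0 * t `^ (- e0)) (s `^ (- e1) * t `^ e1).

Lemma schur_ge0 t s : 0 <= schur t s.
Proof. by rewrite le_min !mulr_ge0 ?powR_ge0. Qed.

Lemma powRVK (x e : R) : 0 < x -> x `^ e * x `^ (- e) = 1.
Proof. by move=> x0; rewrite powRN divff// gt_eqF// powR_gt0. Qed.

Lemma schur_le1 t s : 0 < t -> 0 < s -> schur t s <= 1.
Proof.
move=> t0 s0; rewrite ge_min; have [st|/ltW ts] := leP s t.
  rewrite -(powRVK e0 t0) ler_wpM2r ?powR_ge0//.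
  by apply: ge0_ler_powR; rewrite ?nnegrE ?(ltW e0_gt0) ?(ltW s0) ?(ltW t0).
rewrite -[X in _ || (_ <= X)](powRVK e1 s0) [X in _ || (_ <= X)]mulrC.
rewrite ler_wpM2l ?powR_ge0 ?orbT//.
by apply: ge0_ler_powR; rewrite ?nnegrE ?(ltW e1_gt0) ?(ltW s0) ?(ltW t0).
Qed.

Lemma measurable_schur d (T : measurableType d) (t s : T -> R) :
  measurable_fun setT t -> measurable_fun setT s ->
  measurable_fun setT (fun x => schur (t x) (s x)).
Proof.
move=> mt ms; have mp (f : T -> R) e :
    measurable_fun setT f -> measurable_fun setT (fun x => f x `^ e).
  by move=> mf; exact: (measurableT_comp (@measurable_powR _ _) mf).
by apply: measurable_minr; apply: measurable_funM; exact: mp.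
Qed.

(** The integral of min(x^e0, x^-e1) against dx/x: 1/e0 from ]0, 1] and 1/e1 from the rest. It
    controls both marginals, since the kernel depends on s/t only and dx/x is invariant under
    dilation and inversion. *)
Definition schur_mass : R := e0^-1 + e1^-1.

Lemma schur_mass_ge0 : 0 <= schur_mass.
Proof. by rewrite addr_ge0// invr_ge0 ltW. Qed.

Lemma integral_schur_r t : 0 < t ->
  (\int[leb]_(s in `]0%R, +oo[) (schur t s * s `^ (-1))%:E <= schur_mass%:E)%E.
Proof.
move=> t0.
apply: (@le_trans _ _ (\int[leb]_(s in `]0%R, +oo[)
   (if (s <= t)%R then t `^ (- e0) * s `^ (e0 - 1) else t `^ e1 * s `^ (- e1 - 1))%:E)%E).
  apply: ge0_le_integral_nomeas => s /=; rewrite in_itv/= andbT => s0.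
    by rewrite lee_fin mulr_ge0 ?powR_ge0 ?schur_ge0.
  have E e : s `^ (e - 1) = s `^ e * s `^ (-1) by rewrite powRD ?(gt_eqF s0) ?implybT.
  rewrite lee_fin !E !mulrA; case: ifP => _; rewrite ler_wpM2r ?powR_ge0//.
    by rewrite [leRHS]mulrC ge_min lexx.
  by rewrite [leRHS]mulrC ge_min lexx orbT.
rewrite integral_piecewise_powR ?powR_ge0// lee_fin.
by rewrite !mulrA [t `^ (- e0) * _]mulrC !powRVK// !mul1r lexx.
Qed.

Lemma integral_schur_l s : 0 < s ->
  (\int[leb]_(t in `]0%R, +oo[) (schur t s * t `^ (-1))%:E <= schur_mass%:E)%E.
Proof.
move=> s0.
apply: (@le_trans _ _ (\int[leb]_(t in `]0%R, +oo[)
   (if (t <= s)%R then s `^ (- e1) * t `^ (e1 - 1) else s `^ e0 * t `^ (- e0 - 1))%:E)%E).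
  apply: ge0_le_integral_nomeas => t /=; rewrite in_itv/= andbT => t0.
    by rewrite lee_fin mulr_ge0 ?powR_ge0 ?schur_ge0.
  have E e : t `^ (e - 1) = t `^ e * t `^ (-1) by rewrite powRD ?(gt_eqF t0) ?implybT.
  rewrite lee_fin !E !mulrA; case: ifP => _; rewrite ler_wpM2r ?powR_ge0//.
    by rewrite /schur ge_min lexx orbT.
  by rewrite /schur ge_min lexx.
rewrite integral_piecewise_powR ?powR_ge0// lee_fin.
by rewrite !mulrA [s `^ (- e1) * _]mulrC !powRVK// !mul1r addrC lexx.
Qed.

Section schur_test.
Local Open Scope ereal_scope.
Variables (K : R) (G H : R -> \bar R).
Hypothesis K0 : (0 < K)%R.
Hypothesis mG : measurable_fun setT G.
Hypothesis G0 : forall s, 0 <= G s.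
Hypothesis H0 : forall t, 0 <= H t.
Hypothesis HG : forall t, (0 < t)%R ->
  H t <= K%:E * \int[leb]_(s in `]0%R, +oo[) ((schur t s * s `^ (-1))%:E * G s).

Let k0 t s : 0 <= (schur t s * s `^ (-1))%:E.
Proof. by rewrite lee_fin mulr_ge0 ?powR_ge0 ?schur_ge0. Qed.

Let mk t : measurable_fun setT (fun s : R => (schur t s * s `^ (-1))%:E).
Proof. by apply/measurable_EFinP; apply: measurable_funM => //; exact: measurable_schur. Qed.

Lemma schur_sup (A : \bar R) : (forall s, (0 < s)%R -> G s <= A) ->
  forall t, (0 < t)%R -> H t <= (K * schur_mass)%:E * A.
Proof.
move=> GA t t0; apply: (le_trans (HG t0)); rewrite EFinM -muleA.
rewrite lee_wpmul2l ?lee_fin ?(ltW K0)//.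
have A0 : 0 <= A by exact: le_trans (GA 1%R ltr01).
apply: (@le_trans _ _ (\int[leb]_(s in `]0%R, +oo[) ((schur t s * s `^ (-1))%:E * A))).
  apply: ge0_le_integral_nomeas => s /=; first by rewrite mule_ge0.
  by rewrite in_itv/= andbT => s0; rewrite lee_wpmul2l// GA.
rewrite ge0_integralZr//; last by apply: measurable_funTS; exact: mk.
by rewrite lee_wpmul2r// integral_schur_r.
Qed.

Variable r : R.
Hypothesis r1 : (1 <= r)%R.

Let r0 : (0 < r)%R. Proof. exact: lt_le_trans r1. Qed.

(** In [schur_pow] the two terms of Young's inequality contribute [lam] and [lam * schur_mass];
    hence the sum. *)
Definition schur_const : R := ((K * (1 + schur_mass)) `^ r)%R.

Let KM_ge0 : (0 <= K * (1 + schur_mass))%R.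
Proof. by rewrite mulr_ge0 ?(ltW K0)// addr_ge0// schur_mass_ge0. Qed.

Lemma schur_const_gt0 : (0 < schur_const)%R.
Proof. by rewrite powR_gt0// mulr_gt0// ltr_pwDl// schur_mass_ge0. Qed.

Let mGr : measurable_fun setT (fun s => G s `^ r).
Proof. exact: (measurableT_comp (@measurable_poweR R r) mG). Qed.

Let mkG t : measurable_fun setT (fun s => (schur t s * s `^ (-1))%:E * (G s) `^ r).
Proof. by apply: emeasurable_funM; [exact: mk|exact: mGr]. Qed.

(* a <= lam^(1-r) a^r + lam for every lam > 0; the choice of lam optimises the
   sum and replaces Hoelder's inequality. *)
Lemma le_young_poweR (a : \bar R) (lam : R) : 0 <= a -> (0 < lam)%R ->
  a <= (lam `^ (1 - r))%:E * a `^ r + lam%:E.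
Proof.
case: a => [a| |]// a0 lam0; last first.
  by rewrite poweRyr ?gt_eqF// gt0_muley ?lte_fin ?powR_gt0// addye// leey.
rewrite poweR_EFin -EFinM -EFinD lee_fin; rewrite lee_fin in a0.
have [al|/ltW la] := leP a lam.
  by rewrite (le_trans al)// lerDr mulr_ge0 ?powR_ge0.
apply: (@le_trans _ _ (lam `^ (1 - r) * a `^ r)%R); last by rewrite lerDl ltW.
have a_gt0 : (0 < a)%R by exact: lt_le_trans la.
apply: (@le_trans _ _ (a `^ (1 - r) * a `^ r)%R).
  by rewrite -powRD ?(gt_eqF a_gt0) ?implybT// subrK powRr1.
by rewrite ler_wpM2r ?powR_ge0// powR_le_neg// subr_le0.
Qed.

(** Young's inequality is applied under the integral with one [lam] for all s, whose r-th power is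
    essentially the integral on the right; both terms are then multiples of [lam]. *)
Lemma schur_pow t : (0 < t)%R -> (H t) `^ r <=
  schur_const%:E * \int[leb]_(s in `]0%R, +oo[) ((schur t s * s `^ (-1))%:E * (G s) `^ r).
Proof.
move=> t0; set I := (\int[leb]_(s in _) _).
have I0 : 0 <= I by apply: integral_ge0 => s _; rewrite mule_ge0 ?poweR_ge0.
have [Ioo|Ioo] := eqVneq I +oo.
  by rewrite Ioo gt0_muley ?leey// lte_fin schur_const_gt0.
have [i iE] : exists i : R, I = i%:E.
  by exists (fine I); rewrite fineK// ge0_fin_numE// ltey.
rewrite iE in I0 *; rewrite lee_fin in I0.
apply/lee_addgt0Pr => e e_gt0.
(* The perturbation keeps [lam] positive even when i = 0 and amounts to exactly the slack e on the
   right. *)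
pose j := (i + e / schur_const)%R.
have j0 : (0 < j)%R by rewrite ltr_wpDl// divr_gt0// schur_const_gt0.
have -> : schur_const%:E * i%:E + e%:E = (schur_const * j)%:E.
  by rewrite -EFinM -EFinD /j mulrDr mulrCA divff ?mulr1// gt_eqF// schur_const_gt0.
pose lam := (j `^ r^-1)%R.
have lam0 : (0 < lam)%R by exact: powR_gt0.
have -> : (schur_const * j)%R = ((K * (1 + schur_mass) * lam) `^ r)%R.
  rewrite [RHS]powRM ?(ltW lam0) ?KM_ge0//.
  by rewrite /lam -powRrM mulVf ?gt_eqF// powRr1// ltW.
rewrite -poweR_EFin; apply: gt0_ler_poweR; rewrite ?(ltW r0)//.
- by rewrite in_itv/= H0 leey.
- by rewrite in_itv/= leey andbT lee_fin mulr_ge0 ?(ltW lam0) ?KM_ge0.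
apply: (le_trans (HG t0)); rewrite -mulrA EFinM lee_wpmul2l ?lee_fin ?(ltW K0)//.
apply: (@le_trans _ _ (\int[leb]_(s in `]0%R, +oo[)
  ((lam `^ (1 - r))%:E * ((schur t s * s `^ (-1))%:E * (G s) `^ r) +
   lam%:E * (schur t s * s `^ (-1))%:E))).
  apply: ge0_le_integral_nomeas => s _; first by rewrite mule_ge0.
  rewrite muleCA [X in _ + X]muleC -ge0_muleDr
    ?mule_ge0 ?poweR_ge0 ?lee_fin ?powR_ge0 ?(ltW lam0)//.
  by rewrite lee_wpmul2l// le_young_poweR.
rewrite ge0_integralD//; last 4 first.
- move=> s _; apply: mule_ge0; first by rewrite lee_fin powR_ge0.
  by rewrite mule_ge0 ?poweR_ge0.
- by apply: measurable_funTS; apply: measurable_funeM; exact: mkG.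
- by move=> s _; apply: mule_ge0; rewrite // lee_fin ltW.
- by apply: measurable_funTS; apply: measurable_funeM; exact: mk.
rewrite !ge0_integralZl_EFin ?powR_ge0 ?(ltW lam0)//; last 3 first.
- by apply: measurable_funTS; exact: mk.
- by move=> s _; rewrite mule_ge0 ?poweR_ge0.
- by apply: measurable_funTS; exact: mkG.
rewrite -/I iE mulrDl mul1r EFinD; apply: leeD.
  rewrite -EFinM lee_fin; apply: (@le_trans _ _ (lam `^ (1 - r) * j)%R).
    by rewrite ler_wpM2l ?powR_ge0// lerDl ltW// divr_gt0// schur_const_gt0.
  have -> : j = (lam `^ r)%R by rewrite /lam -powRrM mulVf ?gt_eqF// powRr1// ltW.
  by rewrite -powRD ?(gt_eqF lam0) ?implybT// subrK powRr1// ltW.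
by rewrite [in leRHS]mulrC EFinM lee_wpmul2l ?lee_fin ?(ltW lam0)// integral_schur_r.
Qed.

(** For [G s] = s^(1/p) times a rearrangement at s, this is the r-th power of the Lorentz norm
    without its factor r/p. *)
Definition power_integral : \bar R :=
  \int[leb]_(s in `]0%R, +oo[) ((G s) `^ r * (s^-1)%:E).

Lemma schur_pow_sup t : (0 < t)%R -> (H t) `^ r <= schur_const%:E * power_integral.
Proof.
move=> t0; apply: (le_trans (schur_pow t0)).
rewrite lee_wpmul2l ?lee_fin ?(ltW schur_const_gt0)//.
apply: ge0_le_integral_nomeas => s /=; first by rewrite mule_ge0 ?poweR_ge0.
rewrite in_itv/= andbT => s0; rewrite muleC lee_wpmul2l ?poweR_ge0// lee_fin.
by rewrite powR_inv1 ?(ltW s0)// ler_piMl ?invr_ge0 ?(ltW s0)// schur_le1.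
Qed.

(** The case s = r: integrate [schur_pow] against dt/t and exchange the integrals; the inner
    integral in t is the other marginal of the kernel. *)
Lemma schur_pow_integral :
  \int[leb]_(t in `]0%R, +oo[) ((H t) `^ r * (t^-1)%:E) <=
  (schur_const * schur_mass)%:E * power_integral.
Proof.
pose F (z : measurableTypeR R * measurableTypeR R) :=
  schur_const%:E * ((schur z.1 z.2 * z.2 `^ (-1) * z.1 `^ (-1))%:E * (G z.2) `^ r).
have mF : measurable_fun setT F.
  apply: measurable_funeM; apply: emeasurable_funM; last first.
    exact: (measurableT_comp mGr measurable_snd).
  apply/measurable_EFinP; apply: measurable_funM.
    apply: measurable_funM.
      by apply: measurable_schur; [exact: measurable_fst|exact: measurable_snd].
    exact: (measurableT_comp (@measurable_powR _ _) measurable_snd).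
  exact: (measurableT_comp (@measurable_powR _ _) measurable_fst).
have F0 z : 0 <= F z.
  by rewrite !mule_ge0 ?poweR_ge0// lee_fin ?mulr_ge0 ?powR_ge0 ?schur_ge0// ltW ?schur_const_gt0.
have mi := measurable_itv (`]0%R, +oo[ : interval R).
apply: (@le_trans _ _ (\int[leb]_(t in `]0%R, +oo[) \int[leb]_(s in `]0%R, +oo[) F (t, s))).
  apply: ge0_le_integral_nomeas => t /=; rewrite in_itv/= andbT => t0.
    by rewrite mule_ge0 ?poweR_ge0// lee_fin invr_ge0 ltW.
  apply: (@le_trans _ _ (schur_const%:E * (\int[leb]_(s in `]0%R, +oo[)
      ((schur t s * s `^ (-1))%:E * (G s) `^ r)) * (t^-1)%:E)).
    by rewrite lee_wpmul2r ?lee_fin ?invr_ge0 ?(ltW t0)// schur_pow.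
  rewrite -ge0_integralZl_EFin ?(ltW schur_const_gt0)//; last 2 first.
  - by move=> s _; rewrite mule_ge0 ?poweR_ge0.
  - by apply: measurable_funTS; exact: mkG.
  rewrite muleC -ge0_integralZl_EFin ?invr_ge0 ?(ltW t0)//; last 2 first.
  - move=> s _; apply: mule_ge0; first by rewrite lee_fin (ltW schur_const_gt0).
    by rewrite mule_ge0 ?poweR_ge0.
  - by apply: measurable_funTS; apply: measurable_funeM; exact: mkG.
  rewrite le_eqVlt; apply/orP; left; apply/eqP; apply: eq_integral => s _.
  rewrite /F/= [(t `^ (-1))%R]powR_inv1 ?(ltW t0)// muleCA; congr (_ * _).
  by rewrite muleA -EFinM mulrC.
rewrite (@tonelli_on _ _ _ _ _ leb leb _ _ F mi mi mF F0).
have -> : power_integral = \int[leb]_(s in `]0%R, +oo[) ((G s) `^ r * (s `^ (-1))%:E).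
  apply: eq_integral => s; rewrite inE/= in_itv/= andbT => s0.
  by rewrite powR_inv1// ltW.
rewrite -ge0_integralZl_EFin; last 4 first.
- exact: mi.
- by move=> s _; rewrite mule_ge0 ?poweR_ge0// lee_fin powR_ge0.
- apply: measurable_funTS; apply: emeasurable_funM; first exact: mGr.
  by apply/measurable_EFinP.
- by rewrite mulr_ge0 ?schur_mass_ge0 ?(ltW schur_const_gt0).
apply: ge0_le_integral_nomeas => s /=; rewrite in_itv/= andbT => s0.
  by apply: integral_ge0 => t _; exact: F0.
rewrite (_ : (fun t => F (t, s)) = fun t => ((schur_const%:E * (G s) `^ r * (s `^ (-1))%:E) *
   (schur t s * t `^ (-1))%:E)); last first.
  apply/funext => t; rewrite /F /= -!muleA; congr (_ * _).
  by rewrite [LHS]muleC -EFinM; congr (_ * _%:E); ring.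
have c0 : 0 <= schur_const%:E * (G s) `^ r * (s `^ (-1))%:E.
  by rewrite !mule_ge0 ?poweR_ge0// lee_fin ?powR_ge0 ?(ltW schur_const_gt0).
rewrite ge0_integralZl//; last 2 first.
- apply: measurable_funTS; apply/measurable_EFinP; apply: measurable_funM => //.
  exact: measurable_schur.
- by move=> t _; rewrite lee_fin mulr_ge0 ?powR_ge0 ?schur_ge0.
apply: (le_trans (lee_wpmul2l c0 (integral_schur_l s0))).
rewrite EFinM -!muleA.
rewrite le_eqVlt; apply/orP; left; apply/eqP; congr (_ * _).
by rewrite muleA muleC.
Qed.

End schur_test.

End schur_kernel.

(** * From a dominated rearrangement to Lorentz norms *)

Section lorentz_le.
Context {d} {T : measurableType d} {R : realType}.
Variable mu : {measure set T -> \bar R}.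
Local Notation leb := (@lebesgue_measure R).
Local Open Scope ereal_scope.
Variables p q K e0 e1 : R.
Hypotheses (p0 : (0 < p)%R) (q0 : (0 < q)%R) (K0 : (0 < K)%R).
Hypotheses (e0_gt0 : (0 < e0)%R) (e1_gt0 : (0 < e1)%R).

(** A convolution inequality on the multiplicative group ]0, oo[ between the two profiles whose
    norms in dt/t are the Lorentz norms. All bounds below are drawn from it. *)
Definition dominated_rearrangement (f g : T -> R) := forall t : R, (0 < t)%R ->
  (t `^ q^-1)%:E * rearrangement mu f t <=
  K%:E * \int[leb]_(s in `]0%R, +oo[)
    ((schur e0 e1 t s * s `^ (-1))%:E * ((s `^ p^-1)%:E * rearrangement mu g s)).

Let H a (f : T -> R) t := (t `^ a^-1)%:E * rearrangement mu f t.

Let H0 a f t : 0 <= H a f t.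
Proof. by rewrite mule_ge0 ?rearrangement_ge0// lee_fin powR_ge0. Qed.

Let mH a f : measurable_fun setT (H a f).
Proof.
apply: emeasurable_funM; last exact: measurable_rearrangement.
by apply/measurable_EFinP.
Qed.

Let M_gt0 : (0 < schur_mass e0 e1)%R.
Proof. by rewrite addr_gt0// invr_gt0. Qed.

Lemma lorentz_le_yy : exists C : R, forall f g, dominated_rearrangement f g ->
  lorentz_norm mu q +oo f <= C%:E * lorentz_norm mu p +oo g.
Proof.
exists (K * schur_mass e0 e1)%R => f g fg /=.
apply: ge_ereal_sup => _ [t + <-]; rewrite /= in_itv/= andbT => t0.
apply: (@schur_sup _ e0 e1 e0_gt0 e1_gt0 K (H p g) (H q f)) => // s s0.
by apply: ereal_sup_ubound; exists s => //=; rewrite in_itv/= s0.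
Qed.

Let poweR_root (x : \bar R) (r : R) : (0 < r)%R -> 0 <= x -> (x `^ r) `^ r^-1 = x.
Proof. by move=> r0 x0; rewrite -poweRrM mulfV ?gt_eqF// poweRe1. Qed.

Let le_poweR (x y : \bar R) (r : R) : (0 < r)%R -> 0 <= x -> x <= y -> x `^ r <= y `^ r.
Proof.
move=> r0 x0 xy; apply: gt0_ler_poweR => //; first exact: ltW.
  by rewrite in_itv/= x0 leey.
by rewrite in_itv/= (le_trans x0 xy) leey.
Qed.

Let N_ge0 r g : 0 <= power_integral (H p g) r.
Proof.
apply: integral_ge0 => s /=; rewrite in_itv/= andbT => s0.
by rewrite mule_ge0 ?poweR_ge0// lee_fin invr_ge0 ltW.
Qed.

Lemma lorentz_le_ry (r : R) : (1 <= r)%R ->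
  exists C : R, forall f g, dominated_rearrangement f g ->
  lorentz_norm mu q +oo f <= C%:E * lorentz_norm mu p r%:E g.
Proof.
move=> r1; have r0 : (0 < r)%R by exact: lt_le_trans r1.
pose c1 := schur_const e0 e1 K r.
have c1_gt0 : (0 < c1)%R by exact: schur_const_gt0.
(* The factor p/r undoes the normalisation r/p of the norm on the right. *)
exists ((c1 * (p / r)) `^ r^-1)%R => f g fg /=.
apply: ge_ereal_sup => _ [t + <-]; rewrite /= in_itv/= andbT => t0.
rewrite -[((c1 * _) `^ _)%:E]poweR_EFin -poweRM
  ?lee_fin ?mulr_ge0 ?invr_ge0 ?(ltW c1_gt0) ?(ltW p0) ?(ltW r0)//; last first.
  by apply: mule_ge0; [rewrite lee_fin divr_ge0 ?(ltW p0) ?(ltW r0)|exact: (N_ge0 r g)].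
rewrite muleA -EFinM (_ : c1 * (p / r) * (r / p) = c1)%R; last first.
  by field; rewrite !gt_eqF.
rewrite -[leLHS](poweR_root r0)//; last exact: H0.
apply: le_poweR; rewrite ?invr_gt0 ?poweR_ge0//.
exact: (@schur_pow_sup _ e0 e1 e0_gt0 e1_gt0 K (H p g) (H q f)).
Qed.

(** Write H^s as (H^r)^(s/r - 1) H^r and bound the first factor by its supremum, the second in the
    mean. The exponent s/r - 1 is nonnegative because r <= s. [c2] collects the normalisation on the
    left and the mass of the kernel, [c3] undoes the normalisation on the right. *)
Lemma lorentz_le_rs (r s : R) : (1 <= r)%R -> (r <= s)%R ->
  exists C : R, forall f g, dominated_rearrangement f g ->
  lorentz_norm mu q s%:E f <= C%:E * lorentz_norm mu p r%:E g.
Proof.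
move=> r1 rs; have r0 : (0 < r)%R by exact: lt_le_trans r1.
have s0 : (0 < s)%R by exact: lt_le_trans rs.
pose c1 := schur_const e0 e1 K r; pose M := schur_mass e0 e1.
have c1_gt0 : (0 < c1)%R by exact: schur_const_gt0.
pose c2 := ((s / q * M) `^ s^-1)%R.
have c2_gt0 : (0 < c2)%R by rewrite powR_gt0// mulr_gt0// divr_gt0.
pose c3 := ((c1 * (p / r)) `^ r^-1)%R.
have c3_gt0 : (0 < c3)%R by rewrite powR_gt0// mulr_gt0// divr_gt0.
exists (c2 * c3)%R => f g fg /=.
have := N_ge0 r g; rewrite -/(power_integral (H p g) r).
have fgH t : (0 < t)%R -> H q f t <= K%:E * \int[leb]_(s in `]0%R, +oo[)
    ((schur e0 e1 t s * s `^ (-1))%:E * H p g s) by exact: fg.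
have := schur_pow_integral e0_gt0 e1_gt0 K0 (mH p g) (H0 p g) (H0 q f) fgH r1.
have := schur_pow_sup e0_gt0 e1_gt0 K0 (mH p g) (H0 p g) (H0 q f) fgH r1.
rewrite -/c1 -/M.
case: (power_integral (H p g) r) => [N| |]//; last first.
  move=> _ _ _; rewrite gt0_muley ?lte_fin ?divr_gt0// poweRyr ?invr_eq0 ?gt_eqF//.
  by rewrite gt0_muley ?leey// lte_fin mulr_gt0.
rewrite lee_fin => Hsup Hint N0.
pose A := (c1 * N)%R; have A0 : (0 <= A)%R by rewrite mulr_ge0// ltW.
have sr : (0 <= s / r - 1)%R by rewrite subr_ge0 ler_pdivlMr// mul1r.
have sr0 : (0 < s / r)%R by rewrite divr_gt0.
have Hs t : (0 < t)%R -> (H q f t) `^ s <= (A `^ (s / r - 1))%:E * (H q f t) `^ r.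
  move=> t0; have := Hsup t t0; rewrite -EFinM -/A => hA.
  have : (H q f t) `^ r < +oo by exact: le_lt_trans hA (ltry _).
  have := H0 q f t; case: (H q f t) hA => [h| |]// hA; last first.
    by rewrite poweRyr ?gt_eqF.
  rewrite lee_fin => h0 _; move: hA; rewrite !poweR_EFin lee_fin => hA.
  rewrite -EFinM lee_fin.
  rewrite (_ : h `^ s = (h `^ r) `^ (s / r))%R; last first.
    by rewrite -powRrM mulrC divfK ?gt_eqF.
  rewrite -mulr_powRB1 ?powR_ge0// mulrC ler_wpM2r ?powR_ge0//.
  by apply: ge0_ler_powR; rewrite ?nnegrE ?powR_ge0.
have HsI : \int[leb]_(t in `]0%R, +oo[) ((H q f t) `^ s * (t^-1)%:E) <= (M * A `^ (s / r))%:E.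
  apply: (@le_trans _ _ (\int[leb]_(t in `]0%R, +oo[)
      ((A `^ (s / r - 1))%:E * ((H q f t) `^ r * (t^-1)%:E)))).
    apply: ge0_le_integral_nomeas => t /=; rewrite in_itv/= andbT => t0.
      by rewrite mule_ge0 ?poweR_ge0// lee_fin invr_ge0 ltW.
    by rewrite muleA lee_wpmul2r ?lee_fin ?invr_ge0 ?(ltW t0)// Hs.
  rewrite ge0_integralZl_EFin ?powR_ge0//; last 2 first.
  - move=> t /=; rewrite in_itv/= andbT => t0.
    by rewrite mule_ge0 ?poweR_ge0// lee_fin invr_ge0 ltW.
  - apply: emeasurable_funM.
      by apply: measurable_funTS; exact: (measurableT_comp (@measurable_poweR R r) (mH q f)).
    apply/measurable_EFinP; apply: (@eq_measurable_fun _ _ _ _ _ (fun t : R => t `^ (-1))%R).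
      by move=> t; rewrite inE/= in_itv/= andbT => t0; rewrite powR_inv1// ltW.
    exact: measurable_funTS.
  apply: (@le_trans _ _ ((A `^ (s / r - 1))%:E * (c1 * M * N)%:E)).
    by rewrite lee_wpmul2l ?lee_fin ?powR_ge0// EFinM.
  rewrite -EFinM lee_fin -(mulr_powRB1 A0 sr0) /A.
  by rewrite le_eqVlt; apply/orP; left; apply/eqP; ring.
apply: (@le_trans _ _ (((s / q)%:E * (M * A `^ (s / r))%:E) `^ s^-1)).
  apply: le_poweR; rewrite ?invr_gt0//.
    apply: mule_ge0; first by rewrite lee_fin divr_ge0 ?(ltW s0) ?(ltW q0).
    apply: integral_ge0 => t /=; rewrite in_itv/= andbT => t0.
    by rewrite mule_ge0 ?poweR_ge0// lee_fin invr_ge0 ltW.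
  by rewrite lee_wpmul2l// lee_fin divr_ge0 ?(ltW s0) ?(ltW q0).
have M0 : (0 < M)%R by [].
rewrite -!EFinM poweR_EFin lee_fin mulrA powRM ?powR_ge0//; last first.
  by rewrite !mulr_ge0 ?invr_ge0 ?(ltW s0) ?(ltW q0) ?(ltW M0).
rewrite -(powRrM A) (_ : s / r / s = r^-1)%R; last by field; rewrite !gt_eqF.
rewrite -/c2 -mulrA ler_wpM2l ?(ltW c2_gt0)//.
rewrite /c3 -powRM ?mulr_ge0 ?invr_ge0 ?(ltW c1_gt0) ?(ltW p0) ?(ltW r0)//.
rewrite le_eqVlt; apply/orP; left; apply/eqP; congr (_ `^ _)%R; rewrite /A.
by field; rewrite !gt_eqF.
Qed.

End lorentz_le.

(** * The inequality under the scaling relation *)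

Section sufficiency.
Context {R : realType} {n : nat}.
Local Notation mu := (lebesgue_rV R n).

Lemma Cc_inftyP (u : 'rV[R]_n -> R) : Cc_infty u ->
  [/\ forall i q, derivable u q (delta_mx 0 i), forall i, continuous (partial i u),
      continuous u & exists M : R, forall x, M < `|x| -> u x = 0].
Proof.
move=> [su cu]; split.
- by move=> i q; have [_ /(_ i q)] := su [::].
- by move=> i; have [] := su [:: i].
- by have [] := su [::].
have [M [_ HM]] := compact_bounded cu.
exists (M + 1) => x Mx; apply/eqP; apply: contraTT Mx => ux.
rewrite -leNgt; apply: (HM (M + 1)); first by rewrite ltrDl.
exact: subset_closure.
Qed.

Variables b c q : R.
Hypothesis n2 : (2 <= n)%N.
Hypotheses (b0 : 0 < b) (b1 : b < 1) (c0 : 0 < c) (c1 : c < 1).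
Hypotheses (q0 : 0 < q) (bcq : b + c = n%:R / q).

Let n_gt0 : 0 < n%:R :> R. Proof. by rewrite ltr0n (leq_trans _ n2). Qed.
Let n_neq0 : n%:R != 0 :> R. Proof. by rewrite gt_eqF. Qed.

(** The distances (1 - c/n) - 1/n and 1/n - (1-c)/n between the powers of s in [weak_bound] and the
    target s^(1/n). *)
Let e0 : R := (n%:R - 1 - c) / n%:R.
Let e1 : R := c / n%:R.

Let e0_gt0 : 0 < e0.
Proof.
have h : 2 <= n%:R :> R by rewrite ler_nat.
by rewrite divr_gt0//; have := c1; move: h; lra.
Qed.

Let e1_gt0 : 0 < e1. Proof. by rewrite divr_gt0. Qed.

Let qV : q^-1 = (b + c) / n%:R.
Proof. by rewrite bcq mulrAC divff ?mul1r. Qed.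

(** The relation [b + c = n / q] makes the power of t in each entry, after multiplication by
    t^(1/q), opposite to the surplus power of s; what remains depends on s/t only. *)
Lemma weak_bound_schur (t s : R) : 0 < t -> 0 < s ->
  t `^ q^-1 * weak_bound (n := n) b c t s = schur e0 e1 t s * s `^ n%:R^-1.
Proof.
move=> t0 s0; rewrite /weak_bound /schur minr_pMr ?powR_ge0// minr_pMl ?powR_ge0//.
have E (x e e' : R) : 0 < x -> x `^ e * x `^ e' = x `^ (e + e').
  by move=> x0; rewrite powRD// (gt_eqF x0) implybT.
congr Num.min; rewrite mulrA E// mulrAC E// [RHS]mulrC; congr (_ `^ _ * _ `^ _);
  by rewrite ?qV /e0 /e1; field.
Qed.

Lemma dominated_weighted : exists2 K : R, 0 < K & forall u : 'rV[R]_n -> R, Cc_infty u ->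
  dominated_rearrangement mu n%:R q K e0 e1 (weighted_fun b u) (weighted_grad c u).
Proof.
have [K K0 HK] := @rearrangement_estimate R n b c n2 b0 b1 c0 c1.
exists K => // u /Cc_inftyP[du cu u_cont su] t t0.
have := HK u du cu u_cont su t t0.
move=> /(lee_wpmul2l (_ : 0 <= (t `^ q^-1)%:E)%E); rewrite lee_fin powR_ge0 => /(_ isT).
move=> /le_trans; apply; rewrite muleCA lee_wpmul2l ?lee_fin ?(ltW K0)//.
rewrite -ge0_integralZl_EFin ?powR_ge0//; last 2 first.
- move=> s _; rewrite mule_ge0 ?rearrangement_ge0// lee_fin mulr_ge0 ?powR_ge0//.
  exact: weak_bound_ge0.
- apply: measurable_funTS; apply: emeasurable_funM; last exact: measurable_rearrangement.
  apply/measurable_EFinP; apply: measurable_funM => //.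
  exact: measurable_weak_bound.
rewrite le_eqVlt; apply/orP; left; apply/eqP; apply: eq_integral => s.
rewrite inE/= in_itv/= andbT => s0; rewrite !muleA -!EFinM; congr (_%:E * _)%E.
by rewrite mulrA weak_bound_schur// mulrAC.
Qed.

Lemma lorentz_sobolev (r s : \bar R) : (1 <= r)%E -> (r <= s)%E ->
  exists C : R, forall u : 'rV[R]_n -> R, Cc_infty u ->
   (lorentz_norm mu q s (weighted_fun b u) <=
    C%:E * lorentz_norm mu n%:R r (weighted_grad c u))%E.
Proof.
have [K K0 HK] := dominated_weighted.
case: r s => [r| |] [s| |]//; rewrite ?lee_fin => r1 rs.
- have [C HC] := @lorentz_le_rs _ _ R mu n%:R q K e0 e1 n_gt0 q0 K0 e0_gt0 e1_gt0 r s r1 rs.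
  by exists C => u /HK; exact: HC.
- have [C HC] := @lorentz_le_ry _ _ R mu n%:R q K e0 e1 n_gt0 K0 e0_gt0 e1_gt0 r r1.
  by exists C => u /HK; exact: HC.
- have [C HC] := @lorentz_le_yy _ _ R mu n%:R q K e0 e1 K0 e0_gt0 e1_gt0.
  by exists C => u /HK; exact: HC.
Qed.

End sufficiency.

(** * Necessity *)

Section bump.
Context {R : realType}.

(* The derivatives of exp(-1/(1-t^2)) all have this form. *)
Definition bump_fun (p : {poly R}) (j : nat) (t : R) : R :=
  if `|t| < 1 then p.[t] * (1 - t ^+ 2)^-1 ^+ j * expR (- (1 - t ^+ 2)^-1) else 0.

(** With w = 1 - t^2, the derivative of p w^-j exp(-1/w) is this polynomial times w^-(j+2)
    exp(-1/w). Its terms come from differentiating p, w^-j and the exponential, in this order. *)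
Definition bump_poly (p : {poly R}) (j : nat) : {poly R} :=
  p^`() * (1 - 'X ^+ 2) ^+ 2 + (j.*2)%:R *: ('X * p * (1 - 'X ^+ 2)) - 2 *: ('X * p).

Lemma one_sub_sqr_gt0 (t : R) : `|t| < 1 -> 0 < 1 - t ^+ 2.
Proof.
by move=> t1; rewrite subr_gt0 -[t ^+ 2]real_normK ?num_real// expr_lt1.
Qed.

Lemma pow_expRN_le (m : nat) (y : R) : 0 <= y -> y ^+ m.+1 * expR (- y) <= m.+1`!%:R.
Proof.
move=> y0.
have f0 : 0 < m.+1`!%:R :> R by rewrite ltr0n fact_gt0.
rewrite expRN ler_pdivrMr ?expR_gt0// mulrC -ler_pdivrMr//.
by rewrite (le_trans _ (expR_ge1Dxn m y0))// lerDr.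
Qed.

Lemma horner_bounded (p : {poly R}) : exists2 P : R, 0 <= P &
  forall t, `|t| < 1 -> `|p.[t]| <= P.
Proof.
exists (\sum_(i < size p) `|p`_i|); first exact: sumr_ge0.
move=> t t1; rewrite horner_coef (le_trans (ler_norm_sum _ _ _))//.
apply: ler_sum => i _; rewrite normrM ler_piMr// normrX.
by rewrite exprn_ile1// ltW.
Qed.

(** The exponential absorbs even w^-(j+2), at the price of a factorial. The two spare powers of w
    give the quadratic vanishing at the endpoints that makes the extension by 0 differentiable. *)
Lemma bump_fun_le (p : {poly R}) j : exists2 C : R, 0 <= C &
  forall t, `|t| < 1 -> `|bump_fun p j t| <= C * (1 - t ^+ 2) ^+ 2.
Proof.
have [P P0 HP] := horner_bounded p.
exists (P * (j.+2)`!%:R); first by rewrite mulr_ge0.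
move=> t t1; rewrite /bump_fun t1.
have w0 := one_sub_sqr_gt0 t1; set w := 1 - t ^+ 2 in w0 *.
have v0 : 0 <= w^-1 by rewrite invr_ge0 ltW.
rewrite -mulrA normrM -mulrA ler_pM// ?HP// ger0_norm; last first.
  by rewrite mulr_ge0 ?expR_ge0// exprn_ge0.
have -> : w^-1 ^+ j * expR (- w^-1) = w^-1 ^+ j.+2 * expR (- w^-1) * w ^+ 2.
  by rewrite !exprS !exprVn; field; rewrite ?expf_neq0 ?gt_eqF.
by rewrite ler_wpM2r ?pow_expRN_le// exprn_ge0// ltW.
Qed.

Lemma bump_fun_out (p : {poly R}) j t : 1 <= `|t| -> bump_fun p j t = 0.
Proof. by rewrite leNgt /bump_fun => /negbTE ->. Qed.

Lemma bump_fun_bounded (p : {poly R}) j : exists2 C : R, 0 <= C &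
  forall t, `|bump_fun p j t| <= C.
Proof.
have [C C0 HC] := bump_fun_le p j; exists C => // t.
have [t1|t1] := ltP `|t| 1; last by rewrite bump_fun_out// normr0.
apply: (le_trans (HC t t1)); rewrite ler_piMr// exprn_ile1//.
  by rewrite ltW// one_sub_sqr_gt0.
by rewrite gerBl sqr_ge0.
Qed.

Lemma is_derive_quadratic (f : R -> R) (t C : R) : 0 <= C -> f t = 0 ->
  (forall h, `|f (h + t)| <= C * h ^+ 2) -> is_derive t 1 f 0.
Proof.
move=> C0 ft Hf.
suff h : (fun h => h^-1 *: ((f \o shift t) (h *: (1 : R)) - f t)) @ 0^' --> (0 : R).
  by split; [apply/cvg_ex; eexists; exact: h|exact/cvg_lim].
apply/cvgrPdist_le => e e0; near=> h.
have h0 : h != 0 by near: h; exact: nbhs_dnbhs_neq.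
rewrite sub0r normrN /= ft subr0 [h%:A]mulr1 normrM normfV ler_pdivrMl ?normr_gt0//.
apply: (le_trans (Hf h)); rewrite -[h ^+ 2]real_normK ?num_real// expr2 mulrCA.
rewrite ler_wpM2l//; apply: (@le_trans _ _ ((C + 1) * `|h|)).
  by rewrite ler_wpM2r// lerDl.
rewrite mulrC -ler_pdivlMr ?ltr_wpDl//.
near: h; apply: nbhs_dnbhs; exists (e / (C + 1)) => /=.
  by rewrite divr_gt0// ltr_wpDl.
by move=> h /=; rewrite sub0r normrN => /ltW.
Unshelve. all: by end_near. Qed.

Lemma is_derive_bump (p : {poly R}) j (t : R) :
  is_derive t 1 (bump_fun p j) (bump_fun (bump_poly p j) j.+2 t).
Proof.
have [t1|t1] := ltP `|t| 1; last first.
  rewrite bump_fun_out//.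
  have [C C0 HC] := bump_fun_le p j.
  (* For |t| >= 1 and |h + t| < 1, the factor 1 - (h+t)^2 is at most 2 (1 - |h+t|), hence at most 2
     |h|; its square gives the 4. *)
  apply: (@is_derive_quadratic _ _ (C * 4)); [by rewrite mulr_ge0|exact: bump_fun_out|].
  move=> h; have [ht|ht] := ltP `|h + t| 1; last first.
    by rewrite bump_fun_out// normr0 mulr_ge0 ?sqr_ge0// mulr_ge0.
  apply: (le_trans (HC _ ht)); rewrite -mulrA ler_wpM2l//.
  have -> : 4 * h ^+ 2 = (2 * `|h|) ^+ 2.
    by rewrite exprMn real_normK ?num_real// -natrX.
  have w0 := one_sub_sqr_gt0 ht.
  rewrite lerXn2r ?nnegrE ?mulr_ge0 ?(ltW w0)//.
  rewrite -[_ ^+ 2]real_normK ?num_real//.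
  have := ler_normB (h + t) h; rewrite addrAC subrr add0r.
  have := normr_ge0 (h + t); have := normr_ge0 h; move: ht t1.
  by move: `|h + t| `|h| `|t| => a x y; nra.
have w0 := one_sub_sqr_gt0 t1.
pose w := fun t : R => 1 - t ^+ 2.
pose v := fun t : R => (w t)^-1.
have dw : is_derive t 1 w (- (2 * t)).
  have := is_derive_poly (1 - 'X ^+ 2 : {poly R}) t.
  rewrite derivB -[1 : {poly R}]/(1%:P) derivC derivXn sub0r => h.
  have -> : w = horner (1 - 'X ^+ 2) by apply/funext => x; rewrite !hornerE.
  by apply: is_derive_eq h _; rewrite hornerN hornerMn expr1 hornerX mulr_natl.
have wt0 : w t != 0 by rewrite /w gt_eqF.
have dv : is_derive t 1 v (2 * t * (v t) ^+ 2).
  apply: is_derive_eq (is_deriveV wt0 dw) _.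
  by rewrite /v [_ *: _]/GRing.scale/= exprVn; field.
have dvN : is_derive t 1 (fun x => - v x) (- (2 * t * (v t) ^+ 2)) by apply: is_deriveN.
have dE : is_derive t 1 (expR \o (fun x => - v x)) (expR (- v t) * (- (2 * t * (v t) ^+ 2))).
  exact: is_derive1_comp.
have dP : is_derive t 1 (fun x => p.[x]) p^`().[t] by exact: is_derive_poly.
have dJ : is_derive t 1 (v ^+ j) ((j%:R * (v t) ^+ j.-1) *: (2 * t * (v t) ^+ 2)).
  exact: is_deriveX.
have := is_deriveM (is_deriveM dP dJ) dE.
move=> dF; apply: (is_derive_eq (near_eq_is_derive _ dF)).
  near=> x; rewrite /bump_fun ifT; first by rewrite !fctE.
  near: x; have : continuous (fun y : R => `|y|) by exact: norm_continuous.
  by move=> /(_ t) /cvgr_lt; apply.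
rewrite /bump_fun t1 /bump_poly !exprSr !hornerE -!expr2 -/(w t) -/(v t) !fctE.
rewrite -muln2 natrM ![_ *: _]/GRing.scale/=.
have vw : v t = (w t)^-1 by [].
move: (expR _) (p.[t]) (p^`().[t]) => E P P'.
rewrite vw; move: (w t) wt0 => y y0.
case: j {dJ dF} => [|k]; rewrite ?succnK ?exprS ?expr0; field; rewrite ?y0 ?expf_neq0//.
Unshelve. all: by end_near. Qed.


End bump.

(** * Products of one-variable functions *)

Section product_function.
Context {R : realType} {n : nat}.
Variable psi : nat -> R -> R.
Hypothesis dpsi : forall k (x : R), is_derive x 1 (psi k) (psi k.+1 x).

(** [k] is a multi-index. As [psi k] is the k-th derivative of [psi 0], this is a mixed partial
    derivative of the plain product, and iterating along a list of directions only counts how often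
    each occurs. *)
Definition prod_fun (k : 'I_n -> nat) (x : 'rV[R]_n) : R := \prod_i psi (k i) (x 0 i).

Lemma is_derive_of_line (u : 'rV[R]_n -> R) p z (l : R) :
  is_derive (0 : R) 1 (fun s : R => u (p + s *: z)) l -> is_derive p z u l.
Proof.
move=> [du <-].
have E : (fun h : R => h^-1 *: (((fun s => u (p + s *: z)) \o shift 0) (h *: (1 : R)) -
            u (p + 0 *: z))) =
    (fun h => h^-1 *: ((u \o shift p) (h *: z) - u p)).
  apply/funext => h /=; rewrite scale0r !addr0; congr (_ *: (u _ - _)).
  by rewrite [h%:A]mulr1 addrC.
by move: du; rewrite /derivable/derive E => du; split.
Qed.

Lemma is_derive_prod_fun (k : 'I_n -> nat) (i : 'I_n) (q : 'rV[R]_n) :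
  is_derive q (delta_mx 0 i) (prod_fun k) (prod_fun (fun j => (j == i) + k j)%N q).
Proof.
apply: is_derive_of_line.
pose c := \prod_(j < n | j != i) psi (k j) (q 0 j).
have -> : (fun s : R => prod_fun k (q + s *: delta_mx 0 i)) =
    c \*: (psi (k i) \o (fun s => s + q 0 i)).
  apply/funext => s /=; rewrite /prod_fun (bigD1 i)//= mulrC; congr (_ * _).
    by apply: eq_bigr => j ji; rewrite !mxE eqxx (negbTE ji) mulr0 addr0.
  by rewrite !mxE !eqxx mulr1 addrC.
have -> : prod_fun (fun j => (j == i) + k j)%N q = c * (psi (k i).+1 (q 0 i) * 1).
  rewrite /prod_fun (bigD1 i)//= eqxx mulr1 mulrC; congr (_ * _).
  by apply: eq_bigr => j /negbTE ->.
apply: is_deriveZ; apply: is_derive1_comp; last exact: is_derive_shift.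
by rewrite add0r; exact: dpsi.
Qed.

Lemma iter_partial_prod_fun (s : seq 'I_n) :
  iter_partial s (prod_fun (fun=> 0%N)) = prod_fun (fun j => count_mem j s).
Proof.
elim: s => [//|i s IH] /=; rewrite IH; apply/funext => q.
have h := is_derive_prod_fun (fun j => count_mem j s) i q.
by rewrite /partial derive_val /prod_fun; apply: eq_bigr => j _; rewrite eq_sym.
Qed.

Lemma continuous_prod_fun k : continuous (prod_fun k).
Proof.
apply: continuous_big => [|i _ x]; first exact: mul_continuous.
have pc : continuous (psi (k i)).
  move=> y; apply: differentiable_continuous; apply/derivable1_diffP.
  exact: ex_derive.
exact: (cvg_comp _ _ (@coord_continuous _ _ _ 0 i x) (pc _)).
Qed.

Lemma smooth_prod_fun : smooth (prod_fun (fun=> 0%N)).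
Proof.
move=> s; rewrite iter_partial_prod_fun; split; first exact: continuous_prod_fun.
by move=> i x; have [] := is_derive_prod_fun (fun j => count_mem j s) i x.
Qed.

Lemma Cc_infty_prod_fun (rho : R) : (forall t, rho < `|t| -> psi 0 t = 0) ->
  0 <= rho -> Cc_infty (prod_fun (fun=> 0%N)).
Proof.
move=> psi0 rho0; split; first exact: smooth_prod_fun.
have supp : [set x | prod_fun (fun=> 0%N) x != 0] `<=` [set x : 'rV[R]_n | `|x| <= rho].
  move=> x /= ux; apply/rV_norm_leP => // i; rewrite leNgt; apply: contra ux => /psi0 xi.
  by rewrite /prod_fun (bigD1 i)//= xi mul0r.
have cl : closed [set x : 'rV[R]_n | `|x| <= rho].
  have nc : continuous (fun x : 'rV[R]_n => `|x|) by exact: norm_continuous.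
  by have := closed_comp (fun x _ => nc x) (@closed_le R rho).
have cls : closure [set x | prod_fun (fun=> 0%N) x != 0] `<=`
    [set x : 'rV[R]_n | `|x| <= rho].
  by rewrite [X in _ `<=` X]((closure_id _).1 cl); exact: closure_subset.
apply: bounded_closed_compact; last exact: closed_closure.
exists rho; split; first exact: num_real.
by move=> M rM x /cls /= xr; rewrite (le_trans xr)// ltW.
Qed.

End product_function.

(** * Lorentz norms compared with steps *)

Section lorentz_bounds.
Context {d} {T : measurableType d} {R : realType}.
Variable mu : {measure set T -> \bar R}.
Local Notation leb := (@lebesgue_measure R).
Local Open Scope ereal_scope.

(** The normalisation r/p makes the norm of a step independent of r, so the two bounds that follow
    hold for all second indices with the same constants. *)
Lemma integral_power_step (p r c S : R) : (0 < p)%R -> (0 < r)%R -> (0 <= c)%R -> (0 < S)%R ->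
  ((r / p)%:E * \int[leb]_(t in `]0%R, S])
     (((t `^ p^-1)%:E * c%:E) `^ r * (t^-1)%:E)) `^ r^-1 = (c * S `^ p^-1)%:E.
Proof.
move=> p0 r0 c0 S0.
have rp : (0 < r / p)%R by rewrite divr_gt0.
have -> : \int[leb]_(t in `]0%R, S]) (((t `^ p^-1)%:E * c%:E) `^ r * (t^-1)%:E) =
    \int[leb]_(t in `]0%R, S]) ((c `^ r)%:E * (t `^ (r / p - 1))%:E).
  apply: eq_integral => t; rewrite inE/= in_itv/= => /andP[t0 _].
  rewrite powRM ?powR_ge0// -powRrM [(p^-1 * r)%R]mulrC -!EFinM.
  rewrite [(t `^ (_ - _))%R]powRD ?(gt_eqF t0) ?implybT// powR_inv1 ?(ltW t0)//.
  by congr EFin; rewrite mulrA [(c `^ r * _)%R]mulrC.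
rewrite ge0_integralZl_EFin ?powR_ge0//; last 2 first.
- by move=> t _; rewrite lee_fin powR_ge0.
- by apply/measurable_EFinP; exact: measurable_funTS.
rewrite integral_powR_0// -!EFinM poweR_EFin; congr EFin.
rewrite (_ : r / p * _ = c `^ r * S `^ (r / p))%R; last first.
  by field; rewrite !gt_eqF.
rewrite powRM ?powR_ge0// -!powRrM mulfV ?gt_eqF// powRr1//; congr (_ * _ `^ _)%R.
by field; rewrite !gt_eqF.
Qed.

Lemma lorentz_le_step (p M S : R) (r : \bar R) (g : T -> R) :
  (0 < p)%R -> 1 <= r -> (0 <= M)%R -> (0 < S)%R ->
  (forall x, (`|g x| <= M)%R) -> mu [set x | (0 < `|g x|)%R] <= S%:E ->
  lorentz_norm mu p r g <= (M * S `^ p^-1)%:E.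
Proof.
move=> p0 r1 M0 S0 gM gS.
have gM' t : (0 < t)%R -> rearrangement mu g t <= M%:E.
  move=> t0; apply: ereal_inf_lbound; exists M => //; split => //.
  rewrite (_ : [set x | _] = set0) ?measure0 ?lee_fin ?(ltW t0)//.
  by apply/seteqP; split => // x /=; rewrite ltNge gM.
have gT t : (S <= t)%R -> rearrangement mu g t = 0.
  move=> St; apply/eqP; rewrite eq_le rearrangement_ge0 andbT.
  apply: ereal_inf_lbound; exists 0%R => //; split => //.
  by apply: (le_trans gS); rewrite lee_fin.
case: r r1 => [r| |]// r1; last first.
  rewrite /=; apply: ge_ereal_sup => _ [t + <-]; rewrite /= in_itv/= andbT => t0.
  have [St|/ltW tS] := leP S t.
    by rewrite gT// mule0 lee_fin mulr_ge0 ?powR_ge0.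
  rewrite mulrC EFinM; apply: lee_pmul.
  - by rewrite lee_fin powR_ge0.
  - exact: rearrangement_ge0.
  - rewrite lee_fin; apply: ge0_ler_powR => //; rewrite ?nnegrE ?invr_ge0 ?(ltW p0)//;
      exact: ltW.
  - exact: gM'.
rewrite lee_fin in r1; have r0 : (0 < r)%R by exact: lt_le_trans r1.
rewrite /= -(@integral_power_step p r M S)//.
have h0 (c : \bar R) t : (0 < t)%R -> 0 <= c -> 0 <= ((t `^ p^-1)%:E * c) `^ r * (t^-1)%:E.
  by move=> t0 c0; rewrite mule_ge0 ?poweR_ge0// lee_fin invr_ge0 ltW.
apply: gt0_ler_poweR; rewrite ?invr_ge0 ?(ltW r0)//.
- rewrite in_itv/= leey andbT; apply: mule_ge0; first by rewrite lee_fin divr_ge0 ?ltW.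
  apply: integral_ge0 => t /=; rewrite in_itv/= andbT => t0.
  by apply: h0 => //; exact: rearrangement_ge0.
- rewrite in_itv/= leey andbT; apply: mule_ge0; first by rewrite lee_fin divr_ge0 ?ltW.
  by apply: integral_ge0 => t /=; rewrite in_itv/= => /andP[t0 _];
    apply: mule_ge0; rewrite lee_fin ?powR_ge0 ?invr_ge0 ?(ltW t0).
rewrite lee_wpmul2l ?lee_fin ?divr_ge0 ?(ltW r0) ?(ltW p0)//.
rewrite integral_mkcond [leRHS]integral_mkcond.
apply: ge0_le_integral_nomeas => t _.
  apply: erestrict_ge0 => {}t /=; rewrite in_itv/= andbT => t0.
  by apply: h0 => //; exact: rearrangement_ge0.
rewrite !patchE !mem_setE !in_itv/= andbT.
have [t0|] //= := ltP 0%R t.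
have [tS|/ltW St] := leP t S; last first.
  by rewrite gT// mule0 poweR0r ?gt_eqF// mul0e.
rewrite lee_wpmul2r ?lee_fin ?invr_ge0 ?(ltW t0)//.
rewrite -[((_ * _) `^ r)%:E]poweR_EFin EFinM.
apply: gt0_ler_poweR; rewrite ?(ltW r0)//.
- by rewrite in_itv/= leey andbT mule_ge0 ?rearrangement_ge0// lee_fin powR_ge0.
- by rewrite in_itv/= leey andbT mule_ge0// lee_fin powR_ge0.
- by rewrite lee_wpmul2l ?lee_fin ?powR_ge0// gM'.
Qed.

(** The rearrangement is at least k for t < S, but at t = S a smaller level may already be
    admissible when mu A = S. Halving S leaves a closed interval on which the bound holds. *)
Lemma lorentz_ge_step (p k S : R) (r : \bar R) (f : T -> R) (A : set T) :
  (0 < p)%R -> 1 <= r -> (0 <= k)%R -> (0 < S)%R ->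
  measurable_fun setT f -> measurable A ->
  (forall x, A x -> (k <= `|f x|)%R) -> S%:E <= mu A ->
  (k * (S / 2) `^ p^-1)%:E <= lorentz_norm mu p r f.
Proof.
move=> p0 r1 k0 S0 mf mA Ak SA.
have S20 : (0 < S / 2)%R by rewrite divr_gt0.
have kf t : (t <= S / 2)%R -> k%:E <= rearrangement mu f t.
  move=> tS; apply: le_ereal_inf_tmp => _ [l [l0 hl] <-].
  rewrite leNgt lte_fin; apply/negP => lk.
  suff : S%:E <= t%:E.
    by rewrite lee_fin leNgt (le_lt_trans tS)// ltr_pdivrMr// ltr_pMr// ltr1n.
  apply: (le_trans SA); apply: le_trans hl; apply: le_measure; rewrite ?inE//.
    apply: (@measurable_level _ _ _ (fun x => `|f x|%R)).
    exact: (measurableT_comp (@normr_measurable R setT) mf).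
  by move=> x /Ak; exact: lt_le_trans.
case: r r1 => [r| |]// r1; last first.
  rewrite /=; apply: (@le_trans _ _ (((S / 2) `^ p^-1)%:E * rearrangement mu f (S / 2))).
    by rewrite mulrC EFinM lee_wpmul2l ?lee_fin ?powR_ge0// kf.
  by apply: ereal_sup_ubound; exists (S / 2)%R => //=; rewrite in_itv/= S20.
rewrite lee_fin in r1; have r0 : (0 < r)%R by exact: lt_le_trans r1.
rewrite /= -(@integral_power_step p r k (S / 2))//.
have h0 (c : \bar R) t : (0 < t)%R -> 0 <= c -> 0 <= ((t `^ p^-1)%:E * c) `^ r * (t^-1)%:E.
  by move=> t0 c0; rewrite mule_ge0 ?poweR_ge0// lee_fin invr_ge0 ltW.
apply: gt0_ler_poweR; rewrite ?invr_ge0 ?(ltW r0)//.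
- rewrite in_itv/= leey andbT; apply: mule_ge0; first by rewrite lee_fin divr_ge0 ?ltW.
  by apply: integral_ge0 => t /=; rewrite in_itv/= => /andP[t0 _];
    apply: mule_ge0; rewrite lee_fin ?powR_ge0 ?invr_ge0 ?(ltW t0).
- rewrite in_itv/= leey andbT; apply: mule_ge0; first by rewrite lee_fin divr_ge0 ?ltW.
  apply: integral_ge0 => t /=; rewrite in_itv/= andbT => t0.
  by apply: h0 => //; exact: rearrangement_ge0.
rewrite lee_wpmul2l ?lee_fin ?divr_ge0 ?(ltW r0) ?(ltW p0)//.
rewrite integral_mkcond [leRHS]integral_mkcond.
apply: ge0_le_integral_nomeas => t _.
  by apply: erestrict_ge0 => {}t /=; rewrite in_itv/= => /andP[t0 _];
    apply: mule_ge0; rewrite lee_fin ?powR_ge0 ?invr_ge0 ?(ltW t0).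
rewrite !patchE !mem_setE !in_itv/= andbT.
have [t0|] //= := ltP 0%R t.
have [tS|_] := leP t (S / 2)%R; last by apply: h0 => //; exact: rearrangement_ge0.
rewrite lee_wpmul2r ?lee_fin ?invr_ge0 ?(ltW t0)//.
rewrite -[((_ * _) `^ r)%:E]poweR_EFin EFinM.
apply: gt0_ler_poweR; rewrite ?(ltW r0)//.
- by rewrite in_itv/= leey andbT mule_ge0// lee_fin powR_ge0.
- by rewrite in_itv/= leey andbT mule_ge0 ?rearrangement_ge0// lee_fin powR_ge0.
- by rewrite lee_wpmul2l ?lee_fin ?powR_ge0// kf.
Qed.

End lorentz_bounds.

(** * Dilated bumps and the scaling relation *)

Section necessity.
Context {R : realType}.

Lemma bump_exists : exists phi : nat -> R -> R,
  [/\ forall k (t : R), is_derive t 1 (phi k) (phi k.+1 t),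
      forall k t, 1 <= `|t| -> phi k t = 0,
      exists2 a : R, 0 < a & forall t, `|t| <= 2^-1 -> a <= phi 0 t &
      exists2 B : R, 0 <= B & forall k t, (k <= 1)%N -> `|phi k t| <= B].
Proof.
(* Each differentiation raises the pole order by 2, so the k-th derivative has numerator [P k] and
   order [k.*2]. *)
pose P := fix P k : {poly R} := if k is k'.+1 then bump_poly (P k') k'.*2 else 1.
pose phi k := bump_fun (P k) k.*2.
exists phi; split.
- by move=> k t; exact: is_derive_bump.
- by move=> k t; exact: bump_fun_out.
(* For |t| <= 1/2 the quantity 1 - t^2 is at least 1/2, so its inverse is at most 2. *)
- exists (expR (- 2)); first exact: expR_gt0.
  move=> t t2; rewrite /phi /= /bump_fun ifT; last first.
    by rewrite (le_lt_trans t2)// invf_lt1// ltr1n.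
  rewrite hornerC expr0 !mul1r ler_expR lerN2.
  have h : 2^-1 <= 1 - t ^+ 2.
    have t4 : t ^+ 2 <= 2^-1 ^+ 2.
      by rewrite -[t ^+ 2]real_normK ?num_real// lerXn2r ?nnegrE ?invr_ge0.
    by move: t4; rewrite expr2; lra.
  by rewrite -[leRHS]invrK lef_pV2 ?posrE ?invr_gt0// (lt_le_trans _ h)// invr_gt0.
have [B0 B0_ge0 HB0] := bump_fun_bounded (P 0%N) 0.
have [B1 B1_ge0 HB1] := bump_fun_bounded (P 1%N) 2.
exists (B0 + B1); first exact: addr_ge0.
move=> [|[|//]] t _; first by rewrite (le_trans (HB0 t))// lerDl.
by rewrite (le_trans (HB1 t))// lerDr.
Qed.

Context {n : nat}.
Local Notation mu := (lebesgue_rV R n).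
Hypothesis n2 : (2 <= n)%N.
Variables b c q : R.
Hypotheses (b0 : 0 < b) (c0 : 0 < c) (q0 : 0 < q).

Let n_gt0 : 0 < n%:R :> R. Proof. by rewrite ltr0n (leq_trans _ n2). Qed.

(** The bump lives on a cube of size 1/lam. Its weighted height is of order lam^b, and the measure
    lam^-n enters to the power 1/q. On the right the weighted gradient is of order lam^(1-c), and
    the measure to the power 1/n contributes 1/lam. *)
Lemma scaled_bump_estimates : exists2 D1 : R, 0 < D1 & exists2 D2 : R, 0 <= D2 &
  forall lam : R, 0 < lam -> exists2 u : 'rV[R]_n -> R, Cc_infty u &
  forall r s : \bar R, (1 <= r)%E -> (1 <= s)%E ->
    ((D1 * lam `^ (b - n%:R / q))%:E <= lorentz_norm mu q s (weighted_fun b u))%E /\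
    (lorentz_norm mu n%:R r (weighted_grad c u) <= (D2 * lam `^ (- c))%:E)%E.
Proof.
have [phi [dphi phi0 [a a0 Ha] [B B0 HB]]] := bump_exists.
exists ((n%:R / 2) `^ (- b) * a ^+ n * (4^-1 ^+ n / 2) `^ q^-1).
  by rewrite !mulr_gt0 ?powR_gt0 ?exprn_gt0 ?mulr_gt0 ?invr_gt0 ?exprn_gt0 ?invr_gt0.
(* The two powers of n pass from the sup to the Euclidean norm, in the weight and in the gradient; 2
   is the n-th root of the volume factor 2^n of the supporting cube. *)
exists (n%:R `^ c * n%:R * B ^+ n * 2).
  by rewrite !mulr_ge0 ?powR_ge0 ?exprn_ge0.
move=> lam lam0.
pose psi k (t : R) := lam ^+ k * phi k (lam * t).
have dpsi k (t : R) : is_derive t 1 (psi k) (psi k.+1 t).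
  have -> : psi k = (lam ^+ k) \*: (phi k \o (lam \*: (@id R))) by [].
  have -> : psi k.+1 t = lam ^+ k * (phi k.+1 (lam * t) * lam).
    by rewrite /psi exprSr -mulrA [lam * phi _ _]mulrC.
  apply: is_deriveZ; apply: is_derive1_comp.
  by apply: is_derive_eq; rewrite [_ *: _]mulr1.
have psi0 k t : lam^-1 <= `|t| -> psi k t = 0.
  move=> ht; rewrite /psi phi0 ?mulr0// normrM gtr0_norm//.
  by rewrite -(ler_pM2l lam0) mulfV ?gt_eqF// in ht.
pose u := prod_fun (n := n) psi (fun=> 0%N).
have lamV0 : 0 <= lam^-1 by rewrite invr_ge0 ltW.
have Cu : Cc_infty u.
  by apply: (Cc_infty_prod_fun dpsi _ lamV0) => t /ltW; exact: psi0.
exists u => // r s r1 s1.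
have [du cu u_cont _] := Cc_inftyP Cu.
have lamE e : lam^-1 `^ e = lam `^ (- e).
  by rewrite -[lam^-1]powR_inv1 ?(ltW lam0)// -powRrM mulN1r.
split.
(* The cube [l, 2l]^n avoids the origin, where the weight is 0 by convention, and stays within |x|
   <= 1/(2 lam), where every factor of the bump is at least [a]. *)
- pose l := 4^-1 * lam^-1.
  have l0 : 0 < l by rewrite mulr_gt0 ?invr_gt0.
  pose A := [set v : 'rV[R]_n | forall i, (const_mx l : 'rV_n) 0 i <= v 0 i <=
    (const_mx l : 'rV_n) 0 i + l].
  have mA : measurable A.
    have := measurable_rV_box (const_mx l : 'rV[R]_n) (const_mx l + const_mx l).
    by congr measurable; apply/seteqP; split => v /= H i; have := H i; rewrite !mxE.
  have AE : mu A = (l ^+ n)%:E by apply: lebesgue_rV_box; exact: ltW.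
  have AE' : ((l ^+ n)%:E <= mu A)%E by rewrite AE.
  have := @lorentz_ge_step _ _ R mu q ((n%:R / 2 * lam^-1) `^ (- b) * a ^+ n) (l ^+ n) s
    (weighted_fun b u) A q0 s1.
  have -> : (n%:R / 2 * lam^-1) `^ (- b) * a ^+ n * (l ^+ n / 2) `^ q^-1 =
    (n%:R / 2) `^ (- b) * a ^+ n * (4^-1 ^+ n / 2) `^ q^-1 * lam `^ (b - n%:R / q).
    rewrite powRM ?divr_ge0// lamE opprK /l exprMn.
    rewrite [4^-1 ^+ n * _ / 2]mulrAC [(_ * lam^-1 ^+ n) `^ _]powRM ?exprn_ge0//.
    rewrite -[lam^-1 ^+ n]powR_mulrn// -powRrM lamE.
    rewrite [lam `^ (b - _)]powRD ?(gt_eqF lam0) ?implybT//.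
    by ring.
  apply.
  + by rewrite mulr_ge0 ?powR_ge0// exprn_ge0// ltW.
  + exact: exprn_gt0.
  + exact: measurable_weighted_fun.
  + exact: mA.
  + move=> x Ax.
    have hx i : 0 < x 0 i /\ x 0 i <= 2^-1 * lam^-1.
      have /andP[h1 h2] := Ax i; move: h1 h2; rewrite !mxE => h1 h2.
      split; first exact: lt_le_trans h1.
      by apply: (le_trans h2); rewrite /l; lra.
    have x2 : `|x| <= 2^-1 * lam^-1.
      apply/rV_norm_leP => [|i]; first by rewrite mulr_ge0.
      by have [h1 h2] := hx i; rewrite gtr0_norm.
    have ex0 : 0 < eucl_norm x.
      apply: lt_le_trans (rV_coord_le_eucl x (Ordinal (leq_trans (ltnW (ltnSn 1)) n2))).
      by have [h1 _] := hx (Ordinal (leq_trans (ltnW (ltnSn 1)) n2)); rewrite normr_gt0 gt_eqF.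
    have exn : eucl_norm x <= n%:R / 2 * lam^-1.
      by apply: (le_trans (eucl_le_norm x)); rewrite -mulrA ler_wpM2l.
    have ux : a ^+ n <= u x.
      rewrite /u /prod_fun -[n in a ^+ n]card_ord -prodr_const.
      apply: ler_prod => i _; rewrite (ltW a0)/= /psi expr0 mul1r Ha//.
      have [h1 h2] := hx i; rewrite normrM !gtr0_norm//.
      by rewrite -(ler_pM2l lam0) mulrCA mulfV ?mulr1 ?gt_eqF// in h2.
    rewrite /weighted_fun normrM ger0_norm ?powR_ge0// ler_pM ?powR_ge0 ?exprn_ge0 ?(ltW a0)//.
      by rewrite powR_le_neg// oppr_le0 ltW.
    exact: le_trans ux (ler_norm _).
  + exact: AE'.
have partialE i x : partial i u x = prod_fun (n := n) psi (fun j => (j == i) + 0)%N x.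
  by have h := is_derive_prod_fun dpsi (fun=> 0%N) i x; rewrite /partial derive_val.
have gout x : lam^-1 < `|x| -> gradient u x = 0.
  move=> lx; have [j lj] : exists j, lam^-1 < `|x 0 j|.
    apply: contrapT => /forallNP H; move: lx; rewrite ltNge => /negP; apply.
    by apply/rV_norm_leP => // j; rewrite leNgt; apply/negP.
  apply/rowP => i; rewrite !mxE partialE /prod_fun (bigD1 j)//= psi0 ?mul0r//.
  exact: ltW.
have gle i x : `|partial i u x| <= lam * B ^+ n.
  rewrite partialE /prod_fun normr_prod.
  apply: (@le_trans _ _ (\prod_(j < n) ((if j == i then lam else 1) * B))).
    apply: ler_prod => j _; rewrite normr_ge0/= /psi normrM addn0.
    apply: ler_pM => //; last by apply: HB; case: (j == i).
    by case: (j == i); rewrite ?expr1 ?expr0 ?normr1// gtr0_norm.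
  rewrite big_split/= prodr_const card_ord -big_mkcond big_pred1_eq.
  exact: lexx.
have -> : n%:R `^ c * n%:R * B ^+ n * 2 * lam `^ (- c) =
    ((n%:R * lam^-1) `^ c * (n%:R * (lam * B ^+ n))) * ((2 * lam^-1) ^+ n) `^ n%:R^-1.
  rewrite -[(_ * lam^-1) ^+ n]powR_mulrn ?mulr_ge0// -powRrM mulfV ?gt_eqF//.
  rewrite powRr1 ?mulr_ge0// powRM// lamE.
  by field; rewrite gt_eqF.
apply: lorentz_le_step => //.
- by rewrite !mulr_ge0 ?powR_ge0 ?exprn_ge0 ?(ltW lam0).
- by rewrite exprn_gt0// mulr_gt0// invr_gt0.
- move=> x; rewrite ger0_norm ?weighted_grad_ge0// weighted_gradE.
  have [xl|lx] := leP `|x| lam^-1; last first.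
    rewrite (gout _ lx) eucl_norm0 mulr0.
    by rewrite !mulr_ge0 ?powR_ge0 ?exprn_ge0 ?(ltW lam0).
  apply: ler_pM; rewrite ?powR_ge0 ?eucl_norm_ge0//.
    apply: ge0_ler_powR; rewrite ?nnegrE ?eucl_norm_ge0 ?mulr_ge0 ?(ltW c0)//.
    by apply: (le_trans (eucl_le_norm x)); rewrite ler_wpM2l.
  apply: (le_trans (eucl_le_norm _)); rewrite ler_wpM2l//.
  apply/rV_norm_leP => [|i]; first by rewrite mulr_ge0 ?exprn_ge0// ltW.
  by rewrite mxE.
rewrite -(lebesgue_rV_ball (0 : 'rV[R]_n) lamV0); apply: le_measure; rewrite ?inE.
- apply: (@measurable_level _ _ _ (fun x => `|weighted_grad c u x|)).
  by apply: (measurableT_comp (@normr_measurable R setT)); exact: measurable_weighted_grad.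
- exact: measurable_rV_ball.
move=> x /=; rewrite subr0 leNgt => gx; apply/negP => /gout gx0.
by move: gx; rewrite weighted_gradE gx0 eucl_norm0 mulr0 normr0 ltxx.
Qed.

(** The bumps would give D1 lam^theta <= |C| D2 for every lam > 0, where theta is the defect in the
    relation; a nonzero theta makes the left side arbitrarily large. *)
Lemma necessary_scaling (r s : \bar R) : (1 <= r)%E -> (r <= s)%E ->
  (exists C : R, forall u : 'rV[R]_n -> R, Cc_infty u ->
   (lorentz_norm mu q s (weighted_fun b u) <=
    C%:E * lorentz_norm mu n%:R r (weighted_grad c u))%E) ->
  b + c = n%:R / q.
Proof.
move=> r1 rs [C HC]; have s1 := le_trans r1 rs.
have [D1 D1_gt0 [D2 D2_ge0 HD]] := scaled_bump_estimates.
apply/eqP; rewrite -subr_eq0; apply/negPn/negP => theta0.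
set theta := b + c - n%:R / q in theta0.
pose E := `|C| * D2.
have E0 : 0 <= E by exact: mulr_ge0.
have E1 : 0 < (E + 1) / D1 by rewrite divr_gt0// ltr_wpDl.
(* Solves D1 lam^theta = E + 1, which contradicts the bound by E whatever the sign of theta. *)
pose lam := ((E + 1) / D1) `^ theta^-1.
have lam0 : 0 < lam by exact: powR_gt0.
have [u Cu /(_ r s r1 s1)[H1 H2]] := HD lam lam0.
have : ((D1 * lam `^ (b - n%:R / q))%:E <= (E * lam `^ (- c))%:E)%E.
  apply: (le_trans H1); apply: (le_trans (HC u Cu)).
  rewrite /E -mulrA EFinM; apply: (@le_trans _ _
    (`|C|%:E * lorentz_norm mu n%:R r (weighted_grad c u))%E).
    apply: lee_wpmul2r; last by rewrite lee_fin ler_norm.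
    case: (r) => [r'| |]//=; first exact: poweR_ge0.
    apply: le_ereal_sup_tmp; exists (((1 : R) `^ n%:R^-1)%:E *
      rearrangement mu (weighted_grad c u) 1)%E.
      by exists 1 => //=; rewrite in_itv/= ltr01.
    by rewrite mule_ge0 ?rearrangement_ge0// lee_fin powR_ge0.
  by rewrite lee_wpmul2l// lee_fin.
rewrite lee_fin -(ler_pM2r (powR_gt0 c lam0)) -!mulrA -!powRD ?(gt_eqF lam0) ?implybT//.
rewrite addNr powRr0 mulr1 addrAC -/theta /lam -powRrM mulVf// powRr1 ?(ltW E1)//.
by rewrite mulrC divfK ?gt_eqF// leNgt ltrDl ltr01.
Qed.

End necessity.

Unset Implicit Arguments.
Set Strict Implicit.

Theorem theorem5p10 (R : realType) (d : nat) (q beta gamma : R)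
    (d_ge2 : (2 <= d)%N) (d_le_q : d%:R <= q)
    (beta_gt0 : 0 < beta) (gamma_gt0 : 0 < gamma)
    (gamma_le : gamma <= d%:R / q) (gamma_lt : gamma < d%:R - 1) :
  (beta + gamma = d%:R / q ->
   forall r s : \bar R, (1 <= r)%E -> (r <= s)%E ->
   exists C : R, forall u : 'rV[R]_d -> R, Cc_infty u ->
     (lorentz_norm (lebesgue_rV R d) q s
        (fun x => (eucl_norm x `^ (- beta) * u x)%R)
      <= C%:E * lorentz_norm (lebesgue_rV R d) d%:R r
        (fun x => eucl_norm (eucl_norm x `^ gamma *: gradient u x)%R))%E)
  /\
  (forall r s : \bar R, (1 <= r)%E -> (r <= s)%E ->
   (exists C : R, forall u : 'rV[R]_d -> R, Cc_infty u ->
     (lorentz_norm (lebesgue_rV R d) q s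
        (fun x => (eucl_norm x `^ (- beta) * u x)%R)
      <= C%:E * lorentz_norm (lebesgue_rV R d) d%:R r
        (fun x => eucl_norm (eucl_norm x `^ gamma *: gradient u x)%R))%E) ->
   beta + gamma = d%:R / q).
Proof.
have q0 : 0 < q by rewrite (lt_le_trans _ d_le_q)// ltr0n (leq_trans _ d_ge2).
have dq1 : d%:R / q <= 1 by rewrite ler_pdivrMr// mul1r.
split=> [bcq r s r1 rs|r s r1 rs HC].
  (* The sum of the exponents is d/q <= 1 and both are positive, so each is strictly below 1. *)
  have b1 : beta < 1 by move: bcq dq1 gamma_gt0; lra.
  have c1 : gamma < 1 by move: bcq dq1 beta_gt0; lra.
  exact: (lorentz_sobolev d_ge2 beta_gt0 b1 gamma_gt0 c1 q0 bcq r1 rs).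
exact: (necessary_scaling d_ge2 beta_gt0 gamma_gt0 q0 r1 rs HC).
Qed.
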